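(* Let $\delta\in(0,1]$, let $w\in A_{1+\delta/n}(\mathbb R^n)$ satisfy $\int_{\mathbb R^n}\frac{w(x)}{1+|x|^n}\,dx<\infty$, and let $b\in\mathrm{BMO}(\mathbb R^n)$. If the commutators $[b,R_j]$, $j\in\{1,\dots,n\}$, of the classical Riesz transforms $R_1,\dots,R_n$ on $\mathbb R^n$ are all bounded from $H^1_w(\mathbb R^n)$ into $L^1_w(\mathbb R^n)$, then $b\in\mathcal{BMO}_w(\mathbb R^n)$.
   Context: Weights: $A_q(\mathbb R^n)$, $q\in[1,\infty)$, is the usual Muckenhoupt class (defined with suprema over balls), and $A_\infty(\mathbb R^n)=\bigcup_{q\in[1,\infty)}A_q(\mathbb R^n)$. For a weight $w$ and measurable set $E$, $w(E)=\int_E w(x)\,dx$. $L^1_w(\mathbb R^n)$ is the space of measurable $f$ with $\|f\|_{L^1_w}=\int_{\mathbb R^n}|f(x)|w(x)\,dx<\infty$. BMO: for a ball $B$, $x_B$ is its center, $b_B=\frac1{|B|}\int_B b(x)\,dx$, and $B^\complement=\mathbb R^n\setminus B$. A locally integrable $b$ is in $\mathrm{BMO}(\mathbb R^n)$ if $\|b\|_{\mathrm{BMO}(\mathbb R^n)}=\sup_B\frac1{|B|}\int_B|b(x)-b_B|\,dx<\infty$. For $w\in A_\infty(\mathbb R^n)$ with $\int_{\mathbb R^n}\frac{w(x)}{1+|x|^n}dx<\infty$, a locally integrable $b$ is in $\mathcal{BMO}_w(\mathbb R^n)$ if $$\|b\|_{\mathcal{BMO}_w(\mathbb R^n)}:=\sup_B\left\{\int_{B^\complement}\frac{w(x)}{|x-x_B|^n}\,dx\;\frac1{w(B)}\int_B|b(x)-b_B|\,dx\right\}<\infty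 .$$ Both suprema are over all balls $B\subset\mathbb R^n$. Weighted Hardy space: fix a Schwartz function $\phi$ with $\phi(x)=1$ for all $x\in B(0,1)$, put $\phi_t(x)=t^{-n}\phi(x/t)$ and $\mathcal M_\phi f=\sup_{t\in(0,\infty)}|f*\phi_t|$ for $f\in\mathcal S'(\mathbb R^n)$. Then $H^1_w(\mathbb R^n)$ is the space of $f\in\mathcal S'(\mathbb R^n)$ with $\|f\|_{H^1_w(\mathbb R^n)}:=\|\mathcal M_\phi f\|_{L^1_w(\mathbb R^n)}<\infty$ (the space does not depend on the choice of $\phi$). Riesz transforms: $R_j$ is the singular integral operator, bounded on $L^2(\mathbb R^n)$, with kernel $c_n\frac{x_j-y_j}{|x-y|^{n+1}}$ (principal value), $c_n$ the usual dimensional constant. Commutator: $[b,R_j](f)=bR_j(f)-R_j(bf)$, which makes sense for bounded compactly supported $f$ when $b\in\mathrm{BMO}(\mathbb R^n)$ (then $f,bf\in L^2(\mathbb R^n)$). A continuous $(H^1_w(\mathbb R^n),\infty)$-atom is a continuous function $a$ supported in a ball $B$ with $\int a=0$ and $\|a\|_{L^\infty}\le w(B)^{-1}$; finite linear combinations of these are dense in $H^1_w(\mathbb R^n)$. ''$[b,R_j]$ is bounded from $H^1_w(\mathbb R^n)$ into $L^1_w(\mathbb R^n)$'' means that $[b,R_j]$, initially defined on finite linear combinations of continuous $(H^1_w(\mathbb R^n),\infty)$-atoms, extends to a bounded linear operator from $H^1_w(\mathbb R^n)$ to $L^1_w(\mathbb R^n)$. *)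

(* Defs.v *)
From HB Require Import structures.
From mathcomp Require Import all_boot all_order all_algebra.
From mathcomp Require Import all_classical all_reals all_analysis.
Set Implicit Arguments.
Unset Strict Implicit.
Unset Printing Implicit Defensive.
Import Order.TTheory GRing.Theory Num.Theory.
Import numFieldNormedType.Exports.
Local Open Scope classical_set_scope.
Local Open Scope ring_scope.

Definition rV_display : measure_display. Proof. exact: default_measure_display. Qed.

Section rV_measurable.
Context {R : realType} (n : nat).

(* This is the Borel sigma-algebra: measurability of functions below means
   Borel measurability, and every Lebesgue measurable function agrees almost
   everywhere with a Borel one. *)
Definition rV_measurable : set (set 'rV[R]_n) :=
  g_sigma_preimage (fun i (x : 'rV[R]_n) => x ord0 i : measurableTypeR R).

Let rV_measurable0 : rV_measurable set0.
Proof. exact: sigma_algebra0. Qed.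

Let rV_measurableC A : rV_measurable A -> rV_measurable (~` A).
Proof. exact: sigma_algebraC. Qed.

Let rV_measurable_bigcup (F : (set 'rV[R]_n)^nat) :
  (forall i, rV_measurable (F i)) -> rV_measurable (\bigcup_i F i).
Proof. exact: sigma_algebra_bigcup. Qed.

HB.instance Definition _ := @isMeasurable.Build rV_display
  'rV[R]_n rV_measurable rV_measurable0 rV_measurableC rV_measurable_bigcup.

End rV_measurable.

Section rV_measurable_lemmas.
Context {R : realType}.

Lemma measurable_rV_coord n (i : 'I_n) :
  measurable_fun [set: 'rV[R]_n] (fun x => x ord0 i : measurableTypeR R).
Proof.
move=> _ Y mY; rewrite setTI; apply: sub_sigma_algebra => /=.
rewrite -bigcup_seq/=; exists i => /=; first by rewrite mem_index_enum.
by exists Y => //; rewrite setTI.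
Qed.

Lemma measurable_rVP d (T : measurableType d) n (f : T -> 'rV[R]_n) :
  (forall i, measurable_fun [set: T] (fun t => f t ord0 i : measurableTypeR R)) ->
  measurable_fun [set: T] f.
Proof.
move=> mf _ Y mY; rewrite setTI; move: Y mY.
apply: smallest_sub => /=.
  split => [|A mA|F mF].
  - by rewrite /= preimage_set0.
  - by rewrite /= setTD -[_ @^-1` _]/(~` (f @^-1` A)); exact: measurableC.
  - by rewrite /= preimage_bigcup; exact: bigcup_measurable.
move=> A; rewrite -bigcup_seq => -[i _ [B mB <-]]; rewrite setTI.
by rewrite -comp_preimage -[X in measurable X]setTI; exact: mf.
Qed.

Definition rV_cons n (p : measurableTypeR R * 'rV[R]_n) : 'rV[R]_n.+1 :=
  row_mx (\row_(_ < 1) p.1) p.2.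

Definition rV_uncons n (x : 'rV[R]_n.+1) : measurableTypeR R * 'rV[R]_n :=
  (x ord0 ord0, @rsubmx _ 1 1 n x).

Lemma rV_consK n : cancel (@rV_cons n) (@rV_uncons n).
Proof.
move=> [a x]; rewrite /rV_cons /rV_uncons; congr pair.
  by rewrite mxE; case: splitP => // j _; rewrite mxE.
exact: row_mxKr.
Qed.

Lemma rV_unconsK n : cancel (@rV_uncons n) (@rV_cons n).
Proof.
move=> x; rewrite /rV_cons /rV_uncons /= -[RHS](@hsubmxK _ 1 1 n).
by congr (@row_mx _ 1 1 n _ _); apply/rowP => i; rewrite !mxE;
  congr (x _ _); apply/val_inj; rewrite /= (ord1 i).
Qed.

Lemma rV_cons_ord0 n t x : @rV_cons n (t, x) ord0 ord0 = t.
Proof. exact: (congr1 fst (rV_consK (t, x))). Qed.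

Lemma rV_uncons_lift n (x : 'rV[R]_n.+1) i :
  (@rV_uncons n x).2 ord0 i = x ord0 (lift ord0 i).
Proof. by rewrite mxE; congr (x _ _); exact/val_inj. Qed.

Lemma rV_cons_lift n t x i : @rV_cons n (t, x) ord0 (lift ord0 i) = x ord0 i.
Proof. by rewrite -rV_uncons_lift rV_consK. Qed.

Lemma measurable_rV_cons n : measurable_fun setT (@rV_cons n).
Proof.
apply: measurable_rVP => i; case: (@split_ordP 1 n i) => j ij.
  rewrite (_ : (fun _ => _) = fst) //; apply/funext => p.
  have -> : i = lshift n j by [].
  by apply: etrans (row_mxEl _ _ _ _) _; rewrite mxE.
rewrite (_ : (fun _ => _) = (fun x : 'rV_n => x ord0 j : measurableTypeR R) \o snd).
  by apply: measurableT_comp => //; exact: measurable_rV_coord.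
apply/funext => p.
have -> : i = rshift 1 j by [].
exact: row_mxEr.
Qed.

HB.instance Definition _ n :=
  isMeasurableFun.Build _ _ _ _ (@rV_cons n) (@measurable_rV_cons n).

Lemma measurable_rV_uncons n : measurable_fun setT (@rV_uncons n).
Proof.
apply: measurable_fun_pair => /=; first exact: measurable_rV_coord.
apply: measurable_rVP => i.
rewrite (_ : (fun _ => _) = fun x : 'rV_n.+1 =>
  x ord0 (rshift 1 i) : measurableTypeR R); last first.
  by apply/funext => x; rewrite mxE.
exact: (@measurable_rV_coord n.+1).
Qed.

End rV_measurable_lemmas.

Section leb_step.
Context {R : realType} (n : nat).
Variable mu : {sigma_finite_measure set 'rV[R]_n -> \bar R}.

Definition leb_step : set 'rV[R]_n.+1 -> \bar R :=
  pushforward (lebesgue_measure \x mu)%E (@rV_cons R n).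

Let leb_step0 : leb_step set0 = 0%E. Proof. exact: measure0. Qed.

Let leb_step_ge0 A : (0 <= leb_step A)%E. Proof. exact: measure_ge0. Qed.

Let leb_step_sigma_additive : semi_sigma_additive leb_step.
Proof. exact: measure_semi_sigma_additive. Qed.

HB.instance Definition _ := isMeasure.Build _ _ _ leb_step
  leb_step0 leb_step_ge0 leb_step_sigma_additive.

Let leb_step_sigma_finite : sigma_finite setT leb_step.
Proof.
have /sigma_finiteP[F [FT ndF Foo]] := sigma_finiteT (@lebesgue_measure R).
have /sigma_finiteP[G [GT ndG Goo]] := sigma_finiteT mu.
exists (fun k => @rV_uncons R n @^-1` (F k `*` G k)).
  rewrite -preimage_bigcup -(preimage_setT (@rV_uncons R n)).
  congr (_ @^-1` _); rewrite -setXTT FT GT predeqE => -[x y]; split.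
    move=> [/= [i _ Fix] [k _ Gky]]; exists (maxn i k) => //; split.
    - by move: x Fix; exact/subsetPset/ndF/leq_maxl.
    - by move: y Gky; exact/subsetPset/ndG/leq_maxr.
  by move=> [i _ []/= ? ?]; split; exists i.
move=> k; have [mF Fk] := Foo k; have [mG Gk] := Goo k; split.
  rewrite -[X in measurable X]setTI; apply: measurable_rV_uncons => //.
  exact: measurableX.
rewrite /leb_step /pushforward -comp_preimage (_ : _ \o _ = id); last first.
  by apply/funext => x /=; rewrite rV_consK.
by rewrite preimage_id product_measure1E// lte_mul_pinfty// ge0_fin_numE.
Qed.

HB.instance Definition _ := Measure_isSigmaFinite.Build _ _ _ leb_step
  leb_step_sigma_finite.

End leb_step.

(* Lebesgue measure, as the n-fold product of [lebesgue_measure]. *)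
Fixpoint leb {R : realType} (n : nat) :
    {sigma_finite_measure set 'rV[R]_n -> \bar R} :=
  match n with
  | 0 => @dirac _ 'rV[R]_0 0 R
  | m.+1 => leb_step (@leb R m)
  end.
Arguments leb {R} n.

Lemma leb_box {R : realType} n (a b : 'rV[R]_n) :
  (forall i, a ord0 i <= b ord0 i) ->
  leb n [set x : 'rV[R]_n | forall i, a ord0 i <= x ord0 i <= b ord0 i] =
  (\prod_(i < n) (b ord0 i - a ord0 i))%:E.
Proof.
elim: n a b => [|n IH] a b ab.
  by rewrite big_ord0 /= diracE mem_set//= => -[].
pose a' := (@rV_uncons R n a).2; pose b' := (@rV_uncons R n b).2.
pose box' := [set x : 'rV[R]_n | forall i, a' ord0 i <= x ord0 i <= b' ord0 i].
have pre : @rV_cons R n @^-1`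
      [set x : 'rV[R]_n.+1 | forall i, a ord0 i <= x ord0 i <= b ord0 i] =
    (`[a ord0 ord0, b ord0 ord0]%classic : set (measurableTypeR R)) `*` box'.
  apply/seteqP; split => -[t x] /=.
    move=> H; split; first by have := H ord0; rewrite rV_cons_ord0 in_itv.
    by move=> i; have := H (lift ord0 i); rewrite rV_cons_lift !rV_uncons_lift.
  move=> [/= tab H] i; have [j ->|->] := unliftP ord0 i.
    by rewrite rV_cons_lift -!rV_uncons_lift; exact: H.
  by rewrite rV_cons_ord0; move: tab; rewrite in_itv.
have mbox : measurable box'.
  have -> : box' = \bigcap_(i in [set: 'I_n])
      ((fun x : 'rV[R]_n => x ord0 i : measurableTypeR R) @^-1`
        `[a' ord0 i, b' ord0 i]%classic).
    apply/seteqP; split=> [x H i _|x H i] /=; first by rewrite in_itv/=; exact: H.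
    by have := H i I; rewrite /= in_itv.
  apply: fin_bigcap_measurable => // i _.
  rewrite -[X in measurable X]setTI; exact: measurable_rV_coord.
rewrite /= /leb_step /pushforward pre product_measure1E//= IH.
  rewrite lebesgue_measure_itv/= big_ord_recl.
  rewrite lte_fin -EFinB; case: ifPn => [_|].
    rewrite -EFinM; congr (_ * _)%:E.
    by apply: eq_bigr => i _; rewrite !rV_uncons_lift.
  rewrite -leNgt => ba; rewrite mul0e.
  have -> : b ord0 ord0 = a ord0 ord0 by apply/le_anti; rewrite ba ab.
  by rewrite subrr mul0r.
by move=> i; rewrite !rV_uncons_lift.
Qed.

Section function_spaces.
Context {R : realType} {n : nat}.
Local Notation Rn := 'rV[R]_n.
Local Notation mu := (@leb R n).
Implicit Types (w b f phi a : Rn -> R) (B E : set Rn).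

(* The norm [`|x|] of the library on ['rV[R]_n] is the sup norm. *)
Definition enorm (x : Rn) : R := Num.sqrt (\sum_i x ord0 i ^+ 2).

Definition eball (c : Rn) (r : R) : set Rn := [set x | enorm (x - c) < r].

Definition sup_balls (F : Rn -> R -> \bar R) : \bar R :=
  ereal_sup [set F p.1 p.2 | p in [set p : Rn * R | 0 < p.2]].

Definition eavg B (g : Rn -> \bar R) : \bar R :=
  ((fine (mu B))^-1%:E * \int[mu]_(x in B) g x)%E.

Definition avg B b : R := (fine (mu B))^-1 * \int[mu]_(x in B) b x.

Definition loc_integrable f : Prop :=
  measurable_fun setT f /\
  forall K, compact K -> (\int[mu]_(x in K) `|f x|%:E < +oo)%E.

Definition weight w : Prop :=
  [/\ loc_integrable w, forall x, 0 <= w x & {ae mu, forall x, 0 < w x}].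

Definition wmeas w E : \bar R := \int[mu]_(x in E) (w x)%:E.

(* The values of [w x `^ - (q - 1)^-1] where [w x = 0] are irrelevant, since
   a weight is positive almost everywhere. *)
Definition muckenhoupt (q : R) w : Prop :=
  [/\ 1 <= q, weight w &
    if q == 1 then
      exists C : R, forall (c : Rn) (r : R), 0 < r ->
        {ae mu, forall x, eball c r x ->
          (eavg (eball c r) (EFin \o w) <= (C * w x)%:E)%E}
    else
      (sup_balls (fun c r => eavg (eball c r) (EFin \o w) *
         (eavg (eball c r) (fun x => (w x `^ (- (q - 1)^-1))%:E)) `^ (q - 1))
       < +oo)%E].

Definition bmo_norm b : \bar R :=
  sup_balls (fun c r =>
    eavg (eball c r) (fun x => `|b x - avg (eball c r) b|%:E)).

Definition bmo b : Prop := loc_integrable b /\ (bmo_norm b < +oo)%E.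

Definition bmow_norm w b : \bar R :=
  sup_balls (fun c r =>
    \int[mu]_(x in ~` eball c r) (w x / enorm (x - c) ^+ n)%:E *
    ((fine (wmeas w (eball c r)))^-1%:E *
     \int[mu]_(x in eball c r) `|b x - avg (eball c r) b|%:E))%E.

Definition bmow w b : Prop := loc_integrable b /\ (bmow_norm w b < +oo)%E.

Definition L1w_norm w f : \bar R := \int[mu]_x (`|f x| * w x)%:E.

Definition L1w w f : Prop := measurable_fun setT f /\ (L1w_norm w f < +oo)%E.

Definition partial (i : 'I_n) f : Rn -> R := fun x => 'D_(delta_mx ord0 i) f x.

Definition partials (s : seq 'I_n) f : Rn -> R := foldr partial f s.

(* These seminorms, for [N : nat], generate the topology of the Schwartz
   space. *)
Definition schwartz_norm (N : nat) f : \bar R :=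
  ereal_sup [set ((1 + enorm p.2) ^+ N * `|partials p.1 f p.2|)%:E |
    p in [set p : seq 'I_n * Rn | (size p.1 <= N)%N]].

Definition schwartz f : Prop :=
  (forall s x, differentiable (partials s f) x) /\
  forall N, (schwartz_norm N f < +oo)%E.

(* A tempered distribution is given by a functional on all functions, of which
   only the values at Schwartz functions matter. *)
Definition tempered (F : (Rn -> R) -> R) : Prop :=
  (forall (k : R) f g, schwartz f -> schwartz g ->
     F (k \*o f \+ g) = k * F f + F g) /\
  exists (N : nat) (C : R), forall f, schwartz f ->
    (`|F f|%:E <= C%:E * schwartz_norm N f)%E.

Definition distr_of f : (Rn -> R) -> R := fun psi => \int[mu]_x (f x * psi x).

Definition dilate phi (t : R) : Rn -> R := fun x => t ^- n * phi (t^-1 *: x).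

Definition convol (F : (Rn -> R) -> R) phi : Rn -> R :=
  fun x => F (fun y => phi (x - y)).

Definition max_fun phi (F : (Rn -> R) -> R) (x : Rn) : \bar R :=
  ereal_sup [set `|convol F (dilate phi t) x|%:E | t in [set t : R | 0 < t]].

Definition H1w_norm phi w (F : (Rn -> R) -> R) : \bar R :=
  (\int[mu]_x (max_fun phi F x * (w x)%:E))%E.

Definition H1w phi w (F : (Rn -> R) -> R) : Prop :=
  tempered F /\ (H1w_norm phi w F < +oo)%E.

Definition Gamma (z : R) : R :=
  \int[lebesgue_measure]_(t in `]0, +oo[%classic) (t `^ (z - 1) * expR (- t)).

Definition riesz_const : R :=
  Gamma (n.+1%:R / 2) / pi `^ (n.+1%:R / 2).

Definition riesz_trunc (j : 'I_n) (e : R) f (x : Rn) : R :=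
  \int[mu]_(y in [set y | e < enorm (x - y)])
    (riesz_const * ((x ord0 j - y ord0 j) / enorm (x - y) ^+ n.+1) * f y).

(* The limit exists for almost every [x] when [f] is in L^2. *)
Definition riesz (j : 'I_n) f (x : Rn) : R :=
  lim (riesz_trunc j e f x @[e --> 0^'+]).

Definition commutator b (j : 'I_n) f : Rn -> R :=
  b \* riesz j f \- riesz j (b \* f).

Definition atom w a : Prop :=
  continuous a /\
  exists (c : Rn) (r : R),
    [/\ 0 < r,
        forall x, ~ eball c r x -> a x = 0,
        \int[mu]_x a x = 0 &
        (Lnorm mu +oo (EFin \o a) <= (fine (wmeas w (eball c r)))^-1%:E)%E].

Definition fin_atomic w f : Prop :=
  exists (m : nat) (k : 'I_m -> R) (a : 'I_m -> Rn -> R),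
    (forall i, atom w (a i)) /\ f = (fun x => \sum_(i < m) k i * a i x).

(* [T], defined on finite linear combinations of atoms, extends to a bounded
   linear operator from H^1_w to L^1_w. Elements of L^1_w are identified when
   equal almost everywhere; linearity and boundedness imply that [L F] depends,
   up to this identification, only on the values of [F] at Schwartz
   functions. *)
Definition bounded_H1w_L1w phi w (T : (Rn -> R) -> Rn -> R) : Prop :=
  exists L : ((Rn -> R) -> R) -> Rn -> R,
    [/\ forall F, H1w phi w F -> L1w w (L F),
        forall (k : R) F G, H1w phi w F -> H1w phi w G ->
          L (k \*o F \+ G) = k \*o L F \+ L G %[ae mu],
        exists C : R, forall F, H1w phi w F ->
          (L1w_norm w (L F) <= C%:E * H1w_norm phi w F)%E &
        forall f, fin_atomic w f -> L (distr_of f) = T f %[ae mu]].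

End function_spaces.

(* Main.v *)
(** Fix a ball B = B(c, r) and put O = \int_B |b - b_B|.  Since b - b_B has mean
    zero on B, there is a continuous H^1_w-atom a supported in B with
    \int (b - b_B) a >= O / (4 w(B)).  Atoms are bounded in H^1_w, hence the
    functions [b, R_j] a are bounded in L^1_w.  For x far from B,
      [b, R_j] a (x) = (b(x) - b_B) R_j a(x) - R_j((b - b_B) a)(x),
    where the last term is c_n (x_j - c_j) / |x - c|^(n+1) \int (b - b_B) a up to
    an error absorbed by it, and R_j a(x) decays like |x - c|^(-n-1).  Summing over j and
    integrating against w bounds O / w(B) * \int_{B^c} w / |x - c|^n.

    The term (b - b_B) R_j a is handled without the John-Nirenberg inequality:
    on most of the annulus 4^k r <= |x - c| < 4^(k+1) r, in the sense of
    Lebesgue measure and hence, by A_p, of w, |b - b_B| is at most a multiple of k.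
    The sum over k converges because w(B(c, 4^k r)) <= C (4^(n+1) t)^k w(B) for some
    t < 1: this improves on the doubling bound given by A_p with p <= 1 + 1/n,
    and follows from reverse doubling of the dual weight w^(-1/(p-1)). *)
Require Import Defs.
From mathcomp Require Import all_boot all_order all_algebra.
From mathcomp Require Import all_classical all_reals all_analysis.
From mathcomp Require Import measurable_realfun ess_sup_inf.
From mathcomp Require Import ring lra.
Set Implicit Arguments.
Unset Strict Implicit.
Unset Printing Implicit Defensive.
Import Order.TTheory GRing.Theory Num.Theory.
Import numFieldNormedType.Exports.
Local Open Scope classical_set_scope.
Local Open Scope ring_scope.

(** * Euclidean balls and the Borel sigma-algebra *)

(** The plain A_p bound with p = 1 + 1/n is exactly critical: it lets w(B(c, 4^k r)) grow like
    4^(k(n+1)), which cancels a decay of order n + 1 and leaves a divergent series. The gain t^k is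
    therefore used twice: for the tail of the maximal function of an atom, and for the error terms,
    where it also beats the factor k. Discarding the bad part of an annulus is cheap: the good part
    carries a fixed share of the w-mass of the whole ball B(c, 4^(k+1) r), and the good parts, being
    disjoint, still share one bound on the L^1_w norms of the commutators. All the Riesz transforms
    are needed together, since a single kernel x_j / |x|^(n+1) vanishes on a hyperplane. Freezing
    the kernel in R_j((b - b_B) a) costs a relative error of order r / |x - c|, so it can be
    absorbed only from some rank k0 on, which depends on n alone. The finitely many inner annuli are
    estimated without cancellation, from the BMO norm of b and the growth of w. In the constant 1/4
    for the atom, one factor 2 pays for making the sign of b - b_B continuous, compactly supported
    and of mean zero, the other for normalising the result. *)

Section enorm_theory.
Context {R : realType} {n : nat}.
Implicit Types x y z c : 'rV[R]_n.

Lemma enorm_ge0 x : 0 <= enorm x. Proof. exact: sqrtr_ge0. Qed.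

Lemma sqr_enorm x : enorm x ^+ 2 = \sum_i x ord0 i ^+ 2.
Proof. by rewrite sqr_sqrtr// sumr_ge0// => i _; rewrite sqr_ge0. Qed.

Lemma enorm_coord x i : `|x ord0 i| <= enorm x.
Proof.
rewrite -ler_sqr ?nnegrE ?enorm_ge0// sqr_enorm (bigD1 i)//= real_normK ?num_real//.
by rewrite lerDl sumr_ge0// => j _; rewrite sqr_ge0.
Qed.

Lemma enorm_eq0 x : enorm x = 0 -> x = 0.
Proof.
move=> x0; apply/rowP => i; rewrite mxE; apply/normr0_eq0/le_anti.
by rewrite normr_ge0 -x0 enorm_coord.
Qed.

Lemma enorm0 : enorm (0 : 'rV[R]_n) = 0.
Proof. by rewrite /enorm big1 ?sqrtr0// => i _; rewrite mxE expr0n. Qed.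

Lemma enormZ k x : enorm (k *: x) = `|k| * enorm x.
Proof.
rewrite /enorm (eq_bigr (fun i => k ^+ 2 * x ord0 i ^+ 2)); last first.
  by move=> i _; rewrite mxE exprMn.
by rewrite -mulr_sumr sqrtrM ?sqr_ge0// sqrtr_sqr.
Qed.

Lemma enormN x : enorm (- x) = enorm x.
Proof. by rewrite -scaleN1r enormZ normrN1 mul1r. Qed.

Lemma enormB x y : enorm (x - y) = enorm (y - x).
Proof. by rewrite -enormN opprB. Qed.

(** Cauchy-Schwarz from the weighted inequality x_i y_i <= (s/2) x_i^2 + y_i^2 / (2s). The choice
    [s = |y| / |x|] makes each of the two sums equal to |x| |y| / 2. *)
Lemma enorm_dot_le x y : \sum_i x ord0 i * y ord0 i <= enorm x * enorm y.
Proof.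
have [/enorm_eq0 ->|x0] := eqVneq (enorm x) 0.
  by rewrite enorm0 mul0r big1// => i _; rewrite mxE mul0r.
have [/enorm_eq0 ->|y0] := eqVneq (enorm y) 0.
  by rewrite enorm0 mulr0 big1// => i _; rewrite mxE mulr0.
have xp : 0 < enorm x by rewrite lt_neqAle eq_sym x0 enorm_ge0.
have yp : 0 < enorm y by rewrite lt_neqAle eq_sym y0 enorm_ge0.
pose s := enorm y / enorm x.
have sp : 0 < s by rewrite divr_gt0.
apply: (@le_trans _ _ (\sum_i (s / 2 * x ord0 i ^+ 2 + (2 * s)^-1 * y ord0 i ^+ 2))).
  apply: ler_sum => i _; rewrite -subr_ge0.
  have -> : s / 2 * x ord0 i ^+ 2 + (2 * s)^-1 * y ord0 i ^+ 2 - x ord0 i * y ord0 i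
     = (2 * s)^-1 * (s * x ord0 i - y ord0 i) ^+ 2.
    by field; rewrite gt_eqF.
  by rewrite mulr_ge0 ?sqr_ge0// invr_ge0 mulr_ge0// ltW.
rewrite big_split/= -!mulr_sumr -!sqr_enorm /s le_eqVlt; apply/orP; left.
by apply/eqP; field; rewrite x0 y0.
Qed.

Lemma enormD x y : enorm (x + y) <= enorm x + enorm y.
Proof.
rewrite -ler_sqr ?nnegrE ?addr_ge0 ?enorm_ge0// sqr_enorm.
rewrite (eq_bigr (fun i => x ord0 i ^+ 2 + y ord0 i ^+ 2 + 2 * (x ord0 i * y ord0 i))).
  rewrite big_split/= big_split/= -mulr_sumr -!sqr_enorm.
  have := enorm_dot_le x y; nra.
by move=> i _; rewrite mxE; ring.
Qed.

Lemma enorm_sub x y z : enorm (x - z) <= enorm (x - y) + enorm (y - z).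
Proof. by rewrite (le_trans _ (enormD _ _))// addrA subrK. Qed.

Lemma enorm_dist x y : `|enorm x - enorm y| <= enorm (x - y).
Proof.
have := enormD (x - y) y; have := enormD (y - x) x.
rewrite !subrK (enormB y x) => h1 h2.
by rewrite ler_norml; apply/andP; split; lra.
Qed.

Lemma enorm_le_sum x : enorm x <= \sum_i `|x ord0 i|.
Proof.
have s0 (P : pred 'I_n) : 0 <= \sum_(i | P i) `|x ord0 i| by apply: sumr_ge0.
rewrite -ler_sqr ?nnegrE ?enorm_ge0 ?s0// sqr_enorm expr2 mulr_suml ler_sum// => i _.
rewrite -real_normK ?num_real// expr2 ler_wpM2l//.
by rewrite (bigD1 i)//= lerDl s0.
Qed.

Lemma enorm_continuous : continuous (enorm : 'rV[R]_n -> R).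
Proof.
move=> x; apply: (@continuous_comp _ _ _ (fun x : 'rV[R]_n => \sum_i x ord0 i ^+ 2) Num.sqrt).
  apply: (continuous_big (@add_continuous R^o)) => i _ {}x.
  apply: (@continuous_comp _ _ _ (fun x : 'rV[R]_n => x ord0 i) (fun t => t ^+ 2)); first exact: coord_continuous.
  exact: exprn_continuous.
exact: sqrt_continuous.
Qed.

End enorm_theory.

Section rV_borel.
Context {R : realType} {n : nat}.

(** The sigma-algebra is generated by the coordinates, so an open set is exhibited as the union of
    the countably many sup-norm cubes, with rational centre and radius 1/(k+1), that it contains. *)
Lemma rV_open_measurable (U : set 'rV[R]_n) : open U -> measurable U.
Proof.
move=> oU.
pose Q (p : 'rV[rat]_n * nat) : set 'rV[R]_n :=
  \bigcap_(i in [set: 'I_n]) ((fun y : 'rV[R]_n => y ord0 i : measurableTypeR R) @^-1`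
     (ball (ratr (p.1 ord0 i) : R) (p.2.+1%:R^-1))).
have -> : U = \bigcup_p (if `[< Q p `<=` U >] then Q p else set0).
  apply/seteqP; split; last by move=> x [p _]; case: asboolP => // pU /pU.
  move=> x Ux; have /nbhs_ballP[e /= e0 xe] : nbhs x U by exact: open_nbhs_nbhs.
  have [k ke] : exists k : nat, k.+1%:R^-1 < e / 2.
    have e20 : 0 < e / 2 by rewrite divr_gt0.
    have := (@near_infty_natSinv_lt R (PosNum e20)) => -[k _ /(_ k)] /=.
    by move=> /(_ (leqnn _)) ?; exists k.
  have k0 : 0 < (k.+1%:R^-1 : R) by rewrite invr_gt0.
  have H i : exists q : rat, ball (ratr q : R) k.+1%:R^-1 (x ord0 i).
    move: k0 {ke}; set d : R := k.+1%:R^-1 => k0.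
    have : x ord0 i - d < x ord0 i + d by lra.
    move=> /rat_in_itvoo[q]; rewrite in_itv/= => /andP[h1 h2]; exists q.
    by rewrite /ball/= ltr_norml; apply/andP; split; lra.
  have [q qP] := choice H; exists (\row_i q i, k) => //.
  case: asboolP; first by move=> _ i _ /=; rewrite mxE.
  case=> y Qy; apply: xe; split => // i j; rewrite (ord1 i).
  have /= := Qy j I; rewrite mxE => h1; have /ball_sym h2 := qP j.
  apply: (@le_ball _ _ _ (k.+1%:R^-1 + k.+1%:R^-1)); first by rewrite (splitr e) ltW// ltrD.
  exact: ball_triangle h2 h1.
apply: countable_bigcupT_measurable => // p; case: asboolP => // _.
apply: fin_bigcap_measurable => // i _.
rewrite -[X in measurable X]setTI; apply: measurable_rV_coord => //.
exact: measurable_ball.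
Qed.

Lemma rV_continuous_measurable (f : 'rV[R]_n -> R) :
  continuous f -> measurable_fun setT f.
Proof.
move=> /continuousP cf; apply: (measurability _ (@RGenOInfty.measurableE R)).
move=> _ [_ [a ->] <-]; rewrite setTI; apply: rV_open_measurable.
by apply: cf; exact: interval_open.
Qed.

End rV_borel.

Section balls.
Context {R : realType} {n : nat}.
Implicit Types (c x : 'rV[R]_n) (r : R).

Lemma enormB_continuous c : continuous (fun x => enorm (x - c)).
Proof.
move=> x; apply: (@continuous_comp _ _ _ (fun x => x - c) enorm).
  by by refine (cvgB cvg_id (cvg_cst c)).
exact: enorm_continuous.
Qed.

Lemma enormB_measurable c : measurable_fun setT (fun x => enorm (x - c)).
Proof. by apply: rV_continuous_measurable; exact: enormB_continuous. Qed.

Lemma measurable_eball c r : measurable (eball c r).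
Proof.
apply: rV_open_measurable.
rewrite (_ : eball c r = (fun x => enorm (x - c)) @^-1` `]-oo, r[%classic).
  by have /continuousP := @enormB_continuous c; apply; exact: interval_open.
by apply/seteqP; split => x; rewrite /eball/= in_itv.
Qed.

Lemma eball_le c r s : r <= s -> eball c r `<=` eball c s.
Proof. by move=> rs x; rewrite /eball/= => /lt_le_trans; apply. Qed.

Definition box (a b : 'rV[R]_n) :=
  [set x : 'rV[R]_n | forall i, a ord0 i <= x ord0 i <= b ord0 i].

Definition cube c r := box (c - const_mx r) (c + const_mx r).

Lemma cubeP c r x : cube c r x <-> forall i, `|x ord0 i - c ord0 i| <= r.
Proof.
split=> H i; have := H i; rewrite ?mxE ler_norml.
  by move=> /andP[h1 h2]; apply/andP; split; lra.
by move=> /andP[h1 h2]; apply/andP; split; lra.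
Qed.

Lemma leb_cube c r : 0 <= r -> leb n (cube c r) = ((2 * r) ^+ n)%:E.
Proof.
move=> r0; rewrite leb_box; last by move=> i; rewrite !mxE; lra.
congr EFin; rewrite -[in RHS](card_ord n) -prodr_const; apply: eq_bigr => i _.
by rewrite !mxE; ring.
Qed.

Lemma compact_cube c r : compact (cube c r).
Proof.
rewrite (_ : cube c r = [set v | forall i,
  `[c ord0 i - r, c ord0 i + r]%classic (v ord0 i)]).
  by apply: (@rV_compact R n (fun i => `[c ord0 i - r, c ord0 i + r]%classic)) => i; exact: segment_compact.
by apply/seteqP; split => x H i; have := H i; rewrite /= !mxE in_itv.
Qed.

Lemma measurable_cube c r : measurable (cube c r).
Proof.
have -> : cube c r = \bigcap_(i in [set: 'I_n])
      ((fun x : 'rV[R]_n => x ord0 i : measurableTypeR R) @^-1`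
        `[c ord0 i - r, c ord0 i + r]%classic).
  apply/seteqP; split=> [x H i _|x H i] /=.
    by rewrite in_itv/=; have := H i; rewrite !mxE.
  by have := H i I; rewrite /= in_itv/= !mxE.
apply: fin_bigcap_measurable => // i _.
rewrite -[X in measurable X]setTI; exact: measurable_rV_coord.
Qed.

Lemma eball_sub_cube c r : eball c r `<=` cube c r.
Proof.
move=> x xr; apply/cubeP => i; apply/ltW/(le_lt_trans _ xr).
by have := enorm_coord (x - c) i; rewrite !mxE.
Qed.

(** Volumes are known for boxes, so a ball is trapped between two cubes. The half-side r/(2n) works
    because the Euclidean norm is at most the sum of the n coordinates, hence at most r/2. *)
Lemma cube_sub_eball c r : (0 < n)%N -> 0 < r ->
  cube c (r / (2 * n%:R)) `<=` eball c r.
Proof.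
move=> n0 r0 x /cubeP H; rewrite /eball/=; apply: (le_lt_trans (enorm_le_sum _)).
apply: (@le_lt_trans _ _ (\sum_(i < n) (r / (2 * n%:R)))).
  by apply: ler_sum => i _; rewrite !mxE; exact: H.
rewrite sumr_const card_ord -[X in X < _]mulr_natr.
have -> : r / (2 * n%:R) * n%:R = r / 2 by field; rewrite pnatr_eq0 -lt0n.
by lra.
Qed.

Lemma leb_eball_le c r : 0 <= r -> (leb n (eball c r) <= ((2 * r) ^+ n)%:E)%E.
Proof.
move=> r0; rewrite -(leb_cube c)//; apply: le_measure; last exact: eball_sub_cube.
  by rewrite inE; exact: measurable_eball.
by rewrite inE; exact: measurable_cube.
Qed.

Lemma leb_eball_ge c r : (0 < n)%N -> 0 < r ->
  (((r / n%:R) ^+ n)%:E <= leb n (eball c r))%E.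
Proof.
move=> n0 r0.
have -> : r / n%:R = 2 * (r / (2 * n%:R)) by field; rewrite pnatr_eq0 -lt0n.
rewrite -(leb_cube c).
  apply: le_measure; last exact: cube_sub_eball.
    by rewrite inE; exact: measurable_cube.
  by rewrite inE; exact: measurable_eball.
by rewrite divr_ge0 ?mulr_ge0// ltW.
Qed.

Lemma leb_eball_fin c r : leb n (eball c r) \is a fin_num.
Proof.
have [r0|r0] := leP 0 r.
  by rewrite ge0_fin_numE// (le_lt_trans (leb_eball_le _ r0))// ltry.
rewrite (_ : eball c r = set0) ?measure0// -subset0 => x.
by rewrite /eball/= => /lt_trans/(_ r0); rewrite ltNge enorm_ge0.
Qed.

Definition vol (A : set 'rV[R]_n) : R := fine (leb n A).

Lemma vol_eballE c r : leb n (eball c r) = (vol (eball c r))%:E.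
Proof. by rewrite /vol fineK// leb_eball_fin. Qed.

Lemma vol_eball_le c r : 0 <= r -> vol (eball c r) <= (2 * r) ^+ n.
Proof. by move=> r0; rewrite -lee_fin -vol_eballE leb_eball_le. Qed.

Lemma vol_eball_ge c r : (0 < n)%N -> 0 < r -> (r / n%:R) ^+ n <= vol (eball c r).
Proof. by move=> n0 r0; rewrite -lee_fin -vol_eballE leb_eball_ge. Qed.

Lemma vol_eball_gt0 c r : (0 < n)%N -> 0 < r -> 0 < vol (eball c r).
Proof.
move=> n0 r0; apply: lt_le_trans (vol_eball_ge c n0 r0).
by rewrite exprn_gt0// divr_gt0// ltr0n.
Qed.

Lemma loc_integrable_eball (f : 'rV[R]_n -> R) c r :
  loc_integrable f -> (leb n).-integrable (eball c r) (EFin \o f).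
Proof.
move=> [mf fK]; apply/integrableP; split.
  by apply: measurable_funTS; exact/measurable_EFinP.
apply: le_lt_trans (fK _ (@compact_cube c r)).
apply: ge0_subset_integral => //; last exact: eball_sub_cube.
- exact: measurable_eball.
- exact: measurable_cube.
- by apply: measurable_funTS; apply/measurable_EFinP; exact: measurableT_comp.
Qed.

End balls.

(** * Muckenhoupt weights *)

Definition wm {R : realType} {n : nat} (v : 'rV[R]_n -> R) E : R := fine (wmeas v E).

(** The constant 1 is also a density, so every statement about [wm] specialises to Lebesgue volume;
    w, its dual weight and volume are treated uniformly. *)
Definition density {R : realType} {n : nat} (v : 'rV[R]_n -> R) :=
  [/\ measurable_fun setT v, forall x, 0 <= v x &
      forall c r, (wmeas v (eball c r) < +oo)%E].

Section density_theory.
Context {R : realType} {n : nat}.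
Implicit Types (v : 'rV[R]_n -> R) (c x : 'rV[R]_n) (r : R) (E F : set 'rV[R]_n).

Lemma measurable_EFin_fun v E : measurable_fun setT v -> measurable_fun E (EFin \o v).
Proof. by move=> mv; apply: measurable_funTS; exact/measurable_EFinP. Qed.

Lemma wmeas1 E : measurable E -> wmeas (cst 1 : 'rV[R]_n -> R) E = leb n E.
Proof. by move=> mE; have := @integral_cst _ _ _ (leb n) E mE 1%E; rewrite mul1e. Qed.

Lemma density1 : density (cst 1 : 'rV[R]_n -> R).
Proof.
split=> // c r; rewrite wmeas1; last exact: measurable_eball.
by rewrite -ge0_fin_numE ?leb_eball_fin.
Qed.

Lemma wm1 E : measurable E -> wm (cst 1 : 'rV[R]_n -> R) E = vol E.
Proof. by move=> mE; rewrite /wm wmeas1. Qed.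

Lemma le_wmeas v E F : density v -> measurable E -> measurable F -> E `<=` F ->
  (wmeas v E <= wmeas v F)%E.
Proof.
move=> [mv v0 _] mE mF EF; apply: ge0_subset_integral => //.
  exact: measurable_EFin_fun.
by move=> x _; rewrite lee_fin.
Qed.

Lemma wmeas_ge0 v E : density v -> (0 <= wmeas v E)%E.
Proof. by move=> [mv v0 _]; apply: integral_ge0 => x _; rewrite lee_fin. Qed.

Lemma wm_ge0 v E : density v -> 0 <= wm v E.
Proof. by move=> dv; apply: fine_ge0; exact: wmeas_ge0. Qed.

Lemma wmE v E c r : density v -> measurable E -> E `<=` eball c r ->
  wmeas v E = (wm v E)%:E.
Proof.
move=> dv mE Er; rewrite /wm fineK// ge0_fin_numE ?wmeas_ge0//.
case: (dv) => _ _ /(_ c r); apply: le_lt_trans.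
by apply: le_wmeas => //; exact: measurable_eball.
Qed.

Lemma wm_eballE v c r : density v -> wmeas v (eball c r) = (wm v (eball c r))%:E.
Proof. by move=> dv; apply: (@wmE v _ c r) => //; exact: measurable_eball. Qed.

Lemma le_wm v E F c r : density v -> measurable E -> measurable F -> E `<=` F ->
  F `<=` eball c r -> wm v E <= wm v F.
Proof.
move=> dv mE mF EF Fr.
rewrite -lee_fin -(@wmE v E c r)// -?(@wmE v F c r)//; first exact: le_wmeas.
exact: subset_trans Fr.
Qed.

Lemma wm_setU v E F c r : density v -> measurable E -> measurable F ->
  [disjoint E & F] -> E `|` F `<=` eball c r -> wm v (E `|` F) = wm v E + wm v F.
Proof.
move=> dv mE mF dEF EFr; apply: EFin_inj.
rewrite EFinD -(@wmE v E c r)//; last exact: subset_trans EFr.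
rewrite -(@wmE v F c r)//; last exact: subset_trans EFr.
rewrite -(@wmE v _ c r)//; last exact: measurableU.
case: dv => mv v0 _; rewrite /wmeas ge0_integral_setU//.
  exact: measurable_EFin_fun.
by move=> x _; rewrite lee_fin.
Qed.

Lemma leb_vol E c r : measurable E -> E `<=` eball c r -> leb n E = (vol E)%:E.
Proof.
move=> mE Er; rewrite /vol fineK// ge0_fin_numE//.
apply: (@le_lt_trans _ _ (leb n (eball c r))).
  by apply: le_measure => //; rewrite inE//; exact: measurable_eball.
by rewrite -ge0_fin_numE ?leb_eball_fin.
Qed.

Lemma vol_ge0 E : 0 <= vol E. Proof. exact: fine_ge0. Qed.

Lemma le_vol E F c r : measurable E -> measurable F -> E `<=` F ->
  F `<=` eball c r -> vol E <= vol F.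
Proof.
move=> mE mF EF Fr; rewrite -!wm1//; apply: (@le_wm _ _ _ c r) => //.
exact: density1.
Qed.

Lemma wm_gt0 v E c r : density v -> {ae leb n, forall x, 0 < v x} ->
  measurable E -> E `<=` eball c r -> 0 < vol E -> 0 < wm v E.
Proof.
move=> dv vpos mE Er; apply: contraTT.
rewrite -leNgt => vE0; have {}vE0 : wmeas v E = 0%E.
  by rewrite (@wmE _ _ c r)//; congr EFin; apply/le_anti; rewrite vE0 wm_ge0.
case: dv => mv v0 _.
have : (\int[leb n]_(x in E) `|(v x)%:E| = 0)%E.
  by rewrite -[RHS]vE0; apply: eq_integral => x _; rewrite gee0_abs// lee_fin.
move/(ae_eq_integral_abs (leb n) mE (measurable_EFin_fun mv)) => v_eq0.
have : {ae leb n, forall x, ~ E x}.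
  by apply: filterS2 vpos v_eq0 => x vx + Ex => /(_ Ex) [] /eqP; rewrite gt_eqF.
move=> [N [mN N0 subN]]; rewrite -leNgt /vol (_ : leb n _ = 0%E)//.
by apply: (subset_measure0 _ _ _ N0) => // x Ex; apply: subN => /= /(_ Ex).
Qed.

(** Translate the ball by [2 * r] along the first basis vector. This ball witnesses that a dilated
    ball minus the original one keeps a definite share of the volume, for reverse doubling and for
    the annuli. *)
Lemma ball_in_annulus (n0 : (0 < n)%N) c r : exists c',
  eball c' r `<=` eball c (3 * r) /\ [disjoint eball c r & eball c' r].
Proof.
pose e : 'rV[R]_n := delta_mx ord0 (Ordinal n0).
have e1 : enorm e = 1.
  rewrite /enorm (bigD1 (Ordinal n0))//= big1 ?addr0.
    by rewrite mxE !eqxx expr1n sqrtr1.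
  by move=> i i0; rewrite mxE (negbTE i0) andbF expr0n.
exists (c + (2 * r) *: e); split.
  move=> x; rewrite /eball/= => xr; have r0 := le_lt_trans (enorm_ge0 _) xr.
  apply: (le_lt_trans (enorm_sub _ (c + (2 * r) *: e) _)).
  rewrite [X in _ + enorm X]addrAC subrr add0r enormZ e1 gtr0_norm ?mulr_gt0//.
  by lra.
apply/disj_setPS => x [] /=; rewrite /eball/= => h1 h2.
have r0 := le_lt_trans (enorm_ge0 _) h1.
have := enorm_sub c x (c + (2 * r) *: e).
have -> : enorm (c - (c + (2 * r) *: e)) = 2 * r.
  by rewrite opprD addNKr enormN enormZ e1 gtr0_norm ?mulr_gt0// mulr1.
rewrite (enormB c).
by lra.
Qed.

Lemma sup_balls_bounded (G : 'rV[R]_n -> R -> \bar R) : (sup_balls G < +oo)%E ->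
  exists2 K : R, 0 < K & forall c r, 0 < r -> (G c r <= K%:E)%E.
Proof.
move=> Glty; have Gle c r : 0 < r -> (G c r <= sup_balls G)%E.
  by move=> r0; apply: ereal_sup_ubound; exists (c, r).
move: (sup_balls G) Glty Gle => [s| |] // _ Gle.
  exists (`|s| + 1); first by rewrite ltr_wpDl.
  move=> c r /(Gle c) h; rewrite (le_trans h)// lee_fin.
  by rewrite (le_trans (ler_norm s))// lerDl.
by exists 1 => // c r /(Gle c) h; rewrite (le_trans h)// leNye.
Qed.

End density_theory.

Section muckenhoupt_theory.
Context {R : realType} {n : nat}.
Variables (n0 : (0 < n)%N) (p : R) (p1 : 1 < p) (w : 'rV[R]_n -> R).
Hypothesis Apw : muckenhoupt p w.
Implicit Types (c x : 'rV[R]_n) (r : R) (E F : set 'rV[R]_n).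
Local Notation mu := (leb n).

Definition dual_weight x := w x `^ (- (p - 1)^-1).
Local Notation sg := dual_weight.

Let wpos : {ae mu, forall x, 0 < w x}. Proof. by case: Apw => _ []. Qed.

Let p1_gt0 : 0 < p - 1. Proof. by rewrite subr_gt0. Qed.
Let p_gt0 : 0 < p. Proof. exact: lt_trans p1. Qed.

Lemma muckenhoupt_density : density w.
Proof.
case: Apw => _ [lw w0 _] _; split=> //; first by case: lw.
move=> c r; have /integrableP[_] := loc_integrable_eball c r lw.
by under eq_integral do rewrite /= ger0_norm//.
Qed.
Local Notation dw := muckenhoupt_density.

Lemma muckenhoupt_gt0 c r : 0 < r -> 0 < wm w (eball c r).
Proof.
move=> r0; apply: (@wm_gt0 _ _ _ _ c r) => //; first exact: dw.
  exact: measurable_eball.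
exact: vol_eball_gt0.
Qed.

Lemma measurable_dual_weight : measurable_fun setT sg.
Proof.
by case: dw => mw _ _; exact: (measurableT_comp (measurable_powR _) mw).
Qed.

Let sg0 x : 0 <= sg x. Proof. exact: powR_ge0. Qed.

Let sup_bound : exists2 K : R, 0 < K & forall c r, 0 < r ->
  (eavg (eball c r) (EFin \o w) * (eavg (eball c r) (EFin \o sg)) `^ (p - 1) <= K%:E)%E.
Proof.
by case: Apw => _ _; rewrite gt_eqF// => /sup_balls_bounded[K K0 h]; exists K.
Qed.

(** If the dual weight had infinite mass on a ball, the A_p product of that ball would be infinite,
    because w(B) > 0 and p - 1 > 0. *)
Lemma dual_density : density sg.
Proof.
split=> //; first exact: measurable_dual_weight.
move=> c r; have [r0|r0] := leP r 0.
  rewrite (_ : eball c r = set0) ?/wmeas ?integral_set0// -subset0 => x.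
  by rewrite /eball/= => /lt_le_trans/(_ r0); rewrite ltNge enorm_ge0.
have [K K0 /(_ c r r0)] := sup_bound.
have V0 := vol_eball_gt0 c n0 r0.
rewrite ltey; apply: contraTN => /eqP sgoo.
rewrite /eavg -/(wmeas w _) -/(wmeas sg _) sgoo wm_eballE; last exact: dw.
rewrite -/(vol _) -EFinM mulry gtr0_sg ?invr_gt0// mul1e poweRyr ?gt_eqF//.
by rewrite mulry gtr0_sg ?mul1e ?leye_eq// mulr_gt0 ?invr_gt0 ?muckenhoupt_gt0.
Qed.

Lemma muckenhoupt_bound : exists2 K : R, 0 < K & forall c r, 0 < r ->
  wm w (eball c r) * wm sg (eball c r) `^ (p - 1) <= K * vol (eball c r) `^ p.
Proof.
have [K K0 h] := sup_bound; exists K => // c r r0; have := h c r r0.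
have V0 := vol_eball_gt0 c n0 r0.
rewrite /eavg -/(wmeas w _) -/(wmeas sg _) -/(vol _).
rewrite (wm_eballE _ _ dw) (wm_eballE _ _ dual_density) -!EFinM lee_fin.
rewrite powRM; [|by rewrite invr_ge0 ltW|by apply: wm_ge0; exact: dual_density].
have -> : (vol (eball c r))^-1 = vol (eball c r) `^ (-1) by rewrite powRN powRr1// ltW.
rewrite -powRrM mulN1r.
set V := vol _; set W := wm w _; set S := _ `^ (p - 1).
have -> : V `^ (-1) * W * (V `^ (- (p - 1)) * S) = W * S * (V `^ (-1) * V `^ (- (p - 1))).
  by ring.
rewrite -powRD; last by apply/implyP => _; rewrite gt_eqF.
have -> : -1 - (p - 1) = - p by ring.
by rewrite powRN ler_pdivrMr// powR_gt0.
Qed.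

(** Hölder's inequality with exponents p and p/(p-1) for w^(1/p) and the matching power of the dual
    weight, whose product is 1 almost everywhere on E. It reverses [muckenhoupt_bound] and holds on
    arbitrary subsets of a ball, which is the source of all comparisons below. *)
Lemma vol_le_holder E c r : measurable E -> E `<=` eball c r ->
  vol E `^ p <= wm w E * wm sg E `^ (p - 1).
Proof.
move=> mE Er; have [mw w0 _] := dw.
pose q := p / (p - 1).
have q0 : 0 < q by rewrite divr_gt0.
have pq : p^-1 + q^-1 = 1 by rewrite /q; field; rewrite !gt_eqF.
pose f x := w x `^ p^-1 * \1_E x.
pose g x := sg x `^ q^-1 * \1_E x.
have mf : measurable_fun setT f.
  apply: measurable_funM; last exact: measurable_indic.
  exact: (measurableT_comp (measurable_powR _) mw).
have mg : measurable_fun setT g.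
  apply: measurable_funM; last exact: measurable_indic.
  exact: (measurableT_comp (measurable_powR _) measurable_dual_weight).
have := hoelder mu mf mg p_gt0 q0 pq.
have Np (v : 'rV[R]_n -> R) (e : R) : 0 < e -> (forall x, 0 <= v x) ->
  ('N[mu]_e%:E [EFin \o (fun x => v x `^ e^-1 * \1_E x)%R] = wmeas v E `^ e^-1)%E.
  move=> e0 v0; rewrite unlock; congr (_ `^ _)%E.
  rewrite /wmeas [RHS]integral_mkcond; apply: eq_integral => x _.
  rewrite /= patchE indicE; case: (x \in E); rewrite ?mulr1 ?mulr0.
    by rewrite ger0_norm ?powR_ge0// -powRrM mulVf ?gt_eqF// powRr1.
  by rewrite normr0 powR0// gt_eqF.
rewrite Np// Np// => H.
have {H} : (mu E <= wmeas w E `^ p^-1 * wmeas sg E `^ q^-1)%E.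
  apply: le_trans H; rewrite Lnorm1 -wmeas1// /wmeas [leLHS]integral_mkcond.
  apply: ae_ge0_le_integral => //.
  - by move=> x _; rewrite patchE; case: ifP => //= _; rewrite lee_fin.
  - by apply: (iffLR (measurable_restrictT _ mE)); exact: (@measurable_EFin_fun _ _ (cst 1) E (measurable_cst _)).
  - do 2! apply: measurableT_comp => //; exact: measurable_funM.
  (* Where [w x > 0] the exponents [p^-1] and [- (p - 1)^-1 * q^-1] of [w x] add up to 0. *)
  apply: filterS wpos => x wx _; rewrite patchE/=; case: ifPn => [xE|_]; last by rewrite -[leLHS]/(0%:E) lee_fin.
  rewrite lee_fin /f /g indicE xE !mulr1 ger0_norm ?mulr_ge0 ?powR_ge0//.
  rewrite /dual_weight -powRrM -powRD; last by apply/implyP => _; rewrite gt_eqF.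
  rewrite (_ : p^-1 + _ = 0) ?powRr0// /q; field.
  by rewrite !gt_eqF.
rewrite (leb_vol mE Er) (wmE dw mE Er) (wmE dual_density mE Er) -EFinM lee_fin.
move=> /(ge0_ler_powR (ltW p_gt0)); rewrite !nnegrE vol_ge0 mulr_ge0 ?powR_ge0// => /(_ isT isT).
move/le_trans; apply; rewrite powRM ?powR_ge0// -!powRrM mulVf ?gt_eqF//.
rewrite powRr1; last exact: wm_ge0 dw.
by rewrite (_ : q^-1 * p = p - 1)// /q; field; rewrite !gt_eqF.
Qed.

End muckenhoupt_theory.

(** The factor (2n)^n comes from comparing balls with cubes instead of scaling the measure; it does
    not depend on k, which is all that matters. *)
Lemma vol_growth_ball {R : realType} n (c : 'rV[R]_n) (r : R) k : (0 < n)%N -> 0 < r ->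
  vol (eball c (4 ^+ k * r)) <= (2 * n%:R) ^+ n * (4 ^+ k) ^+ n * vol (eball c r).
Proof.
move=> n0 r0; have rk0 : 0 < 4 ^+ k * r by rewrite mulr_gt0// exprn_gt0.
apply: (le_trans (vol_eball_le _ (ltW rk0))).
have A0 : 0 <= (2 * n%:R) ^+ n * (4 ^+ k) ^+ n :> R.
  by rewrite mulr_ge0// !exprn_ge0// ?mulr_ge0// exprn_ge0.
apply: le_trans (ler_wpM2l A0 (vol_eball_ge c n0 r0)).
rewrite -!exprMn le_eqVlt; apply/orP; left; apply/eqP; congr (_ ^+ _).
by field; rewrite pnatr_eq0 -lt0n.
Qed.

(** * Comparability and growth of a Muckenhoupt weight *)

Section muckenhoupt_growth.
Context {R : realType} {n : nat}.
Variables (n0 : (0 < n)%N) (p : R) (p1 : 1 < p) (w : 'rV[R]_n -> R).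
Hypothesis Apw : muckenhoupt p w.
Implicit Types (c x : 'rV[R]_n) (r : R) (E F : set 'rV[R]_n).
Local Notation mu := (leb n).
Local Notation sg := (dual_weight p w).
Let dw := muckenhoupt_density Apw.
Let ds : density sg := dual_density n0 p1 Apw.
Let p1_gt0 : 0 < p - 1. Proof. by rewrite subr_gt0. Qed.
Let p_gt0 : 0 < p. Proof. exact: lt_trans p1. Qed.

Let le_powR (a b e : R) : 0 < e -> 0 <= a -> a <= b -> a `^ e <= b `^ e.
Proof.
move=> e0 a0 ab; apply: ge0_ler_powR => //; first exact: ltW.
by rewrite nnegrE (le_trans a0).
Qed.

Let vol_pow_le (eta : R) c r E : 0 < eta -> 0 < r -> measurable E ->
  E `<=` eball c r -> eta * vol (eball c r) <= vol E ->
  eta `^ p * vol (eball c r) `^ p <= wm w E * wm sg E `^ (p - 1).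
Proof.
move=> e0 r0 mE Er h; rewrite -(powRM _ (ltW e0) (vol_ge0 _)).
apply: le_trans (vol_le_holder n0 p1 Apw mE Er).
by apply: le_powR => //; rewrite mulr_ge0 ?vol_ge0// ltW.
Qed.

(** The dual factor [S] is divided out of the A_p bound and the Hölder bound; the latter forces it
    to be nonzero. *)
Let ratio_le (e V W K S wE : R) : 0 < e -> 0 < V -> 0 < K -> 0 <= S ->
  W * S <= K * V -> e * V <= wE * S -> e / K * W <= wE.
Proof.
move=> e0 V0 K0 S_ge0 h1 h2; have S0 : 0 < S.
  rewrite lt_neqAle S_ge0 andbT eq_sym; apply/eqP => S0.
  by move: h2; rewrite S0 mulr0 leNgt mulr_gt0.
rewrite mulrAC ler_pdivrMr// -(ler_pM2r S0).
have := ler_wpM2l (ltW e0) h1; have := ler_wpM2l (ltW K0) h2; lra.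
Qed.

(** Hölder on E, then sg(E) <= sg(B), then the A_p bound on B: the dual mass cancels and the share
    of E is at least eta^p / K. *)
Lemma muckenhoupt_ainfty (eta : R) : 0 < eta -> exists2 kappa, 0 < kappa &
  forall c r E, 0 < r -> measurable E -> E `<=` eball c r ->
    eta * vol (eball c r) <= vol E -> kappa * wm w (eball c r) <= wm w E.
Proof.
move=> e0; have [K K0 HK] := muckenhoupt_bound n0 p1 Apw.
have ep0 : 0 < eta `^ p by rewrite powR_gt0.
exists (eta `^ p / K); first by rewrite divr_gt0.
move=> c r E r0 mE Er h; have h2 := vol_pow_le e0 r0 mE Er h.
have V0 : 0 < vol (eball c r) `^ p by rewrite powR_gt0// vol_eball_gt0.
apply: (ratio_le ep0 V0 K0 (powR_ge0 _ _) (HK c r r0)).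
apply: (le_trans h2); apply: ler_wpM2l; first exact: wm_ge0.
apply: le_powR => //; first exact: wm_ge0.
by apply: (@le_wm _ _ _ _ _ c r) => //; exact: measurable_eball.
Qed.

(** The same two inequalities with the roles exchanged: here w(E) <= w(B) is used and w(B) cancels,
    which leaves a bound on the power p - 1 of the dual mass. *)
Lemma dual_ainfty (eta : R) : 0 < eta -> exists2 kappa, 0 < kappa &
  forall c r E, 0 < r -> measurable E -> E `<=` eball c r ->
    eta * vol (eball c r) <= vol E -> kappa * wm sg (eball c r) <= wm sg E.
Proof.
move=> e0; have [K K0 HK] := muckenhoupt_bound n0 p1 Apw.
have ep0 : 0 < eta `^ p by rewrite powR_gt0.
have eK0 : 0 < eta `^ p / K by rewrite divr_gt0.
exists ((eta `^ p / K) `^ (p - 1)^-1); first by rewrite powR_gt0.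
move=> c r E r0 mE Er h; have h2 := vol_pow_le e0 r0 mE Er h.
have V0 : 0 < vol (eball c r) `^ p by rewrite powR_gt0// vol_eball_gt0.
have W0 := muckenhoupt_gt0 n0 Apw c r0.
have h3 : eta `^ p / K * wm sg (eball c r) `^ (p - 1) <= wm sg E `^ (p - 1).
  have h1 := HK c r r0; rewrite mulrC in h1.
  apply: (ratio_le ep0 V0 K0 (ltW W0) h1).
  apply: (le_trans h2); rewrite mulrC; apply: ler_wpM2l; first exact: powR_ge0.
  by apply: (@le_wm _ _ _ _ _ c r) => //; exact: measurable_eball.
have p10 : 0 < (p - 1)^-1 by rewrite invr_gt0.
have := le_powR p10 (mulr_ge0 (ltW eK0) (powR_ge0 _ _)) h3.
rewrite (powRM _ (ltW eK0) (powR_ge0 _ _)) -!(powRrM (wm _ _)) mulfV ?gt_eqF//.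
by rewrite (powRr1 (wm_ge0 _ ds)) (powRr1 (wm_ge0 _ ds)).
Qed.

(** The disjoint translate of B(c, r) fills at least (8n)^-n of the volume of B(c, 4r), since
    (r/n)^n and (8r)^n bound the two volumes. It thus takes a fixed share k of the dual mass, and at
    most 1 - k is left for B(c, r). *)
Lemma dual_reverse_doubling : exists2 rho : R, 0 < rho < 1 &
  forall c r, 0 < r -> wm sg (eball c r) <= rho * wm sg (eball c (4 * r)).
Proof.
have n0R : 0 < (n%:R : R) by rewrite ltr0n.
have e0 : 0 < ((8 * n%:R) ^- n : R) by rewrite invr_gt0 exprn_gt0// mulr_gt0.
have [k k0 Hk] := dual_ainfty e0.
(* The maximum with 1/2 only secures [0 < rho]. *)
exists (Num.max (1 - k) 2^-1).
  by rewrite lt_max gt_max; apply/andP; split; [|apply/andP; split]; lra.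
move=> c r r0; have [c' [c'3 dis]] := ball_in_annulus n0 c r.
have r40 : 0 < 4 * r by rewrite mulr_gt0.
have B'4 : eball c' r `<=` eball c (4 * r).
  by apply: subset_trans c'3 _; apply: eball_le; lra.
have B4 : eball c r `<=` eball c (4 * r) by apply: eball_le; lra.
have mB a s := @measurable_eball R n a s.
have h1 : k * wm sg (eball c (4 * r)) <= wm sg (eball c' r).
  apply: Hk => //; apply: le_trans (vol_eball_ge c' n0 r0).
  rewrite ler_pdivrMl ?exprn_gt0 ?mulr_gt0//.
  apply: (le_trans (vol_eball_le _ (ltW r40))).
  rewrite -exprMn lerXn2r ?nnegrE ?mulr_ge0 ?divr_ge0 ?(ltW r0)//.
  by rewrite le_eqVlt; apply/orP; left; apply/eqP; field; rewrite gt_eqF.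
have h2 : wm sg (eball c r) + wm sg (eball c' r) <= wm sg (eball c (4 * r)).
  rewrite -(@wm_setU _ _ _ _ _ c (4 * r))//; last by rewrite subUset.
  apply: (@le_wm _ _ _ _ _ c (4 * r)) => //; first exact: measurableU.
  by rewrite subUset.
apply: (@le_trans _ _ ((1 - k) * wm sg (eball c (4 * r)))).
  by rewrite mulrBl mul1r lerBrDr (le_trans _ h2)// lerD2l.
by rewrite ler_wpM2r ?wm_ge0// le_max lexx.
Qed.

Let growth_alg (K D Q V W t S : R) :
  K * D * Q * V <= K * D * Q * (W * (t * S)) -> K * (D * Q * V) <= K * D * (Q * t) * W * S.
Proof. by move=> h; rewrite (le_trans _ (le_trans h _)) // le_eqVlt; apply/orP; left; apply/eqP; ring. Qed.

(** With B_k = B(c, 4^k r), A_p on B_k and Hölder on B bound w(B_k) / w(B) by K (|B_k| / |B|)^p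
    (sg(B) / sg(B_k))^(p-1). The volume ratio contributes 4^(k(n+1)) up to a constant; k-fold
    reverse doubling of [sg] contributes t^k with t = rho^(p-1). *)
Lemma muckenhoupt_growth : p <= 1 + n%:R^-1 -> exists C t : R, [/\ 0 < C, 0 < t < 1 &
  forall c r k, 0 < r -> wm w (eball c (4 ^+ k * r)) <=
    C * (4 ^+ n.+1 * t) ^+ k * wm w (eball c r)].
Proof.
move=> pn; have n0R : 0 < (n%:R : R) by rewrite ltr0n.
have [K K0 HK] := muckenhoupt_bound n0 p1 Apw.
have [rho /andP[rho0 rho1] Hrho] := dual_reverse_doubling.
pose D : R := ((2 * n%:R) ^+ n) `^ p.
have D0 : 0 < D by rewrite powR_gt0// exprn_gt0// mulr_gt0.
exists (K * D), (rho `^ (p - 1)); split; first exact: mulr_gt0.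
  have one : 1 `^ (p - 1) = 1 :> R by rewrite powR1.
  by rewrite powR_gt0//= -[ltRHS]one gt0_ltr_powR// nnegrE// (ltW rho0).
move=> c r k r0.
pose rk := 4 ^+ k * r; have rk0 : 0 < rk by rewrite mulr_gt0// exprn_gt0.
have sgk : wm sg (eball c r) <= rho ^+ k * wm sg (eball c rk).
  rewrite /rk; elim: k {rk rk0} => [|k IH]; first by rewrite !mul1r.
  rewrite (le_trans IH)// exprSr -mulrA ler_wpM2l ?exprn_ge0 ?(ltW rho0)//.
  by rewrite exprS -mulrA Hrho// mulr_gt0// exprn_gt0.
have V0 := vol_eball_gt0 c n0 r0.
have := vol_le_holder n0 p1 Apw (measurable_eball c r) (@subset_refl _ (eball c r)).
set S0 := wm sg (eball c r) `^ (p - 1); have := HK c _ rk0; set Sk := wm sg (eball c rk) `^ (p - 1).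
move=> h1 h2.
have h3 : S0 <= (rho `^ (p - 1)) ^+ k * Sk.
  have -> : (rho `^ (p - 1)) ^+ k = (rho ^+ k) `^ (p - 1).
    rewrite -[LHS]powR_mulrn; last exact: powR_ge0.
    by rewrite powRAC (powR_mulrn _ (ltW rho0)).
  have rk0' : 0 <= rho ^+ k by rewrite exprn_ge0// (ltW rho0).
  rewrite /Sk -(powRM _ rk0' (wm_ge0 _ ds)).
  by apply: le_powR => //; exact: wm_ge0.
have W0 := wm_ge0 (eball c r) dw.
have VV : vol (eball c rk) `^ p <= D * (4 ^+ n.+1) ^+ k * vol (eball c r) `^ p.
  apply: (le_trans (le_powR p_gt0 (vol_ge0 _) (vol_growth_ball c k n0 r0))).
  have a0 : 0 <= (2 * n%:R) ^+ n :> R by rewrite exprn_ge0// mulr_ge0.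
  have b0 : 0 <= (4 ^+ k) ^+ n :> R by rewrite !exprn_ge0.
  rewrite (powRM _ (mulr_ge0 a0 b0) (vol_ge0 _)) (powRM _ a0 b0) -/D.
  apply: ler_wpM2r; first exact: powR_ge0.
  apply: ler_wpM2l; first exact: ltW.
  have -> : (4 ^+ k) ^+ n = 4 `^ (k%:R * n%:R) :> R.
    by rewrite -exprM -natrM powR_mulrn.
  rewrite -powRrM -exprM -[leRHS]powR_mulrn//; apply: ler_powR; first by rewrite ler1n.
  (* The bound on p enters here, as k n p <= k (n + 1). *)
  rewrite natrM -mulrA [leRHS]mulrC; apply: ler_wpM2l => //.
  rewrite -natr1; have := ler_wpM2l (ltW n0R) pn.
  by rewrite mulrDr mulfV ?gt_eqF// mulr1.
(* Needed to cancel [Sk]: if it vanished then so would [S0] by [h3], and [h2] would give the ball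
   zero volume. *)
have Sk0 : 0 < Sk.
  rewrite lt_neqAle powR_ge0 eq_sym andbT; apply: contraTneq h3 => ->.
  rewrite mulr0 -ltNge lt_neqAle powR_ge0 eq_sym andbT; apply: contraTneq h2 => ->.
  by rewrite mulr0 -ltNge powR_gt0.
rewrite -(ler_pM2r Sk0); apply: (le_trans h1).
apply: (le_trans (ler_wpM2l (ltW K0) VV)).
rewrite exprMn; set Q := (4 ^+ n.+1) ^+ k.
have Q0 : 0 <= Q by rewrite !exprn_ge0.
have DK0 : 0 <= K * D * Q by rewrite !mulr_ge0// ltW.
exact: growth_alg (ler_wpM2l DK0 (le_trans h2 (ler_wpM2l W0 h3))).
Qed.

End muckenhoupt_growth.

(** * Decaying profiles integrated against a density *)

Section tails.
Context {R : realType} {n : nat}.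
Implicit Types (c x : 'rV[R]_n) (r : R) (v : 'rV[R]_n -> R).
Local Notation mu := (leb n).

(* Growth of the v-measure under 4-fold dilation that the kernel of order
   -(n+1) can absorb. *)
Definition growth (C t : R) v := forall c r k, 0 < r ->
  wm v (eball c (4 ^+ k * r)) <= C * (4 ^+ n.+1 * t) ^+ k * wm v (eball c r).

(** Volume grows like 4^(nk), one power of 4^k below the critical rate, whence t = 1/4. This makes
    the tail estimate available for Lebesgue measure as well. *)
Lemma growth1 : (0 < n)%N -> growth ((2 * n%:R) ^+ n) 4^-1 (cst 1).
Proof.
move=> n0 c r k r0; rewrite !wm1//; try exact: measurable_eball.
rewrite (_ : 4 ^+ n.+1 * 4^-1 = 4 ^+ n :> R); last by rewrite exprSr mulfK.
by rewrite exprAC; exact: vol_growth_ball.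
Qed.

Lemma geometric_sum_le (t : R) N : 0 < t < 1 -> \sum_(0 <= k < N) t ^+ k <= (1 - t)^-1.
Proof.
move=> /andP[t0 t1]; have t10 : 0 < 1 - t by rewrite subr_gt0.
rewrite -[leRHS]div1r ler_pdivlMr//.
suff -> : (\sum_(0 <= k < N) t ^+ k) * (1 - t) = 1 - t ^+ N.
  by rewrite gerBl exprn_ge0// ltW.
elim: N => [|N IH]; first by rewrite big_nil mul0r expr0 subrr.
by rewrite big_nat_recr//= mulrDl IH exprS; ring.
Qed.

Lemma arith_geometric_sum_le (t : R) N : 0 < t < 1 ->
  \sum_(0 <= k < N) k.+1%:R * t ^+ k <= (1 - t) ^- 2.
Proof.
move=> /andP[t0 t1]; have t10 : 0 < 1 - t by rewrite subr_gt0.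
rewrite -[leRHS]div1r ler_pdivlMr ?exprn_gt0//.
suff -> : (\sum_(0 <= k < N) k.+1%:R * t ^+ k) * (1 - t) ^+ 2 =
          1 - t ^+ N * (1 + N%:R * (1 - t)).
  by rewrite gerBl mulr_ge0 ?exprn_ge0 ?addr_ge0 ?mulr_ge0// ltW.
elim: N => [|N IH]; first by rewrite big_nil mul0r expr0 !mul0r addr0 mulr1 subrr.
by rewrite big_nat_recr//= mulrDl IH (exprS t) -(@natr1 _ N); ring.
Qed.

Lemma nneseries_le (u : nat -> \bar R) (A : \bar R) : (forall k, 0 <= u k)%E ->
  (forall N, \sum_(0 <= k < N) u k <= A)%E -> (\sum_(0 <= k <oo) u k <= A)%E.
Proof.
move=> u0 uA; apply: lime_le; last by apply: nearW => N; exact: uA.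
by apply: is_cvg_nneseries => k _ _; exact: u0.
Qed.

(** Take the least k with x in B(c, 4^k r). By minimality |x - c| >= 4^(k-1) r when k > 0; the
    factor 4^(n+1) pays for this shift by one and makes the case k = 0 trivial. *)
Lemma dyadic_cover c r x : 0 < r -> exists k, eball c (4 ^+ k * r) x /\
  (r / (r + enorm (x - c))) ^+ n.+1 <= 4 ^+ n.+1 * (4 ^- n.+1) ^+ k.
Proof.
move=> r0; have d0 := enorm_ge0 (x - c).
have [k xk] : exists k, enorm (x - c) < 4 ^+ k * r.
  have [k hk] : exists k : nat, enorm (x - c) / r < k%:R.
    by exists (Num.truncn (enorm (x - c) / r)).+1; exact: truncnS_gt.
  exists k; rewrite -ltr_pdivrMr// (lt_le_trans hk)//.
  by rewrite -natrX ler_nat ltnW// ltn_expl.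
have ex : exists k, enorm (x - c) < 4 ^+ k * r by exists k.
case: (ex_minnP ex) => {k xk ex} k xk kmin; exists k; split=> //.
rewrite -exprVn exprAC -exprMn lerXn2r ?nnegrE ?divr_ge0 ?mulr_ge0 ?exprn_ge0 ?invr_ge0//.
- by rewrite ltW.
- by rewrite addr_ge0// ltW.
have rd : 0 < r + enorm (x - c) by rewrite ltr_pwDl.
rewrite ler_pdivrMr//.
case: k xk kmin => [|k] xk kmin.
  by rewrite expr0 mulr1; lra.
rewrite exprS mulrA mulfV// mul1r exprVn ler_pdivlMl ?exprn_gt0//.
have : ~~ (enorm (x - c) < 4 ^+ k * r).
  by apply/negP => /kmin; rewrite ltnn.
by rewrite -leNgt; lra.
Qed.

Lemma continuous_decay m c r : 0 < r ->
  continuous (fun x => (r / (r + enorm (x - c))) ^+ m).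
Proof.
move=> r0 x; have rx : r + enorm (x - c) != 0 by rewrite gt_eqF// ltr_pwDl// enorm_ge0.
apply: (@continuous_comp _ _ _ (fun x => r / (r + enorm (x - c))) (fun t => t ^+ m)).
  refine (cvgM (cvg_cst _) (cvgV rx (cvgD (cvg_cst _) (@enormB_continuous _ _ c x)))).
exact: exprn_continuous.
Qed.

Lemma decay_ge0 m c r x : 0 < r -> 0 <= (r / (r + enorm (x - c))) ^+ m.
Proof. by move=> r0; rewrite exprn_ge0// divr_ge0 ?addr_ge0 ?enorm_ge0 ?(ltW r0). Qed.

Lemma integral_mul_indic v E :
  (\int[mu]_x (v x * \1_E x)%:E = wmeas v E)%E.
Proof.
rewrite /wmeas [RHS]integral_mkcond; apply: eq_integral => x _.
by rewrite patchE indicE; case: (x \in E); rewrite ?mulr1 ?mulr0.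
Qed.

(** The profile is dominated by the sum over k of 4^(n+1) 4^(-(n+1)k) times the indicator of B(c,
    4^k r). After integration the growth hypothesis cancels the powers of 4^(n+1), and a geometric
    series in t remains. *)
Lemma tail_integral v C t : density v -> 0 < C -> 0 < t < 1 -> growth C t v ->
  forall c r, 0 < r ->
  (\int[mu]_x ((r / (r + enorm (x - c))) ^+ n.+1 * v x)%:E <=
   (4 ^+ n.+1 * C / (1 - t) * wm v (eball c r))%:E)%E.
Proof.
move=> dv C0 t01 Hg c r r0; have [mv v0 _] := dv.
have mB s : measurable (eball c s) by exact: measurable_eball.
pose a k : R := 4 ^+ n.+1 * (4 ^- n.+1) ^+ k.
have a0 k : 0 <= a k by rewrite mulr_ge0 ?exprn_ge0// invr_ge0 exprn_ge0.
pose u k x : \bar R := ((a k)%:E * (v x * \1_(eball c (4 ^+ k * r)) x)%:E)%E.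
have v1 k x : 0 <= v x * \1_(eball c (4 ^+ k * r)) x by rewrite mulr_ge0.
have u0 k x : (0 <= u k x)%E by rewrite mule_ge0 ?lee_fin.
have mvk k : measurable_fun setT (fun x => (v x * \1_(eball c (4 ^+ k * r)) x)%:E).
  by apply/measurable_EFinP; apply: measurable_funM => //; exact: measurable_indic.
have mu_ k : measurable_fun setT (u k) by exact: measurable_funeM.
apply: (@le_trans _ _ (\int[mu]_x \sum_(0 <= k <oo) u k x)%E).
  apply: ge0_le_integral => //.
  - by move=> x _; rewrite lee_fin mulr_ge0// decay_ge0.
  - apply/measurable_EFinP; apply: measurable_funM => //.
    by apply: rV_continuous_measurable; exact: continuous_decay.
  - by apply: ge0_emeasurable_sum.
  move=> x _; have [k [xk hk]] := dyadic_cover c x r0.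
  apply: (@le_trans _ _ (u k x)).
    by rewrite /u -EFinM lee_fin indicE mem_set// mulr1 ler_wpM2r.
  apply: le_trans (nneseries_lim_ge k.+1 (fun m _ _ => u0 m x)).
  by rewrite big_nat_recr//= leeDr// sume_ge0.
rewrite integral_nneseries//; apply: nneseries_le => [k|N].
  by apply: integral_ge0.
rewrite (eq_bigr (fun k => (a k * wm v (eball c (4 ^+ k * r)))%:E)); last first.
  move=> k _; rewrite ge0_integralZl_EFin//; last by move=> x _; rewrite lee_fin.
  by rewrite integral_mul_indic wm_eballE// EFinM.
rewrite sumEFin lee_fin.
apply: (@le_trans _ _ (\sum_(0 <= k < N) 4 ^+ n.+1 * C * wm v (eball c r) * t ^+ k)).
  apply: ler_sum => k _; apply: (le_trans (ler_wpM2l (a0 k) (Hg c r k r0))).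
  rewrite /a exprMn le_eqVlt; apply/orP; left; apply/eqP.
  have h : (4 ^- n.+1) ^+ k * (4 ^+ n.+1) ^+ k = 1 :> R.
    by rewrite -exprMn mulVf ?expr1n// gt_eqF// exprn_gt0.
  set x := (4 ^- n.+1) ^+ k in h *; set y := (4 ^+ n.+1) ^+ k in h *.
  transitivity (x * y * (4 ^+ n.+1 * C * wm v (eball c r) * t ^+ k)); last by rewrite h mul1r.
  by move: x y (t ^+ k) (wm v _) (4 ^+ _) {h} => x y tk W f; ring.
rewrite -mulr_sumr mulrAC; apply: ler_wpM2r; first exact: wm_ge0.
apply: ler_wpM2l; first by rewrite mulr_ge0 ?exprn_ge0// ltW.
exact: geometric_sum_le.
Qed.

End tails.

(** * Oscillation of b on dilated balls *)

Section bmo_growth.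
Context {R : realType} {n : nat}.
Variables (n0 : (0 < n)%N) (b : 'rV[R]_n -> R).
Hypothesis bmob : bmo b.
Implicit Types (c x : 'rV[R]_n) (r : R).
Local Notation mu := (leb n).

Let lb : loc_integrable b. Proof. by case: bmob. Qed.

Lemma integrable_cst_eball c r (k : R) : mu.-integrable (eball c r) (EFin \o cst k).
Proof.
have mB := @measurable_eball R n c r.
apply/integrableP; split; first by apply/measurable_EFinP; exact: measurable_cst.
rewrite (integral_cst mu mB `|k|%:E) lte_mul_pinfty ?lee_fin//.
by rewrite -ge0_fin_numE ?leb_eball_fin.
Qed.

Lemma integrable_sub_cst c r (k : R) :
  mu.-integrable (eball c r) (EFin \o (fun x => b x - k)).
Proof.
have mB := @measurable_eball R n c r.
have -> : EFin \o (fun x => b x - k) = ((EFin \o b) \- (EFin \o cst k))%E by apply/funext.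
by apply: integrableB => //; [exact: loc_integrable_eball|exact: integrable_cst_eball].
Qed.


Lemma Rintegral_EFin d (T : measurableType d) (nu : {measure set T -> \bar R})
    (D : set T) (f : T -> R) : measurable D -> nu.-integrable D (EFin \o f) ->
  (\int[nu]_(x in D) f x)%:E = (\int[nu]_(x in D) (f x)%:E)%E.
Proof. by move=> mD fi; rewrite /Rintegral fineK//; exact: integrable_fin_num. Qed.

Lemma integrable_normB c r (k : R) :
  mu.-integrable (eball c r) (EFin \o (fun x => `|b x - k|)).
Proof. exact: (integrable_norm (integrable_sub_cst c r k)). Qed.

Lemma bmo_bound : exists2 beta : R, 0 < beta & forall c r, 0 < r ->
  \int[mu]_(x in eball c r) `|b x - avg (eball c r) b| <= beta * vol (eball c r).
Proof.
case: bmob => _ /sup_balls_bounded[K K0 HK]; exists K => // c r r0.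
have V0 := vol_eball_gt0 c n0 r0.
have := HK c r r0; rewrite /eavg -/(vol _) -Rintegral_EFin; last 2 first.
- exact: measurable_eball.
- exact: integrable_normB.
by rewrite -EFinM lee_fin ler_pdivrMl// mulrC.
Qed.

Lemma avgB_le c r (k : R) : 0 < r ->
  `|avg (eball c r) b - k| <= (vol (eball c r))^-1 * \int[mu]_(x in eball c r) `|b x - k|.
Proof.
move=> r0; have V0 := vol_eball_gt0 c n0 r0; have mB := @measurable_eball R n c r.
have ib := loc_integrable_eball c r lb.
have -> : avg (eball c r) b - k = (vol (eball c r))^-1 * \int[mu]_(x in eball c r) (b x - k).
  rewrite RintegralB//; last exact: integrable_cst_eball.
  rewrite Rintegral_cst// mulrBr /avg -/(vol _); congr (_ - _).
  by rewrite mulrCA mulVf ?mulr1// gt_eqF.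
rewrite normrM gtr0_norm ?invr_gt0// ler_wpM2l ?invr_ge0 ?(ltW V0)//.
by apply: le_normr_Rintegral => //; exact: integrable_sub_cst.
Qed.

(** Averages over B(c, 4^j r) and B(c, 4^(j+1) r) differ by at most D beta, D being the doubling
    constant of volume, so the average drifts at most linearly in k. This first-moment bound stands
    in for exponential integrability. *)
Lemma bmo_telescope : exists2 M : R, 0 < M & forall c r k, 0 < r ->
  \int[mu]_(x in eball c (4 ^+ k * r)) `|b x - avg (eball c r) b| <=
    M * k.+1%:R * vol (eball c (4 ^+ k * r)).
Proof.
have [beta beta0 Hb] := bmo_bound.
have [D D0 HD] : exists2 D : R, 0 <= D & forall c r, 0 < r ->
    vol (eball c (4 * r)) <= D * vol (eball c r).
  exists ((2 * n%:R) ^+ n * 4 ^+ n); first by rewrite mulr_ge0 ?exprn_ge0// mulr_ge0.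
  by move=> c r r0; have := vol_growth_ball c 1 n0 r0; rewrite !expr1.
(* Covers beta, the oscillation on the k-th ball, plus k D beta, the drift of its average. *)
exists ((1 + D) * beta); first by rewrite mulr_gt0// ltr_wpDr.
move=> c r k r0.
have rk j : 0 < 4 ^+ j * r by rewrite mulr_gt0// exprn_gt0.
have step j : `|avg (eball c (4 ^+ j * r)) b - avg (eball c (4 ^+ j.+1 * r)) b| <= D * beta.
  apply: (le_trans (avgB_le c _ (rk j))).
  have V0 := vol_eball_gt0 c n0 (rk j).
  rewrite ler_pdivrMl//.
  have h1 := HD c _ (rk j).
  have h2 := Hb c _ (rk j.+1).
  apply: (@le_trans _ _ (beta * vol (eball c (4 ^+ j.+1 * r)))).
    apply: le_trans h2; rewrite -lee_fin !Rintegral_EFin; try exact: measurable_eball; try exact: integrable_normB.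
    apply: ge0_subset_integral; try exact: measurable_eball.
    - exact: (measurable_int _ (integrable_normB _ _ _)).
    - by move=> x _; rewrite lee_fin.
    - by apply: eball_le; rewrite exprS -mulrA ler_peMl ?ler1n// (ltW (rk j)).
  rewrite exprS -(mulrA 4); apply: (le_trans (ler_wpM2l (ltW beta0) h1)).
  by rewrite le_eqVlt; apply/orP; left; apply/eqP; ring.
have tele j : `|avg (eball c (4 ^+ j * r)) b - avg (eball c r) b| <= j%:R * (D * beta).
  elim: j => [|j IH]; first by rewrite mul1r subrr normr0 mul0r.
  rewrite (_ : avg (eball c (4 ^+ j.+1 * r)) b - _ =
    (avg (eball c (4 ^+ j.+1 * r)) b - avg (eball c (4 ^+ j * r)) b) +
    (avg (eball c (4 ^+ j * r)) b - avg (eball c r) b)); last by rewrite addrA subrK.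
  apply: (le_trans (ler_normD _ _)); rewrite distrC -(@natr1 _ j) mulrDl mul1r addrC.
  by apply: lerD.
set B := eball c (4 ^+ k * r); have mB : measurable B by exact: measurable_eball.
pose A : R := `|avg B b - avg (eball c r) b|.
have iA : mu.-integrable B (EFin \o cst A) by exact: integrable_cst_eball.
apply: (@le_trans _ _ (\int[mu]_(x in B) (`|b x - avg B b| + cst A x))).
  apply: le_Rintegral => //.
  - exact: integrable_normB.
  - have -> : EFin \o (fun x => `|b x - avg B b| + cst A x) =
      ((EFin \o (fun x => `|b x - avg B b|)%R) \+ (EFin \o cst A))%E by apply/funext.
    by apply: integrableD => //; exact: integrable_normB.
  - by move=> x _; apply: le_trans (ler_normD _ _); rewrite addrA subrK.
rewrite RintegralD//; last exact: integrable_normB.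
rewrite Rintegral_cst// -/(vol _).
apply: (le_trans (lerD (Hb _ _ (rk k)) (ler_wpM2r (vol_ge0 _) (tele k)))).
rewrite -/B -mulrDl ler_wpM2r ?vol_ge0// -(@natr1 _ k).
rewrite (_ : (1 + D) * beta * _ = beta + k%:R * (D * beta) + (k%:R * beta + D * beta)); last by ring.
by rewrite lerDl addr_ge0// mulr_ge0// ltW.
Qed.

(* By Chebyshev, a fixed proportion of the annulus when T is large. *)
Definition good_annulus (T : R) c r k : set 'rV[R]_n :=
  (eball c (4 ^+ k.+1 * r) `\` eball c (4 ^+ k * r)) `&`
  [set x | `|b x - avg (eball c r) b| <= T * k.+2%:R].

Lemma measurable_good_annulus T c r k : measurable (good_annulus T c r k).
Proof.
apply: measurableI; first by apply: measurableD; exact: measurable_eball.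
have mb : measurable_fun setT (fun x => `|b x - avg (eball c r) b|).
  by apply: measurableT_comp => //; apply: measurable_funB => //; case: lb.
rewrite -[X in measurable X]setTI (_ : [set x | _] =
  (fun x => `|b x - avg (eball c r) b|) @^-1` `]-oo, T * k.+2%:R]%classic).
  by apply: mb.
by apply/seteqP; split => x /=; rewrite in_itv.
Qed.

(** The annulus holds a share 2 eta of the ball, by the disjoint translate of B(c, 4^k r). Chebyshev
    with T = M / eta removes at most a share eta, since the mean of |b - b_B| over the ball of index
    k + 1 is at most M (k + 2). *)
Lemma vol_good_annulus : exists T eta : R, [/\ 0 < T, 0 < eta & forall c r k, 0 < r ->
  eta * vol (eball c (4 ^+ k.+1 * r)) <= vol (good_annulus T c r k)].
Proof.
have [M M0 HM] := bmo_telescope.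
(* (8n)^-n bounds from below the share of the translate in a ball of four times its radius; half of
   it is given up to Chebyshev's exceptional set. *)
pose eta : R := (8 * n%:R) ^- n / 2.
have e0 : 0 < eta by rewrite divr_gt0// invr_gt0 exprn_gt0// mulr_gt0// ltr0n.
exists (M / eta), eta; split => //; first by rewrite divr_gt0.
move=> c r k r0; have hT : M = M / eta * eta by rewrite divfK// gt_eqF.
have: 0 < M / eta by rewrite divr_gt0.
move: (M / eta) hT => T hT T0; set B := eball c (4 ^+ k.+1 * r).
pose s := 4 ^+ k * r; have s0 : 0 < s by rewrite mulr_gt0// exprn_gt0.
have Bs : B = eball c (4 * s) by rewrite /B /s exprS mulrA.
have rk : 0 < 4 ^+ k.+1 * r by rewrite mulr_gt0// exprn_gt0.
have mB t : measurable (eball c t) by exact: measurable_eball.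
have mBB : measurable B by exact: mB.
pose G := B `&` [set x | T * k.+2%:R < `|b x - avg (eball c r) b|].
have V0 : 0 < vol B by exact: vol_eball_gt0.
have mb : measurable_fun setT (fun x => `|b x - avg (eball c r) b|).
  by apply: measurableT_comp => //; apply: measurable_funB => //; case: lb.
have mG : measurable G.
  apply: measurableI; first exact: mB.
  have -> : [set x | T * k.+2%:R < `|b x - avg (eball c r) b|] =
    (fun x => `|b x - avg (eball c r) b|) @^-1` `]T * k.+2%:R, +oo[%classic.
    by apply/seteqP; split => x /=; rewrite in_itv/= andbT.
  by rewrite -[X in measurable X]setTI; apply: mb.
have GB : G `<=` B by move=> x [].
have vG : vol G <= eta * vol B.
  have Tk : 0 < T * k.+2%:R by rewrite mulr_gt0.
  rewrite -(ler_pM2l Tk); apply: (@le_trans _ _ (\int[mu]_(x in B) `|b x - avg (eball c r) b|)).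
    rewrite -lee_fin Rintegral_EFin//; last exact: integrable_normB.
    apply: (@le_trans _ _ (\int[mu]_(x in G) `|b x - avg (eball c r) b|%:E)%E); last first.
      apply: ge0_subset_integral => //.
      exact: (measurable_int _ (integrable_normB _ _ _)).
    rewrite EFinM -(@leb_vol _ _ _ c (4 ^+ k.+1 * r))// -(integral_cst mu mG).
    apply: ge0_le_integral => //.
    - by move=> x _; rewrite lee_fin ltW.
    - by apply: measurable_funTS; apply/measurable_EFinP.
    - by move=> x [_ /=] /ltW; rewrite lee_fin.
  apply: (le_trans (HM c r k.+1 r0)); rewrite -/B hT.
  by rewrite le_eqVlt; apply/orP; left; apply/eqP; ring.
have vA : 2 * eta * vol B <= vol (B `\` eball c s).
  have [c' [c'3 dis]] := ball_in_annulus n0 c s.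
  apply: (@le_trans _ _ (vol (eball c' s))).
    apply: le_trans (vol_eball_ge c' n0 s0).
    rewrite /eta mulrCA mulfV// mulr1 ler_pdivrMl ?exprn_gt0 ?mulr_gt0 ?ltr0n//.
    rewrite Bs (le_trans (vol_eball_le _ _))//; first by rewrite mulr_ge0// ltW.
    rewrite -exprMn le_eqVlt; apply/orP; left; apply/eqP; congr (_ ^+ _).
    by field; rewrite pnatr_eq0 -lt0n.
  apply: (@le_vol _ _ _ _ c (4 * s)); [exact: measurable_eball|exact: measurableD| |].
    move=> x xs; split; first by rewrite Bs; apply: (@eball_le _ _ c (3 * s)); [lra|exact: c'3].
    by move=> xc; move/disj_setPS : dis => /(_ x); apply.
  by rewrite Bs => x [].
have : vol (B `\` eball c s) <= vol (good_annulus T c r k) + vol G.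
  rewrite -!wm1//; try exact: measurableD; try exact: measurable_good_annulus.
  rewrite -(@wm_setU _ _ _ _ _ c (4 * s)).
  - apply: (@le_wm _ _ _ _ _ c (4 * s)).
    + exact: density1.
    + exact: measurableD.
    + by apply: measurableU => //; exact: measurable_good_annulus.
    + move=> x [xB xs]; case: (leP `|b x - avg (eball c r) b| (T * k.+2%:R)) => h.
        by left.
      by right.
    + by rewrite -Bs subUset; split => // x [[]].
  - exact: density1.
  - exact: measurable_good_annulus.
  - exact: mG.
  - by apply/disj_setPS => x [[_ /= h1] [_ /= h2]]; move: h1; rewrite leNgt h2.
  - by rewrite -Bs subUset; split => // x [[]].
by move=> h; lra.
Qed.

End bmo_growth.

(** * Atoms in the Hardy space *)

Section schwartz_bounds.
Context {R : realType} {n : nat}.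
Implicit Types (phi : 'rV[R]_n -> R) (x z v : 'rV[R]_n).

Lemma schwartz_norm_bound N phi : (schwartz_norm N phi < +oo)%E ->
  exists2 C : R, 0 < C & forall s z, (size s <= N)%N ->
    (1 + enorm z) ^+ N * `|partials s phi z| <= C.
Proof.
move=> lty.
have le s z : (size s <= N)%N ->
    (((1 + enorm z) ^+ N * `|partials s phi z|)%:E <= schwartz_norm N phi)%E.
  by move=> sN; apply: ereal_sup_ubound; exists (s, z).
move: (schwartz_norm N phi) lty le => [K| |] // _ le.
  exists (`|K| + 1); first by rewrite ltr_wpDl.
  move=> s z sN; have := le s z sN; rewrite lee_fin => /le_trans; apply.
  by rewrite (le_trans (ler_norm _))// lerDl.
by exists 1 => // s z /(le s z); rewrite leeNy_eq.
Qed.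

(** The seminorm of order N + 1 controls at least the first partial derivatives, also when N = 0. *)
Lemma schwartz_bound phi N : schwartz phi -> exists2 C : R, 0 < C & forall z,
  `|phi z| <= C / (1 + enorm z) ^+ N.+1 /\
  forall i, `|partial i phi z| <= C / (1 + enorm z) ^+ N.+1.
Proof.
move=> [_ /(_ N.+1)/schwartz_norm_bound[C C0 HC]]; exists C => // z.
have z0 : 0 < (1 + enorm z) ^+ N.+1 by rewrite exprn_gt0// ltr_pwDl// enorm_ge0.
split=> [|i]; rewrite ler_pdivlMr// mulrC.
  exact: (HC [::] z).
exact: (HC [:: i] z).
Qed.

Lemma schwartz_differentiable phi y : schwartz phi -> differentiable phi y.
Proof. by move=> [dphi _]; exact: (dphi [::]). Qed.

Lemma schwartz_continuous phi : schwartz phi -> continuous phi.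
Proof. by move=> sphi x; apply: differentiable_continuous; exact: schwartz_differentiable. Qed.

Lemma schwartz_measurable phi : schwartz phi -> measurable_fun setT phi.
Proof. by move=> /schwartz_continuous; exact: rV_continuous_measurable. Qed.

Lemma derive_sum_partial phi x v : differentiable phi x ->
  'D_v phi x = \sum_i v ord0 i * partial i phi x.
Proof.
move=> dphi; rewrite deriveE// {1}(row_sum_delta v) linear_sum.
by apply: eq_bigr => i _; rewrite linearZ /partial deriveE.
Qed.

Lemma mean_value phi x v : (forall y, differentiable phi y) ->
  exists2 s : R, 0 <= s <= 1 & phi (x + v) - phi x = 'D_v phi (x + s *: v).
Proof.
move=> dphi; pose g (s : R) := phi (x + s *: v).
have dg (s : R) : is_derive s 1 g ('D_v phi (x + s *: v)).
  have e : (fun h : R => h^-1 *: ((g \o shift s) (h *: 1) - g s)) =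
           (fun h : R => h^-1 *: ((phi \o shift (x + s *: v)) (h *: v) - phi (x + s *: v))).
    apply/funext => h /=; rewrite /g; congr (_ *: (phi _ - _)).
    by rewrite [h *: 1]mulr1 scalerDl addrCA.
  apply: DeriveDef; last by rewrite /derive e.
  by rewrite /derivable e; exact: diff_derivable.
have dg1 (s : R) : s \in `]0, 1[%R -> is_derive s 1 g ('D_v phi (x + s *: v)).
  by move=> _; exact: dg.
have cg : {within `[0, 1]%classic, continuous g}.
  apply: continuous_subspaceT => s; apply: differentiable_continuous.
  by apply/derivable1_diffP; exact: ex_derive.
have [s s01] := MVT_segment ler01 dg1 cg.
rewrite /g scale1r scale0r addr0 subr0 mulr1 => e.
by exists s => //; move: s01; rewrite in_itv.
Qed.

(** Mean value theorem on the segment from z to z + v: as |v| <= |z| / 2, all its points have norm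
    at least |z| / 2, where the decay of the n partial derivatives is evaluated. The summand 1 in
    the constant only keeps it positive. *)
Lemma schwartz_increment phi : schwartz phi -> exists2 C : R, 0 < C & forall z v,
  enorm v <= enorm z / 2 ->
  `|phi (z + v) - phi z| <= C * enorm v / (1 + enorm z / 2) ^+ n.+1.
Proof.
move=> sphi; have [C C0 HC] := schwartz_bound n sphi.
exists (n%:R * C + 1); first by rewrite ltr_wpDl// mulr_ge0// ltW.
move=> z v vz; have [|s /andP[s0 s1] ->] := @mean_value phi z v.
  by move=> y; exact: schwartz_differentiable.
rewrite derive_sum_partial; last exact: schwartz_differentiable.
have z2 : 0 < (1 + enorm z / 2) ^+ n.+1.
  by rewrite exprn_gt0// ltr_pwDl// divr_ge0// enorm_ge0.
have sz : enorm z / 2 <= enorm (z + s *: v).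
  have := enorm_dist z (z + s *: v).
  rewrite opprD addNKr enormN enormZ (ger0_norm s0) ler_norml => /andP[_ h].
  have : s * enorm v <= enorm v by rewrite ler_piMl ?enorm_ge0.
  by lra.
apply: (le_trans (ler_norm_sum _ _ _)).
apply: (@le_trans _ _ (\sum_(i < n) C * enorm v / (1 + enorm z / 2) ^+ n.+1)).
  apply: ler_sum => i _; rewrite normrM (mulrC C) -mulrA.
  apply: ler_pM => //; first exact: enorm_coord.
  apply: (le_trans ((HC _).2 i)).
  apply: ler_wpM2l; first exact: ltW.
  rewrite lef_pV2 ?posrE//; last by rewrite exprn_gt0// ltr_pwDl// enorm_ge0.
  rewrite lerXn2r ?nnegrE ?addr_ge0 ?enorm_ge0 ?divr_ge0 ?enorm_ge0//.
  by rewrite lerD2l.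
rewrite sumr_const card_ord -[leLHS]mulr_natl !mulrA.
rewrite ler_wpM2r ?invr_ge0 ?(ltW z2)// ler_wpM2r ?enorm_ge0//.
by rewrite lerDl.
Qed.

End schwartz_bounds.

(** Monotonicity with no measurability, straight from the definition by simple functions. It allows
    integrating bounds on the maximal function, a supremum over uncountably many t whose
    measurability is not established. *)
Lemma le_integral_pointwise d (T : measurableType d) (R : realType)
    (nu : {measure set T -> \bar R}) (f g : T -> \bar R) :
  (forall x, 0 <= f x)%E -> (forall x, f x <= g x)%E ->
  (\int[nu]_x f x <= \int[nu]_x g x)%E.
Proof.
move=> f0 fg; rewrite !ge0_integralTE//; last by move=> x; exact: le_trans (fg x).
apply: le_ereal_sup => _ [h hf <-]; exists h => // x; exact: le_trans (fg x).
Qed.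

Section compact_support.
Context {R : realType} {n : nat}.
Implicit Types (f g : 'rV[R]_n -> R) (x c : 'rV[R]_n) (r M : R).
Local Notation mu := (leb n).

Lemma ball_bounded_integrable f c r M : 0 <= M -> measurable_fun setT f ->
  (forall x, `|f x| <= M) -> (forall x, ~ eball c r x -> f x = 0) ->
  mu.-integrable setT (EFin \o f) /\ (\int[mu]_x `|f x|%:E <= (M * vol (eball c r))%:E)%E.
Proof.
move=> M0 mf fM f0; have mB := @measurable_eball R n c r.
have H : (\int[mu]_x `|f x|%:E <= (M * vol (eball c r))%:E)%E.
  apply: (@le_trans _ _ (\int[mu]_x (cst M x * \1_(eball c r) x)%:E)%E).
    apply: le_integral_pointwise => x; rewrite lee_fin// indicE.
    have [/set_mem xB|] := boolP (x \in _); first by rewrite mulr1.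
    by rewrite notin_setE => /f0 ->; rewrite normr0 mulr0.
  by rewrite integral_mul_indic /wmeas (integral_cst mu mB M%:E) [leRHS]EFinM -vol_eballE.
split=> //; apply/integrableP; split; first exact/measurable_EFinP.
by apply: (le_lt_trans H); rewrite ltry.
Qed.

Lemma ball_bounded_Rintegral f c r M : 0 <= M -> measurable_fun setT f ->
  (forall x, `|f x| <= M) -> (forall x, ~ eball c r x -> f x = 0) ->
  `|\int[mu]_x f x| <= M * vol (eball c r).
Proof.
move=> M0 mf fM f0; have [fi fle] := ball_bounded_integrable M0 mf fM f0.
rewrite (le_trans (le_normr_Rintegral _ fi))// -lee_fin Rintegral_EFin//.
exact: (integrable_norm fi).
Qed.

Lemma normr_Rintegral_le f M : measurable_fun setT f ->
  (\int[mu]_x `|f x|%:E <= M%:E)%E -> `|\int[mu]_x f x| <= M.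
Proof.
move=> mf fM; have fi : mu.-integrable setT (EFin \o f).
  by apply/integrableP; split; [exact/measurable_EFinP|rewrite (le_lt_trans fM) ?ltry].
rewrite (le_trans (le_normr_Rintegral _ fi))// -lee_fin Rintegral_EFin//.
exact: (integrable_norm fi).
Qed.

End compact_support.

(** * The maximal function of a cancelling function *)

Section atom_maximal.
Context {R : realType} {n : nat}.
Variables (n0 : (0 < n)%N) (phi : 'rV[R]_n -> R).
Hypothesis sphi : schwartz phi.
Implicit Types (a : 'rV[R]_n -> R) (x c : 'rV[R]_n) (r A t : R).
Local Notation mu := (leb n).

(* A mean-zero bounded function on a ball, the only features of an atom used
   in the bound on its maximal function. *)
Definition cancelling a c r A :=
  [/\ measurable_fun setT a, forall x, `|a x| <= A,
      forall x, ~ eball c r x -> a x = 0 & \int[mu]_x a x = 0].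

Lemma cancelling_tempered a c r A : 0 <= A -> cancelling a c r A -> tempered (distr_of a).
Proof.
move=> A0 [ma aA a0 _].
have prod f : schwartz f -> exists2 S : R, 0 <= S &
    (forall x, `|a x * f x| <= A * S) /\ mu.-integrable setT (EFin \o (fun x => a x * f x)).
  move=> sf; have [C C0 HC] := schwartz_bound 0 sf.
  have fC x : `|f x| <= C.
    apply: (le_trans (HC x).1); rewrite ler_pdivrMr ?expr1 ?ltr_pwDl ?enorm_ge0//.
    by rewrite ler_peMr ?(ltW C0)// lerDl enorm_ge0.
  have aC x : `|a x * f x| <= A * C by rewrite normrM ler_pM.
  exists C; first exact: ltW.
  split=> //; apply: (ball_bounded_integrable (mulr_ge0 A0 (ltW C0)) _ aC _).1.
    by apply: measurable_funM => //; exact: schwartz_measurable.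
  by move=> x /a0 ->; rewrite mul0r.
split.
  move=> k f g sf sg; rewrite /distr_of.
  have [_ _ [_ fi]] := prod f sf; have [_ _ [_ gi]] := prod g sg.
  rewrite (_ : (fun x => _) = fun x => k * (a x * f x) + a x * g x); last first.
    by apply/funext => x /=; ring.
  have kfi : mu.-integrable setT (EFin \o (fun x => k * (a x * f x))).
    by have := integrableZl measurableT k fi; apply: eq_integrable.
  by rewrite RintegralD// RintegralZl.
exists 0%N, (A * vol (eball c r)) => f sf.
have le z : (`|f z|%:E <= schwartz_norm 0 f)%E.
  apply: ereal_sup_ubound; exists ([::], z) => //=.
  by rewrite expr0 mul1r.
have := (sf.2 0%N); move: (schwartz_norm 0 f) le => [S| |] // le _; last by have := le 0.
have S0 : 0 <= S by rewrite -lee_fin (le_trans _ (le 0))// lee_fin.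
rewrite -EFinM lee_fin (mulrAC A); apply: ball_bounded_Rintegral.
- exact: mulr_ge0.
- by apply: measurable_funM => //; exact: schwartz_measurable.
- by move=> x; rewrite normrM ler_pM// -lee_fin.
- by move=> x /a0 ->; rewrite mul0r.
Qed.

Lemma dilate_shift_continuous t x : 0 < t -> continuous (fun y : 'rV[R]_n => dilate phi t (x - y)).
Proof.
move=> t0; rewrite (_ : (fun y => _) =
    (fun y : 'rV[R]_n => t ^- n * phi ((- t^-1) *: (y - x)))); last first.
  by apply/funext => y; rewrite /dilate scaleNr -scalerN opprB.
move=> y.
apply: (@continuous_comp _ _ _ (fun y : 'rV[R]_n => phi ((- t^-1) *: (y - x))) (fun s => t ^- n * s)).
  apply: (@continuous_comp _ _ _ (fun y : 'rV[R]_n => (- t^-1) *: (y - x)) phi).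
    apply: (@continuous_comp _ _ _ (fun y : 'rV[R]_n => y - x) (fun z => (- t^-1) *: z)).
      by refine (cvgB cvg_id (cvg_cst x)).
    exact: scaler_continuous.
  exact: schwartz_continuous.
by refine (cvgM (cvg_cst _) cvg_id).
Qed.


(** Schwartz decay bounds |phi_t(x - y)| by C t^-n (t / (t + |y - x|))^(n+1). The tail estimate for
    Lebesgue measure at radius t returns t^n, so the bound is uniform in t without a change of
    variables. *)
Lemma dilate_mass : exists2 D : R, 0 < D & forall t x, 0 < t ->
  (\int[mu]_y `|dilate phi t (x - y)|%:E <= D%:E)%E.
Proof.
have [C C0 HC] := schwartz_bound n sphi.
have g2 : 0 < (2 * n%:R) ^+ n :> R by rewrite exprn_gt0// mulr_gt0// ltr0n.
have t4 : 0 < (4^-1 : R) < 1 by apply/andP; split; lra.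
have tail := tail_integral density1 g2 t4 (@growth1 R n n0).
set K := _ / _ in tail; exists (C * K * 2 ^+ n).
  by rewrite !mulr_gt0// ?exprn_gt0// invr_gt0; lra.
have K0 : 0 <= K by rewrite divr_ge0 ?mulr_ge0 ?exprn_ge0//; lra.
move=> t x t0.
have tn : 0 < t ^- n by rewrite invr_gt0 exprn_gt0.
have mdec : measurable_fun setT (fun y : 'rV[R]_n => (t / (t + enorm (y - x))) ^+ n.+1 * cst 1 y).
  apply: measurable_funM => //.
  by apply: rV_continuous_measurable; exact: continuous_decay.
apply: (@le_trans _ _ (\int[mu]_y ((t ^- n * C)%:E *
    ((t / (t + enorm (y - x))) ^+ n.+1 * cst 1 y)%:E))%E).
  apply: le_integral_pointwise => y; first by rewrite lee_fin.
  rewrite -EFinM lee_fin /dilate normrM gtr0_norm// -mulrA ler_wpM2l ?(ltW tn)//.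
  apply: (le_trans (HC _).1); rewrite mulr1 ler_wpM2l ?(ltW C0)//.
  rewrite enormZ gtr0_norm ?invr_gt0// -exprVn enormB le_eqVlt; apply/orP; left; apply/eqP.
  congr (_ ^+ _); have := enorm_ge0 (y - x) => h; field.
  by rewrite !gt_eqF// ?ltr_pwDl// addr_gt0.
rewrite ge0_integralZl_EFin//; last 3 first.
- by move=> y _; rewrite lee_fin mulr_ge0// decay_ge0.
- exact/measurable_EFinP.
- by rewrite mulr_ge0 ?(ltW tn) ?(ltW C0).
apply: (@le_trans _ _ ((t ^- n * C)%:E * (K * (2 * t) ^+ n)%:E)%E).
  apply: lee_pmul => //.
  - by rewrite lee_fin mulr_ge0 ?(ltW tn) ?(ltW C0).
  - by apply: integral_ge0 => y _; rewrite lee_fin mulr_ge0// decay_ge0.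
  apply: (le_trans (tail x t t0)); rewrite lee_fin ler_wpM2l// wm1; last exact: measurable_eball.
  by rewrite vol_eball_le// ltW.
rewrite -EFinM lee_fin exprMn le_eqVlt; apply/orP; left; apply/eqP.
have : t ^- n * t ^+ n = 1 by rewrite mulVf// gt_eqF// exprn_gt0.
move: (t ^+ n) => e ee; transitivity (e^-1 * e * (C * K * 2 ^+ n)); last by rewrite ee mul1r.
by move: K {tail K0} (2 ^+ n) (e^-1) {ee} => K u v; ring.
Qed.

(** Since a has mean zero, phi_t(x - c) can be subtracted under the integral; the increment bound,
    the size A and the volume of the ball, at most (2r)^n, are then multiplied. *)
Lemma convol_far : exists2 D : R, 0 < D & forall a c r A t x, 0 < r -> 0 <= A ->
  cancelling a c r A -> 0 < t -> 2 * r <= enorm (x - c) ->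
  `|convol (distr_of a) (dilate phi t) x| <= D * A * (r / enorm (x - c)) ^+ n.+1.
Proof.
have [C C0 HC] := schwartz_increment sphi.
exists (C * 2 ^+ n.+1 * 2 ^+ n); first by rewrite !mulr_gt0// exprn_gt0.
move=> a c r A t x r0 A0 [ma aA aB a0] t0 xc.
pose d := enorm (x - c); have d0 : 0 < d by rewrite (lt_le_trans _ xc)// mulr_gt0.
pose psi y := dilate phi t (x - y).
have mpsi : measurable_fun setT psi.
  by apply: rV_continuous_measurable; exact: dilate_shift_continuous.
(* This is t^-n C (r/t) (2t/d)^(n+1): all powers of t cancel, so the estimate passes to the supremum
   over t. *)
pose S := C * 2 ^+ n.+1 * r / d ^+ n.+1.
have S0 : 0 <= S by rewrite divr_ge0 ?mulr_ge0 ?exprn_ge0 ?(ltW r0) ?(ltW d0) ?(ltW C0).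
have incr y : eball c r y -> `|psi y - psi c| <= S.
  move=> yc; have yr : enorm (c - y) <= r by rewrite enormB ltW.
  rewrite /psi /dilate -mulrBr normrM gtr0_norm ?invr_gt0 ?exprn_gt0//.
  have -> : t^-1 *: (x - y) = t^-1 *: (x - c) + t^-1 *: (c - y).
    by rewrite -scalerDr addrA subrK.
  have nt z : enorm (t^-1 *: z) = enorm z / t.
    by rewrite enormZ gtr0_norm ?invr_gt0// mulrC.
  have := HC (t^-1 *: (x - c)) (t^-1 *: (c - y)); rewrite !nt -/d.
  have h : enorm (c - y) / t <= d / t / 2.
    rewrite mulrAC ler_pM2r ?invr_gt0// ler_pdivlMr//.
    by apply: (le_trans _ xc); rewrite mulrC ler_pM2l.
  move=> /(_ h) {}h; rewrite ler_pdivrMl ?exprn_gt0//; apply: (le_trans h).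
  have dt0 : 0 < d / (2 * t) by rewrite divr_gt0// mulr_gt0.
  apply: (@le_trans _ _ (C * (r / t) / (d / (2 * t)) ^+ n.+1)).
    apply: ler_pM.
    - by rewrite mulr_ge0 ?divr_ge0 ?enorm_ge0 ?(ltW C0) ?(ltW t0).
    - by rewrite invr_ge0 exprn_ge0// addr_ge0// !divr_ge0 ?(ltW d0) ?(ltW t0).
    - by rewrite ler_wpM2l ?(ltW C0)// ler_wpM2r ?invr_ge0 ?(ltW t0).
    rewrite lef_pV2 ?posrE ?exprn_gt0//; last by rewrite ltr_pwDl// !divr_ge0 ?(ltW d0) ?(ltW t0).
    rewrite lerXn2r ?nnegrE ?(ltW dt0)//; first by rewrite addr_ge0// !divr_ge0 ?(ltW d0) ?(ltW t0).
    rewrite (_ : d / (2 * t) = d / t / 2); first by rewrite lerDr.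
    by field; rewrite gt_eqF.
  rewrite /S le_eqVlt; apply/orP; left; apply/eqP.
  rewrite expr_div_n [(2 * t) ^+ _]exprMn [t ^+ n.+1]exprSr.
  have tn0 := exprn_gt0 n t0; have dn0 := exprn_gt0 n.+1 d0.
  have two0 : 0 < 2 ^+ n.+1 :> R by rewrite exprn_gt0.
  move: (t ^+ n) (d ^+ n.+1) (2 ^+ n.+1) tn0 dn0 two0 => u v e u0 v0 e0.
  by field; rewrite !gt_eqF.
have mc : measurable_fun setT (fun y => a y * (psi y - psi c)).
  by apply: measurable_funM => //; apply: measurable_funB.
have [ai _] := ball_bounded_integrable A0 ma aA aB.
have AS0 : 0 <= A * S by exact: mulr_ge0.
have bnd y : `|a y * (psi y - psi c)| <= A * S.
  have [yc|/aB ->] := pselect (eball c r y); last by rewrite mul0r normr0.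
  by rewrite normrM ler_pM// incr.
have supp y : ~ eball c r y -> a y * (psi y - psi c) = 0 by move=> /aB ->; rewrite mul0r.
have -> : convol (distr_of a) (dilate phi t) x = \int[mu]_y (a y * (psi y - psi c)).
  rewrite /convol /distr_of.
  have e : (fun y => a y * dilate phi t (x - y)) =
      (fun y => a y * (psi y - psi c) + a y * psi c).
    by apply/funext => y; rewrite -mulrDr subrK.
  rewrite e RintegralD//.
  - by rewrite RintegralZr// a0 mul0r addr0.
  - exact: (ball_bounded_integrable AS0 mc bnd supp).1.
  - by have := integrableZr measurableT (psi c) ai; apply: eq_integrable.
apply: (le_trans (ball_bounded_Rintegral AS0 mc bnd supp)).
apply: (le_trans (ler_wpM2l AS0 (vol_eball_le c (ltW r0)))).
rewrite /S expr_div_n (exprSr r) [(2 * r) ^+ n]exprMn le_eqVlt; apply/orP; left; apply/eqP.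
have dn0 := exprn_gt0 n.+1 d0; rewrite -/d.
move: (d ^+ n.+1) dn0 (2 ^+ n.+1) (2 ^+ n) (r ^+ n) => v v0 e1 e2 rn.
by field; rewrite gt_eqF.
Qed.

(** Near the ball the L^1 mass of phi_t suffices, far from it cancellation is used. With q = r / (r
    + |x - c|), |x - c| < 2r gives 1 <= 3q and |x - c| >= 2r gives r / |x - c| <= 2q, so one profile
    without singularity serves both. *)
Lemma max_fun_cancelling : exists2 K : R, 0 < K & forall a c r A x, 0 < r -> 0 <= A ->
  cancelling a c r A ->
  (max_fun phi (distr_of a) x <= (K * A * (r / (r + enorm (x - c))) ^+ n.+1)%:E)%E.
Proof.
have [D1 D10 HD1] := dilate_mass; have [D2 D20 HD2] := convol_far.
exists (D1 * 3 ^+ n.+1 + D2 * 2 ^+ n.+1); first by rewrite addr_gt0// mulr_gt0// exprn_gt0.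
move=> a c r A x r0 A0 ha; apply: ub_ereal_sup => _ [t /= t0 <-]; rewrite lee_fin.
pose q := r / (r + enorm (x - c)); have d0 := enorm_ge0 (x - c).
have q0 : 0 <= q by rewrite divr_ge0 ?addr_ge0 ?(ltW r0).
have rd : 0 < r + enorm (x - c) by rewrite ltr_pwDl.
have E1 : 0 <= D1 * 3 ^+ n.+1 * A * q ^+ n.+1 by rewrite !mulr_ge0 ?exprn_ge0 ?(ltW D10).
have E2 : 0 <= D2 * 2 ^+ n.+1 * A * q ^+ n.+1 by rewrite !mulr_ge0 ?exprn_ge0 ?(ltW D20).
rewrite -/q 2!mulrDl.
have [near|far] := ltP (enorm (x - c)) (2 * r).
  rewrite (@le_trans _ _ (D1 * 3 ^+ n.+1 * A * q ^+ n.+1)) ?lerDl//.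
  have q3 : 1 <= (3 * q) ^+ n.+1.
    by rewrite exprn_ege1// /q mulrA ler_pdivlMr// mul1r; lra.
  have [ma aA aB _] := ha.
  have mpsi : measurable_fun setT (fun y : 'rV[R]_n => dilate phi t (x - y)).
    by apply: rV_continuous_measurable; exact: dilate_shift_continuous.
  apply: (@le_trans _ _ (A * D1)).
    apply: normr_Rintegral_le; first exact: measurable_funM.
    apply: (@le_trans _ _ (\int[mu]_y (A%:E * `|dilate phi t (x - y)|%:E))%E).
      apply: le_integral_pointwise => y; first by rewrite lee_fin.
      by rewrite -EFinM lee_fin normrM ler_wpM2r.
    rewrite ge0_integralZl_EFin//; last first.
      by apply/measurable_EFinP; exact: measurableT_comp.
    by rewrite EFinM lee_wpmul2l ?lee_fin// HD1.
  have := ler_wpM2l (mulr_ge0 A0 (ltW D10)) q3; rewrite mulr1 exprMn.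
  by move/le_trans; apply; rewrite le_eqVlt; apply/orP; left; apply/eqP; ring.
rewrite (@le_trans _ _ (D2 * 2 ^+ n.+1 * A * q ^+ n.+1)) ?lerDr//.
apply: (le_trans (HD2 a c r A t x r0 A0 ha t0 far)).
have dp : 0 < enorm (x - c) by rewrite (lt_le_trans _ far)// mulr_gt0.
have : (r / enorm (x - c)) ^+ n.+1 <= (2 * q) ^+ n.+1.
  apply: lerXn2r; rewrite ?nnegrE; [by rewrite divr_ge0// ltW|exact: mulr_ge0|].
  rewrite ler_pdivrMr// /q mulrA mulrAC ler_pdivlMr//.
  have : 0 <= r * enorm (x - c) by rewrite mulr_ge0// ltW.
  have : r * r <= r * enorm (x - c) by rewrite ler_wpM2l ?(ltW r0)//; lra.
  by lra.
move=> /(ler_wpM2l (mulr_ge0 (ltW D20) A0))/le_trans; apply.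
rewrite exprMn le_eqVlt; apply/orP; left; apply/eqP.
by move: (q ^+ n.+1) (2 ^+ n.+1) => u v; ring.
Qed.

Lemma max_fun_ge0 F x : (0 <= max_fun phi F x)%E.
Proof.
apply: (@le_trans _ _ `|convol F (dilate phi 1) x|%:E); first by rewrite lee_fin.
by apply: ereal_sup_ubound; exists 1 => //=.
Qed.

(** The pointwise profile is integrated against w by the tail estimate. For A = 1/w(B) the bound is
    the constant K, the same for all balls. *)
Lemma H1w_cancelling w C t : density w -> 0 < C -> 0 < t < 1 -> growth C t w ->
  exists2 K : R, 0 < K & forall a c r A, 0 < r -> 0 <= A -> cancelling a c r A ->
    H1w phi w (distr_of a) /\
    (H1w_norm phi w (distr_of a) <= (K * A * wm w (eball c r))%:E)%E.
Proof.
move=> dw C0 t01 Hg; have [K K0 HK] := max_fun_cancelling.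
pose D := 4 ^+ n.+1 * C / (1 - t).
have D0 : 0 < D.
  by rewrite divr_gt0 ?mulr_gt0 ?exprn_gt0//; case/andP: t01 => _; rewrite subr_gt0.
exists (K * D); first exact: mulr_gt0.
move=> a c r A r0 A0 ha; have [mw w0 _] := dw.
have H : (H1w_norm phi w (distr_of a) <= (K * D * A * wm w (eball c r))%:E)%E.
  apply: (@le_trans _ _ (\int[mu]_x ((K * A)%:E *
    ((r / (r + enorm (x - c))) ^+ n.+1 * w x)%:E))%E).
    apply: le_integral_pointwise => x; first by rewrite mule_ge0 ?max_fun_ge0 ?lee_fin.
    rewrite [((_ ^+ _) * _)%:E]EFinM muleA lee_wpmul2r ?lee_fin// -EFinM.
    exact: HK.
  rewrite ge0_integralZl_EFin//; last 3 first.
  - by move=> x _; rewrite lee_fin mulr_ge0// decay_ge0.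
  - apply/measurable_EFinP; apply: measurable_funM => //.
    by apply: rV_continuous_measurable; exact: continuous_decay.
  - by rewrite mulr_ge0 ?(ltW K0).
  have KA0 : 0 <= K * A by rewrite mulr_ge0 ?(ltW K0).
  apply: (@le_trans _ _ ((K * A)%:E * (D * wm w (eball c r))%:E)%E).
    by apply: lee_wpmul2l; [rewrite lee_fin|exact: tail_integral].
  by rewrite -EFinM lee_fin mulrACA mulrA.
split=> //; split; first exact: (cancelling_tempered A0 ha).
by rewrite (le_lt_trans H)// ltry.
Qed.

End atom_maximal.

(** * Riesz transforms and commutators off the support *)

Section ball_products.
Context {R : realType} {n : nat}.
Implicit Types (f g h : 'rV[R]_n -> R) (x c : 'rV[R]_n) (r M : R).
Local Notation mu := (leb n).

Lemma Rintegral_supp f B : (forall x, ~ B x -> f x = 0) ->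
  \int[mu]_x f x = \int[mu]_(x in B) f x.
Proof.
move=> f0; rewrite [RHS]Rintegral_mkcond; congr (fine _); apply: eq_integral => x _.
by rewrite patchE; case: ifPn => //; rewrite notin_setE => /f0 ->.
Qed.

Lemma integrable_mul_bounded h g c r M : measurable_fun setT h ->
  (forall x, eball c r x -> `|h x| <= M) ->
  mu.-integrable (eball c r) (EFin \o g) ->
  mu.-integrable (eball c r) (EFin \o (fun x => h x * g x)).
Proof.
move=> mh hM gi; have mB := @measurable_eball R n c r.
have Mgi : mu.-integrable (eball c r) (fun x => M%:E * (EFin \o g) x)%E.
  exact: integrableZl.
apply: (le_integrable mB _ _ Mgi).
  apply/measurable_EFinP; apply: measurable_funM; first exact: measurable_funTS.
  by apply/measurable_EFinP; exact: measurable_int gi.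
move=> x Bx; rewrite /= lee_fin !normrM ler_wpM2r//.
by rewrite (le_trans (hM x Bx))// ler_norm.
Qed.

Lemma Rintegral_mul_bounded h g c r M : 0 <= M -> measurable_fun setT h ->
  (forall x, eball c r x -> `|h x| <= M) ->
  mu.-integrable (eball c r) (EFin \o g) ->
  `|\int[mu]_(x in eball c r) (h x * g x)| <= M * \int[mu]_(x in eball c r) `|g x|.
Proof.
move=> M0 mh hM gi; have mB := @measurable_eball R n c r.
have hgi := integrable_mul_bounded mh hM gi.
apply: (le_trans (le_normr_Rintegral mB hgi)).
rewrite -RintegralZl//; last exact: (integrable_norm gi).
apply: le_Rintegral => //; first exact: (integrable_norm hgi).
  have := integrableZl mB M (integrable_norm gi).
  by apply: eq_integrable.
by move=> x Bx; rewrite normrM ler_wpM2r// hM.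
Qed.

End ball_products.

Section riesz_kernel.
Context {R : realType} {n : nat}.
Implicit Types (x y z v c : 'rV[R]_n) (r : R) (j : 'I_n).
Local Notation mu := (leb n).

Definition rkernel j z : R := z ord0 j / enorm z ^+ n.+1.

Lemma measurable_rkernel j x : measurable_fun setT (fun y => rkernel j (x - y)).
Proof.
have -> : (fun y => rkernel j (x - y)) =
    (fun y => (x ord0 j - y ord0 j) * (enorm (y - x) `^ (- 1)) ^+ n.+1).
  apply/funext => y; rewrite /rkernel !mxE enormB; congr (_ * _).
  by rewrite powRN powRr1 ?enorm_ge0// exprVn.
apply: measurable_funM.
  by apply: measurable_funB => //; exact: measurable_rV_coord.
apply: (measurableT_comp (exprn_measurable _)).
by apply: (measurableT_comp (measurable_powR _) (enormB_measurable x)).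
Qed.

(** Numerator and denominator are varied separately, giving the two constants: the first uses |z +
    v| >= |z| / 2, the second factors the difference of powers of norms, all of which are at most
    2|z|. *)
Lemma rkernel_smooth j z v : 0 < enorm z -> enorm v <= enorm z / 2 ->
  `|rkernel j (z + v) - rkernel j z| <=
    (2 ^+ n.+1 + n.+1%:R * 4 ^+ n.+1) * enorm v / enorm z ^+ n.+1.
Proof.
move=> z0 vz; set m := n.+1; pose s := enorm (z + v).
have := enorm_dist (z + v) z; rewrite addrAC subrr add0r => sz.
have {sz} /andP[s1 s2] : enorm z / 2 <= s <= 2 * enorm z.
  by move: sz; rewrite ler_norml -/s => /andP[h1 h2]; apply/andP; split; lra.
have s0 : 0 < s by rewrite (lt_le_trans _ s1)// divr_gt0.
have sm := exprn_gt0 m s0; have zm := exprn_gt0 m z0.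
have sV : (s ^+ m)^-1 <= 2 ^+ m / enorm z ^+ m.
  rewrite -[leLHS]div1r ler_pdivrMr// mulrAC ler_pdivlMr// mul1r -exprMn.
  by rewrite lerXn2r ?nnegrE ?mulr_ge0 ?(ltW s0) ?(ltW z0)//; lra.
have -> : rkernel j (z + v) - rkernel j z =
    v ord0 j / s ^+ m + z ord0 j * (enorm z ^+ m - s ^+ m) / (s ^+ m * enorm z ^+ m).
  by rewrite /rkernel !mxE -/s -/m; field; rewrite !gt_eqF.
have diffX : `|enorm z ^+ m - s ^+ m| <= enorm v * (m%:R * (2 * enorm z) ^+ n).
  rewrite subrXX normrM ler_pM//.
    by rewrite (le_trans (enorm_dist _ _))// opprD addNKr enormN.
  apply: (le_trans (ler_norm_sum _ _ _)).
  apply: (@le_trans _ _ (\sum_(i < m) (2 * enorm z) ^+ n)); last first.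
    by rewrite sumr_const card_ord -[leLHS]mulr_natl.
  apply: ler_sum => i _; rewrite normrM !normrX !ger0_norm ?(ltW s0) ?(ltW z0)//=.
  have -> : (2 * enorm z) ^+ n = (2 * enorm z) ^+ (n - i) * (2 * enorm z) ^+ i.
    by rewrite -exprD subnK// -ltnS.
  rewrite ler_pM ?exprn_ge0 ?(ltW s0) ?(ltW z0)// lerXn2r ?nnegrE ?mulr_ge0 ?(ltW s0) ?(ltW z0)//.
  lra.
apply: (le_trans (ler_normD _ _)).
rewrite mulrDl mulrDl; apply: lerD.
  rewrite normrM normfV (gtr0_norm sm).
  have := ler_pM (normr_ge0 _) (_ : 0 <= (s ^+ m)^-1) (enorm_coord v j) sV.
  rewrite invr_ge0 ltW// => /(_ isT)/le_trans; apply.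
  by rewrite mulrA (mulrC (enorm v)).
rewrite normrM normfV normrM (gtr0_norm (mulr_gt0 sm zm)) invfM.
have A1 := ler_pM (normr_ge0 _) (normr_ge0 _) (enorm_coord z j) diffX.
have sz0 : 0 <= (s ^+ m)^-1 by rewrite invr_ge0 ltW.
have A2 := ler_pM (mulr_ge0 (normr_ge0 _) (normr_ge0 _)) sz0 A1 sV.
have zi0 : 0 <= (enorm z ^+ m)^-1 by rewrite invr_ge0 ltW.
have := ler_wpM2r zi0 A2; rewrite -[in leLHS]mulrA => /le_trans; apply.
rewrite ler_wpM2r// {A1 A2 sV diffX}.
have -> : enorm z * (enorm v * (m%:R * (2 * enorm z) ^+ n)) * (2 ^+ m / enorm z ^+ m) =
   enorm v * m%:R * (2 ^+ n * 2 ^+ m).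
  rewrite exprMn /m (exprS (enorm z)).
  have zn0 := exprn_gt0 n z0; move: (2 ^+ n.+1) (2 ^+ n) => e1 e2.
  move: (enorm z ^+ n) zn0 => u u0.
  by field; rewrite !gt_eqF.
have -> : m%:R * 4 ^+ m * enorm v = enorm v * m%:R * 4 ^+ m by ring.
rewrite ler_wpM2l ?mulr_ge0 ?enorm_ge0//.
have -> : (4 : R) = 2 * 2 by ring.
rewrite exprMn ler_wpM2r ?exprn_ge0// ler_weXn2l ?ler1n//.
Qed.

End riesz_kernel.

Section riesz_off_support.
Context {R : realType} {n : nat}.
Implicit Types (f : 'rV[R]_n -> R) (x y z v c : 'rV[R]_n) (r : R) (j : 'I_n).
Local Notation mu := (leb n).

(** For e < |x - c| - r the truncation removes only points where f vanishes, so the truncated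
    integrals are eventually constant and the limit defining [riesz] is that constant. *)
Lemma riesz_far j f c r x : (forall y, ~ eball c r y -> f y = 0) ->
  r < enorm (x - c) ->
  riesz j f x = \int[mu]_(y in eball c r) (@riesz_const R n * rkernel j (x - y) * f y).
Proof.
move=> f0 rx; rewrite /riesz -Rintegral_supp; last by move=> y /f0 ->; rewrite mulr0.
apply: cvg_lim => //; apply: cvg_near_cst; near=> e.
rewrite /riesz_trunc Rintegral_mkcond; congr (fine _); apply: eq_integral => y _.
rewrite patchE; case: ifPn => [_|]; first by rewrite /rkernel !mxE.
rewrite notin_setE /= => /negP; rewrite -leNgt => xye.
rewrite f0 ?mulr0// /eball/= => yc.
have := enorm_sub x y c; apply/negP; rewrite -ltNge.
have : e < enorm (x - c) - r by near: e; apply: nbhs_right_lt; rewrite subr_gt0.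
by lra.
Unshelve. all: by end_near. Qed.

End riesz_off_support.

(** * Lower bound for the commutators far from the ball *)

Section commutator_far.
Context {R : realType} {n : nat}.
Variables (n0 : (0 < n)%N) (b : 'rV[R]_n -> R).
Hypothesis bmob : bmo b.
Implicit Types (a : 'rV[R]_n -> R) (x y z v c : 'rV[R]_n) (r A : R) (j : 'I_n).
Local Notation mu := (leb n).

Let lb : loc_integrable b. Proof. by case: bmob. Qed.

Let Ck : R := 2 ^+ n.+1 + n.+1%:R * 4 ^+ n.+1.

Let Ck0 : 0 <= Ck. Proof. by rewrite addr_ge0 ?mulr_ge0 ?exprn_ge0. Qed.

Lemma rkernel_increment j c r x y : 0 < r -> 2 * r <= enorm (x - c) -> eball c r y ->
  `|rkernel j (x - y) - rkernel j (x - c)| <= Ck * r / enorm (x - c) ^+ n.+1.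
Proof.
move=> r0 xc yc; have d0 : 0 < enorm (x - c) by rewrite (lt_le_trans _ xc)// mulr_gt0.
have cy : enorm (c - y) < r by rewrite enormB.
have := @rkernel_smooth R n j (x - c) (c - y) d0.
rewrite addrA subrK => H; apply: (le_trans (H _)); first by lra.
by rewrite ler_wpM2r ?invr_ge0 ?exprn_ge0 ?enorm_ge0// ler_wpM2l// ltW.
Qed.

Let expand_error (q A O t u p v s : R) : u != 0 ->
  q * A * (O * t / u + p * v * (s * t) / u) =
  q * t / u * (A * O) + p * (q * t / u * (A * (v * s))).
Proof. by move=> u0; field. Qed.

Section one_ball.
Variables (a : 'rV[R]_n -> R) (c : 'rV[R]_n) (r A : R) (x : 'rV[R]_n).
Hypotheses (r0 : 0 < r) (A0 : 0 <= A) (ha : cancelling a c r A).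
Hypothesis xc : 2 * r <= enorm (x - c).

Local Notation B := (eball c r).
Local Notation d := (enorm (x - c)).
Local Notation bB := (avg B b).
Local Notation kappa := (@riesz_const R n).
Let mB : measurable B := @measurable_eball R n c r.
Let d0 : 0 < d. Proof. by rewrite (lt_le_trans _ xc)// mulr_gt0. Qed.
Let e : R := Ck * r / d ^+ n.+1.
Let e0 : 0 <= e. Proof. by rewrite divr_ge0 ?mulr_ge0 ?exprn_ge0 ?(ltW r0) ?(ltW d0). Qed.
Let k j y := rkernel j (x - y).
Let g y := a y * (b y - bB).

Let ai : mu.-integrable B (EFin \o a).
Proof.
have [ma aA a0 _] := ha.
exact: integrableS (ball_bounded_integrable A0 ma aA a0).1.
Qed.

Let gi : mu.-integrable B (EFin \o g).
Proof.
have [ma aA a0 _] := ha.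
apply: (@integrable_mul_bounded _ _ _ _ _ _ A) => //.
exact: integrable_sub_cst.
Qed.

Let mk j : measurable_fun setT (k j). Proof. exact: measurable_rkernel. Qed.

Let kB j y : B y -> `|k j y| <= e + `|rkernel j (x - c)|.
Proof.
move=> yB; have := rkernel_increment j r0 xc yB.
have := ler_normB (k j y) (k j y - rkernel j (x - c)); rewrite -/(k j y) -/e.
have := ler_normD (k j y - rkernel j (x - c)) (rkernel j (x - c)); rewrite subrK.
by lra.
Qed.

Let kfi j f : mu.-integrable B (EFin \o f) ->
  mu.-integrable B (EFin \o (fun y => k j y * f y)).
Proof. by move=> fi; apply: (integrable_mul_bounded (mk j) (@kB j)). Qed.

Let k_near j f : mu.-integrable B (EFin \o f) ->
  `|\int[mu]_(y in B) (k j y * f y) - rkernel j (x - c) * \int[mu]_(y in B) f y| <=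
    e * \int[mu]_(y in B) `|f y|.
Proof.
move=> fi.
have mh : measurable_fun setT (fun y => k j y - rkernel j (x - c)).
  by apply: measurable_funB.
have -> : \int[mu]_(y in B) (k j y * f y) - rkernel j (x - c) * \int[mu]_(y in B) f y =
    \int[mu]_(y in B) ((k j y - rkernel j (x - c)) * f y).
  rewrite -RintegralZl// -RintegralB//.
  - by apply: eq_Rintegral => y _; rewrite mulrBl.
  - exact: kfi.
  - have := integrableZl mB (rkernel j (x - c)) fi; exact: eq_integrable.
apply: Rintegral_mul_bounded => // y yB.
exact: rkernel_increment.
Qed.

Let int_a : \int[mu]_(y in B) a y = 0.
Proof. by have [_ _ a0 <-] := ha; rewrite -Rintegral_supp. Qed.

Let int_abs_a : \int[mu]_(y in B) `|a y| <= A * (2 * r) ^+ n.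
Proof.
have [ma aA a0 _] := ha.
rewrite -Rintegral_supp; last by move=> y /a0 ->; rewrite normr0.
apply: le_trans (ler_wpM2l A0 (vol_eball_le c (ltW r0))).
apply: le_trans (ler_norm _) _.
apply: ball_bounded_Rintegral => //.
- by apply: measurableT_comp.
- by move=> y; rewrite normr_id.
- by move=> y /a0 ->; rewrite normr0.
Qed.

Let int_abs_g : \int[mu]_(y in B) `|g y| <= A * \int[mu]_(y in B) `|b y - bB|.
Proof.
have [ma aA a0 _] := ha.
rewrite -RintegralZl//; last exact: integrable_normB.
apply: le_Rintegral => //.
- exact: (integrable_norm gi).
- have := integrableZl mB A (integrable_normB bmob c r bB); exact: eq_integrable.
- by move=> y _; rewrite /g normrM ler_wpM2r.
Qed.

(** The commutator is unchanged when b is replaced by b - b_B, and off the ball both Riesz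
    transforms are ordinary integrals. *)
Lemma commutator_far_eq j : commutator b j a x =
  kappa * ((b x - bB) * \int[mu]_(y in B) (k j y * a y) - \int[mu]_(y in B) (k j y * g y)).
Proof.
have [ma aA a0 _] := ha.
have rd : r < d by rewrite (lt_le_trans _ xc)// ltr_pMl ?ltr1n.
rewrite /commutator /= (riesz_far j a0 rd) (@riesz_far _ _ _ _ c r)//; last first.
  by move=> y /a0 /= ->; rewrite mulr0.
have h1 : \int[mu]_(y in B) (kappa * rkernel j (x - y) * a y) =
    kappa * \int[mu]_(y in B) (k j y * a y).
  rewrite -RintegralZl//; last exact: kfi.
  by apply: eq_Rintegral => y _; rewrite mulrA.
have h2 : \int[mu]_(y in B) (kappa * rkernel j (x - y) * (b \* a) y) =
    kappa * (\int[mu]_(y in B) (k j y * g y) + bB * \int[mu]_(y in B) (k j y * a y)).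
  rewrite -RintegralZl//; last exact: kfi.
  have i2 : mu.-integrable B (EFin \o (fun y => bB * (k j y * a y))).
    by have := integrableZl mB bB (kfi j ai); exact: eq_integrable.
  rewrite -RintegralD//; last exact: kfi.
  rewrite -RintegralZl//.
    by apply: eq_Rintegral => y _; rewrite /= /g /k; ring.
  by have := integrableD mB (kfi j gi) i2; exact: eq_integrable.
by rewrite h1 h2; ring.
Qed.

Lemma commutator_far_ge : 0 < kappa ->
  kappa * (\int[mu]_(y in B) g y / d ^+ n) <=
  \sum_j `|commutator b j a x| +
  kappa * n%:R * Ck * A * (\int[mu]_(y in B) `|b y - bB| * r / d ^+ n.+1 +
    `|b x - bB| * 2 ^+ n * r ^+ n.+1 / d ^+ n.+1).
Proof.
move=> kp.
set m := \int[mu]_(y in B) g y; set O := \int[mu]_(y in B) `|b y - bB|.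
pose E := Ck * A * (O * r / d ^+ n.+1 + `|b x - bB| * 2 ^+ n * r ^+ n.+1 / d ^+ n.+1).
have one j : kappa * (`|rkernel j (x - c)| * m) <= `|commutator b j a x| + kappa * E.
  rewrite commutator_far_eq [`|kappa * _|]normrM (gtr0_norm kp) -mulrDr ler_wpM2l ?(ltW kp)//.
  have h1 := k_near j ai; rewrite int_a mulr0 subr0 in h1.
  have h2 := k_near j gi; rewrite -/m in h2.
  have {}h1 := le_trans h1 (ler_wpM2l e0 int_abs_a).
  have {}h2 := le_trans h2 (ler_wpM2l e0 int_abs_g); rewrite -/O in h2.
  set I1 := \int[mu]_(y in B) (k j y * a y) in h1 *.
  set I2 := \int[mu]_(y in B) (k j y * g y) in h2 *.
  have -> : E = e * (A * O) + `|b x - bB| * (e * (A * (2 * r) ^+ n)).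
    by rewrite /E /e exprMn (exprSr r) expand_error// gt_eqF// exprn_gt0.
  have h3 : `|(b x - bB) * I1| <= `|b x - bB| * (e * (A * (2 * r) ^+ n)).
    by rewrite normrM ler_wpM2l.
  have h4 : `|rkernel j (x - c)| * m <= `|rkernel j (x - c) * m|.
    by rewrite [leRHS]normrM ler_wpM2l// ler_norm.
  have h5 : `|rkernel j (x - c) * m| <= `|I2| + `|I2 - rkernel j (x - c) * m|.
    by rewrite -[X in `|X| <= _](subKr I2) (le_trans (ler_normB _ _)).
  have h6 : `|I2| <= `|(b x - bB) * I1 - I2| + `|(b x - bB) * I1|.
    by rewrite -[X in `|X| <= _](subKr ((b x - bB) * I1)) (le_trans (ler_normB _ _))// addrC.
  by rewrite (le_trans h4)// (le_trans h5)// (le_trans (lerD h6 h2))// -addrA lerD2l addrC lerD2l.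
have kerE j : `|rkernel j (x - c)| = `|(x - c) ord0 j| / d ^+ n.+1.
  by rewrite /rkernel normrM normfV (gtr0_norm (exprn_gt0 _ d0)).
(* A negative [m] makes the left side nonpositive, while the right side never is negative. *)
have [m0|m0] := ltP m 0.
  apply: (@le_trans _ _ 0).
    by rewrite pmulr_rle0// pmulr_lle0 ?ltW// invr_gt0 exprn_gt0.
  apply: addr_ge0; first by apply: sumr_ge0.
  apply: mulr_ge0; first by apply: mulr_ge0 => //; apply: mulr_ge0 => //; apply: mulr_ge0 => //; exact: ltW kp.
  apply: addr_ge0.
    rewrite divr_ge0 ?exprn_ge0 ?(ltW d0)// mulr_ge0 ?(ltW r0)//.
    exact: Rintegral_ge0.
  by rewrite divr_ge0 ?mulr_ge0 ?exprn_ge0 ?(ltW d0) ?(ltW r0).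
apply: (@le_trans _ _ (\sum_j kappa * (`|rkernel j (x - c)| * m))).
  rewrite -mulr_sumr ler_wpM2l ?(ltW kp)// -mulr_suml mulrC ler_wpM2r//.
  under eq_bigr do rewrite kerE.
  rewrite -mulr_suml; have dn := exprn_gt0 n.+1 d0.
  rewrite ler_pdivlMr// exprS mulrCA mulVf ?gt_eqF ?exprn_gt0// mulr1.
  exact: enorm_le_sum.
apply: (@le_trans _ _ (\sum_j (`|commutator b j a x| + kappa * E))).
  by apply: ler_sum => j _; exact: one.
rewrite big_split/= lerD2l sumr_const card_ord -[leLHS]mulr_natl /E.
rewrite le_eqVlt; apply/orP; left; apply/eqP; ring.
Qed.

End one_ball.
End commutator_far.

(** * Positivity of the constant of the Riesz kernel *)

Section gamma_positivity.
Context {R : realType}.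
Local Notation mu := (@lebesgue_measure R).

(** Raise t <= K e^(t/K) to the power s. With K = 2(s + 1) the exponent s/K is at most 1/2, so half
    of the decay of e^(-t) survives in the Gamma integral. *)
Lemma powR_le_expR (s t : R) : 0 <= s -> 0 < t ->
  t `^ s <= (2 * (s + 1)) `^ s * expR (t / 2).
Proof.
move=> s0 t0; have K0 : 0 < 2 * (s + 1) by rewrite mulr_gt0// ltr_wpDl.
set K := 2 * (s + 1) in K0 *.
have h : t <= K * expR (t / K).
  rewrite -ler_pdivrMl// mulrC (le_trans _ (expR_ge1Dx _))//; lra.
have h1 : t `^ s <= (K * expR (t / K)) `^ s.
  by apply: ge0_ler_powR => //; rewrite nnegrE ?(ltW t0)// mulr_ge0 ?expR_ge0// (ltW K0).
apply: (le_trans h1); rewrite powRM ?expR_ge0 ?(ltW K0)// ler_wpM2l ?powR_ge0//.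
rewrite -expRM ler_expR.
rewrite -mulrA ler_pM2l// ler_pdivrMl// /K; lra.
Qed.

(** A real-valued integral defaults to 0 when it diverges, so finiteness has to be proved too: the
    integrand is dominated by a multiple of the exponential density of rate 1/2. Positivity comes
    from [1, 2], where it is at least e^-2. *)
Lemma Gamma_gt0 (z : R) : 1 <= z -> 0 < Defs.Gamma z.
Proof.
move=> z1; rewrite /Defs.Gamma.
set D := `]0, +oo[%classic; pose s := z - 1.
have s0 : 0 <= s by rewrite subr_ge0.
pose f (t : R) := t `^ s * expR (- t).
have f0 t : 0 <= f t by rewrite mulr_ge0 ?powR_ge0 ?expR_ge0.
have mf : measurable_fun setT f.
  apply: measurable_funM; first exact: measurable_powR.
  apply: (measurableT_comp (@measurable_expR R)).
  exact: oppr_measurable.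
have mD : measurable D by exact: measurable_itv.
have mfD E : measurable_fun E (fun t => (f t)%:E).
  by apply: measurable_funTS; exact/measurable_EFinP.
pose C := (2 * (s + 1)) `^ s.
have C0 : 0 <= C by exact: powR_ge0.
have half0 : 0 < (2^-1 : R) by rewrite invr_gt0.
have fin : (\int[mu]_(t in D) (f t)%:E < +oo)%E.
  apply: (@le_lt_trans _ _ (\int[mu]_(t in D) ((2 * C)%:E * (exponential_pdf 2^-1 t)%:E))%E).
    apply: ge0_le_integral => //.
    - by move=> t _; rewrite lee_fin.
    - exact: mfD.
    - apply: measurable_funeM; apply: measurable_funTS; apply/measurable_EFinP.
      exact: measurable_exponential_pdf.
    - move=> t; rewrite /D/= in_itv/= andbT => t0.
      rewrite -EFinM lee_fin exponential_pdfE ?(ltW t0)// (mulrC 2) -mulrA mulVKf//.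
      rewrite /f mulrC (le_trans (ler_wpM2l (expR_ge0 _) (powR_le_expR s0 t0)))//.
      rewrite mulrCA -expRD ler_wpM2l// ler_expR; lra.
  apply: (@le_lt_trans _ _ (\int[mu]_t ((2 * C)%:E * (exponential_pdf 2^-1 t)%:E))%E).
    apply: ge0_subset_integral => //.
    - apply: measurable_funeM; apply/measurable_EFinP.
      exact: measurable_exponential_pdf.
    - by move=> t _; rewrite mule_ge0 ?lee_fin ?mulr_ge0// exponential_pdf_ge0// ltW.
  rewrite ge0_integralZl_EFin//.
  - by rewrite integral_exponential_pdf// mule1 ltry.
  - by move=> t _; rewrite lee_fin exponential_pdf_ge0// ltW.
  - by apply/measurable_EFinP; exact: measurable_exponential_pdf.
  - by rewrite mulr_ge0.
have pos : ((expR (- 2))%:E <= \int[mu]_(t in D) (f t)%:E)%E.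
  pose I : set (measurableTypeR R) := `[1, 2]%classic.
  have mI : measurable I by exact: measurable_itv.
  have p1 : (\int[mu]_(t in I) (f t)%:E <= \int[mu]_(t in D) (f t)%:E)%E.
    apply: ge0_subset_integral => //.
    - exact: mfD.
    - by move=> t _; rewrite lee_fin.
    - by move=> t; rewrite /D /I /= !in_itv/= => /andP[t1 _]; rewrite andbT (lt_le_trans _ t1).
  apply: (le_trans _ p1).
  have <- : (\int[mu]_(t in I) (cst (expR (- 2))%:E) t)%E = (expR (- 2))%:E.
    rewrite integral_cst//= /I lebesgue_measure_itv/= lte_fin ltr1n -EFinB -EFinM.
    by congr EFin; rewrite (_ : 2 - 1 = 1 :> R) ?mulr1//; ring.
  apply: ge0_le_integral => //.
  - by move=> t _; rewrite lee_fin expR_ge0.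
  - exact: mfD.
  - move=> t; rewrite /I /= in_itv/= => /andP[t1 t2]; rewrite lee_fin /f mulrC.
    rewrite -[leLHS]mulr1 ler_pM ?expR_ge0//; first by rewrite ler_expR lerN2.
    by rewrite -[leLHS](powRr0 t) ler_powR.
rewrite /Rintegral fine_gt0//; apply/andP; split=> //.
by apply: lt_le_trans pos; rewrite lte_fin expR_gt0.
Qed.

Lemma riesz_const_gt0 n : (0 < n)%N -> 0 < @riesz_const R n.
Proof.
move=> n0; rewrite /riesz_const divr_gt0// ?powR_gt0 ?pi_gt0//.
by apply: Gamma_gt0; rewrite ler_pdivlMr// mul1r ler_nat.
Qed.

End gamma_positivity.

(** * A continuous test function for the oscillation *)

Section continuous_approximation.
Context {R : realType} {n : nat}.
Variables (B : set 'rV[R]_n) (G : 'rV[R]_n -> R).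
Hypotheses (mB : measurable B) (G0 : forall x, 0 <= G x).
Hypothesis Gi : (leb n).-integrable B (EFin \o G).
Implicit Types (u v h : 'rV[R]_n -> R) (x : 'rV[R]_n) (A : set 'rV[R]_n).
Local Notation mu := (leb n).

(** The norm of L^1(B, G dx), left abstract so that one choice of G can control several integrals at
    once. *)
Definition wdist u : \bar R := (\int[mu]_(x in B) (`|u x| * G x)%:E)%E.

Let mG : measurable_fun B G.
Proof. by apply/measurable_EFinP; exact: measurable_int Gi. Qed.

Let m_wdist u : measurable_fun setT u -> measurable_fun B (fun x => (`|u x| * G x)%:E).
Proof.
move=> m_u; apply/measurable_EFinP; apply: measurable_funM => //.
by apply: measurable_funTS; exact: measurableT_comp.
Qed.

Lemma le_wdist u v : measurable_fun setT u -> measurable_fun setT v ->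
  (forall x, B x -> `|u x| <= `|v x|) -> (wdist u <= wdist v)%E.
Proof.
move=> m_u m_v uv; apply: ge0_le_integral => //.
- by move=> x _; rewrite lee_fin mulr_ge0.
- exact: m_wdist.
- exact: m_wdist.
- by move=> x Bx; rewrite lee_fin ler_wpM2r// uv.
Qed.

Lemma wdistD u v : measurable_fun setT u -> measurable_fun setT v ->
  (wdist (fun x => `|u x| + `|v x|)%R = wdist u + wdist v)%E.
Proof.
move=> m_u m_v; rewrite /wdist -ge0_integralD//.
- by apply: eq_integral => x _; rewrite ger0_norm ?addr_ge0// mulrDl EFinD.
- by move=> x _; rewrite lee_fin mulr_ge0.
- exact: m_wdist.
- by move=> x _; rewrite lee_fin mulr_ge0.
- exact: m_wdist.
Qed.

Lemma wdist_small (u : nat -> 'rV[R]_n -> R) (e : R) : 0 < e ->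
  (forall k, measurable_fun setT (u k)) -> (forall k x, `|u k x| <= 1) ->
  (forall x, B x -> u k x @[k --> \oo] --> 0) -> exists k, (wdist (u k) <= e%:E)%E.
Proof.
move=> e0 mu_ u1 u0.
have : (wdist (u k) @[k --> \oo] --> \int[mu]_(x in B) (cst 0 x))%E.
  apply: (@dominated_cvg _ _ _ mu B mB (fun k x => (`|u k x| * G x)%:E) (cst 0%E) (EFin \o G)).
  - by move=> k; exact: m_wdist.
  - move=> x Bx.
    have h : `|u k x| * G x @[k --> \oo] --> (0 : R).
      have := cvgM (cvg_norm (u0 x Bx)) (cvg_cst (G x)).
      by rewrite normr0 mul0r; apply.
    by apply: cvg_EFin; [exact: nearW|exact: h].
  - by [].
  - exact: Gi.
  - by move=> k x _; rewrite /= lee_fin ger0_norm ?mulr_ge0// ler_piMl.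
rewrite integral0 => /fine_cvgP[[N1 _ hN1] /cvgrPdist_lt/(_ e e0)[N2 _ hN2]].
exists (maxn N1 N2).
have /fineK <- := hN1 (maxn N1 N2) (leq_maxl _ _).
have := hN2 (maxn N1 N2) (leq_maxr _ _).
by rewrite /= sub0r normrN => /ltW; rewrite lee_fin => /(le_trans (ler_norm _)).
Qed.

(** Values in [0, 1] keep the approximants uniformly bounded and make them combine under complements
    and unions. *)
Definition approximable A := forall e : R, 0 < e -> exists h,
  [/\ continuous h, forall x, 0 <= h x <= 1 & (wdist (fun x => \1_A x - h x)%R <= e%:E)%E].


Let cmeas h : continuous h -> measurable_fun setT h.
Proof. exact: rV_continuous_measurable. Qed.

Let mind A : measurable A -> measurable_fun setT (\1_A : 'rV[R]_n -> R).
Proof. by move=> mA; exact: measurable_indic. Qed.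

Lemma approximable0 : approximable set0.
Proof.
move=> d d0; exists (fun=> 0); split; [exact: cst_continuous|by move=> x; rewrite lexx ler01|].
rewrite /wdist integral0_eq ?lee_fin ?(ltW d0)// => x _.
by rewrite indicE in_set0 subrr normr0 mul0r.
Qed.

Lemma approximableC A : approximable A -> approximable (~` A).
Proof.
move=> aA e e0; have [h [ch h01 hd]] := aA e e0; exists (fun x => 1 - h x); split.
- by move=> x; refine (cvgB (cvg_cst _) (ch x)).
- by move=> x; have /andP[h0 h1] := h01 x; apply/andP; split; lra.
apply: le_trans hd; rewrite le_eqVlt; apply/orP; left; apply/eqP.
apply: eq_integral => x _; congr (_ * _)%:E; rewrite -[RHS]normrN; congr (`|_|).
rewrite !indicE in_setC; case: (x \in A) => /=; ring.
Qed.

Lemma approximableU A A' : measurable A -> measurable A' ->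
  approximable A -> approximable A' -> approximable (A `|` A').
Proof.
move=> mA mA' aA aA' e e0; have e20 : 0 < e / 2 by rewrite divr_gt0.
have [h [ch h01 hd]] := aA _ e20; have [h' [ch' h01' hd']] := aA' _ e20.
(* This is 1 - (1 - h)(1 - h'), again with values in [0, 1]; its error is at most the sum of the two
   errors. *)
exists (fun x => h x + h' x - h x * h' x); split.
- move=> x; refine (cvgB (cvgD (ch x) (ch' x)) (cvgM (ch x) (ch' x))).
- move=> x; have /andP[a0 a1] := h01 x; have /andP[b0 b1] := h01' x.
  by apply/andP; split; nra.
have mu1 : measurable_fun setT (fun x => \1_A x - h x).
  by apply: measurable_funB; [exact: mind|exact: cmeas].
have mu2 : measurable_fun setT (fun x => \1_A' x - h' x).
  by apply: measurable_funB; [exact: mind|exact: cmeas].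
rewrite (splitr e) EFinD; apply: le_trans (leeD hd hd').
rewrite -wdistD//; apply: le_wdist.
- apply: measurable_funB; first by apply: mind; exact: measurableU.
  apply: measurable_funB; last by apply: measurable_funM; exact: cmeas.
  by apply: measurable_funD; exact: cmeas.
- by apply: measurable_funD; exact: measurableT_comp.
move=> x _; rewrite [leRHS]ger0_norm ?addr_ge0//.
have /andP[a0 a1] := h01 x; have /andP[b0 b1] := h01' x.
rewrite !indicE in_setU; case: (x \in A); case: (x \in A') => /=.
- have -> : 1 - (h x + h' x - h x * h' x) = (1 - h x) * (1 - h' x) by ring.
  rewrite normrM (le_trans (ler_piMr _ _)) ?lerDl// ger0_norm; lra.
- have -> : 1 - (h x + h' x - h x * h' x) = (1 - h x) * (1 - h' x) by ring.
  rewrite normrM (le_trans (ler_piMr _ _)) ?lerDl// ger0_norm; lra.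
- have -> : 1 - (h x + h' x - h x * h' x) = (1 - h x) * (1 - h' x) by ring.
  rewrite normrM (le_trans (ler_piMl _ _)) ?lerDr// ger0_norm; lra.
- rewrite !sub0r !normrN !ger0_norm//; nra.
Qed.

(** Dominated convergence replaces the countable union by a finite one within e/2; the finite one is
    approximated within e/2. *)
Lemma approximable_bigcup (F : nat -> set 'rV[R]_n) : (forall i, measurable (F i)) ->
  (forall i, approximable (F i)) -> approximable (\bigcup_i F i).
Proof.
move=> mF aF e e0; have e20 : 0 < e / 2 by rewrite divr_gt0.
pose FN N := \big[setU/set0]_(i < N) F i.
have mFN N : measurable (FN N) by apply: bigsetU_measurable => i _.
have aFN N : approximable (FN N).
  elim: N => [|N IH]; first by rewrite /FN big_ord0; exact: approximable0.
  have -> : FN N.+1 = FN N `|` F N by rewrite /FN big_ord_recr.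
  exact: approximableU.
have mU : measurable (\bigcup_i F i) by exact: bigcupT_measurable.
have md N : measurable_fun setT (fun x => \1_(\bigcup_i F i) x - \1_(FN N) x : R).
  by apply: measurable_funB; exact: mind.
have [||N hN] := @wdist_small (fun N x => \1_(\bigcup_i F i) x - \1_(FN N) x) _ e20 md.
- move=> k x; rewrite !indicE; case: (_ \in _); case: (_ \in _) => /=;
    by rewrite ?subrr ?subr0 ?sub0r ?normrN ?normr0 ?normr1.
- move=> x Bx; apply: cvg_near_cst.
  have [[i _ Fi]|nF] := pselect ((\bigcup_i F i) x).
    exists i.+1 => // N /= iN; rewrite !indicE !mem_set ?subrr//.
      by rewrite /FN -bigcup_mkord; exists i.
    by exists i.
  exists 0%N => // N _; rewrite !indicE !memNset ?subrr//.
  by rewrite /FN -bigcup_mkord => -[i _ Fi]; apply: nF; exists i.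
have [h [ch h01 hd]] := aFN N _ e20; exists h; split=> //.
have mh : measurable_fun setT (fun x => \1_(FN N) x - h x).
  by apply: measurable_funB; [exact: mind|exact: cmeas].
rewrite (splitr e) EFinD; apply: le_trans (leeD hN hd).
rewrite -wdistD//; apply: le_wdist.
- by apply: measurable_funB; [exact: mind|exact: cmeas].
- by apply: measurable_funD; exact: measurableT_comp.
move=> x _; rewrite [leRHS]ger0_norm ?addr_ge0//.
by apply: le_trans (ler_normD _ _); rewrite addrA subrK.
Qed.

Lemma approximable_halfspace i (t : R) : approximable [set x : 'rV[R]_n | t < x ord0 i].
Proof.
move=> e e0; set A : set 'rV[R]_n := [set x | _].
pose h k x : R := Num.min 1 (Num.max 0 (k%:R * (x ord0 i - t))).
have ch k : continuous (h k).
  move=> x; apply: (@continuous_comp _ _ _ (fun x : 'rV[R]_n => x ord0 i)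
    (fun s => Num.min 1 (Num.max 0 (k%:R * (s - t))))); first exact: coord_continuous.
  apply: (@continuous_min _ R (cst 1)); first exact: cvg_cst.
  apply: (@continuous_max _ R (cst 0)); first exact: cvg_cst.
  by refine (cvgM (cvg_cst _) (cvgB cvg_id (cvg_cst _))).
have h01 k x : 0 <= h k x <= 1.
  by rewrite /h le_min ler01 le_max lexx/= ge_min lexx.
have mA : measurable A.
  have -> : A = (fun x : 'rV[R]_n => x ord0 i : measurableTypeR R) @^-1` `]t, +oo[%classic.
    by apply/seteqP; split => x /=; rewrite in_itv/= andbT.
  by rewrite -[X in measurable X]setTI; apply: measurable_rV_coord.
have [|||k hk] := @wdist_small (fun k x => \1_A x - h k x) e e0.
- by move=> k; apply: measurable_funB; [exact: mind|exact: cmeas].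
- move=> k x; have /andP[a0 a1] := h01 k x; rewrite indicE; case: (_ \in _) => /=.
    by rewrite ger0_norm; lra.
  by rewrite sub0r normrN ger0_norm.
- move=> x Bx; apply: cvg_near_cst.
  have [tx|xt] := ltP t (x ord0 i).
    exists (Num.truncn (x ord0 i - t)^-1).+1 => // k /= hk.
    rewrite indicE mem_set//= /h.
    have k1 : 1 <= k%:R * (x ord0 i - t).
      rewrite -ler_pdivrMr ?subr_gt0// div1r.
      by rewrite (le_trans (ltW (truncnS_gt _)))// ler_nat.
    by rewrite (max_idPr _) ?(le_trans ler01)// (min_idPl _)// subrr.
  exists 0%N => // k _; rewrite indicE memNset/=; last by rewrite /A/= ltNge xt.
  rewrite /h (max_idPl _) ?(min_idPr _) ?subrr//.
  by rewrite mulr_ge0_le0// subr_le0.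
by exists (h k).
Qed.

(** The good-sets principle, applied twice: to the sigma-algebra generated by the coordinates, then
    to the Borel sets of the line generated by open rays, whose preimages are half-spaces. *)
Lemma measurable_approximable A : measurable A -> approximable A.
Proof.
move=> mA; suff : [set A | measurable A /\ approximable A] A by case.
move: A mA; apply: smallest_sub => /=.
  split => [|A [mA aA]|F mF].
  - by split; [exact: measurable0|exact: approximable0].
  - by rewrite setTD; split; [exact: measurableC|exact: approximableC].
  - split; first by apply: bigcupT_measurable => i; have [] := mF i.
    by apply: approximable_bigcup => i; have [] := mF i.
move=> A; rewrite -bigcup_seq => -[i _ [Y mY <-]]; rewrite setTI.
pose co (x : 'rV[R]_n) : measurableTypeR R := x ord0 i.
have mco Z : measurable Z -> measurable (co @^-1` Z).
  by move=> mZ; rewrite -[X in measurable X]setTI; exact: measurable_rV_coord.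
split; first exact: mco.
suff : [set Z : set (measurableTypeR R) | measurable Z /\ approximable (co @^-1` Z)] Y by case.
have : (@RGenOInfty.G R).-sigma.-measurable Y by rewrite -RGenOInfty.measurableE.
move: Y mY => Y _; move: Y; apply: smallest_sub => /=.
  split => [|Z [mZ aZ]|F mF].
  - by split; [exact: measurable0|rewrite preimage_set0; exact: approximable0].
  - rewrite setTD; split; first exact: measurableC.
    by rewrite preimage_setC; exact: approximableC.
  - split; first by apply: bigcupT_measurable => k; have [] := mF k.
    rewrite preimage_bigcup; apply: approximable_bigcup => k; have [mFk aFk] := mF k => //.
    exact: mco.
move=> _ [t ->]; split; first exact: measurable_itv.
have -> : co @^-1` `]t, +oo[%classic = [set x : 'rV[R]_n | t < x ord0 i].
  by apply/seteqP; split => x /=; rewrite in_itv/= andbT.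
exact: approximable_halfspace.
Qed.

End continuous_approximation.

(** * Testing the oscillation with a continuous mean-zero function *)

Section test_function.
Context {R : realType} {n : nat}.
Variables (n0 : (0 < n)%N) (c : 'rV[R]_n) (r : R) (r0 : 0 < r).
Variable f : 'rV[R]_n -> R.
Local Notation B := (eball c r).
Local Notation mu := (leb n).
Hypotheses (mf : measurable_fun setT f) (fi : mu.-integrable B (EFin \o f)).
Hypothesis f_mean0 : \int[mu]_(x in B) f x = 0.
Implicit Types (u v : 'rV[R]_n -> R).

Let O := \int[mu]_(x in B) `|f x|.
Hypothesis O0 : 0 < O.

Let mB : measurable B := @measurable_eball R n c r.
Let V := vol B.
Let V0 : 0 < V. Proof. exact: vol_eball_gt0. Qed.
(** The summand |f| controls the integral of u f. The constant O/V is scaled to control that of u: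
    an error O/8 in [wdist] moves the integral of u over B by at most V/8. *)
Let G x := `|f x| + O / V.
Let OV0 : 0 < O / V. Proof. exact: divr_gt0. Qed.
Let G0 x : 0 <= G x. Proof. by rewrite addr_ge0// ltW. Qed.

Let Gi : mu.-integrable B (EFin \o G).
Proof.
have := integrableD mB (integrable_norm fi) (integrable_cst_eball c r (O / V)).
exact: eq_integrable.
Qed.

Let Ji u M : measurable_fun setT u -> (forall x, `|u x| <= M) ->
  mu.-integrable B (EFin \o (fun x => u x * f x)).
Proof. by move=> m_u uM; apply: (@integrable_mul_bounded _ _ _ _ _ _ M). Qed.

Let ui u M : measurable_fun setT u -> (forall x, `|u x| <= M) ->
  mu.-integrable B (EFin \o u).
Proof.
move=> m_u uM.
have := @integrable_mul_bounded _ _ _ (cst 1) c r M m_u (fun x _ => uM x) (integrable_cst_eball c r 1).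
by apply: eq_integrable => // x _; rewrite /= mulr1.
Qed.

Let mGu u : measurable_fun setT u -> measurable_fun B (fun x => (`|u x| * G x)%:E).
Proof.
move=> m_u; apply/measurable_EFinP; apply: measurable_funTS.
apply: measurable_funM; first exact: measurableT_comp.
by apply: measurable_funD; [exact: measurableT_comp|exact: measurable_cst].
Qed.

Let J u := \int[mu]_(x in B) (u x * f x).
Let I u := \int[mu]_(x in B) u x.

Let J_le u (e M : R) : measurable_fun setT u -> (forall x, `|u x| <= M) ->
  (wdist B G u <= e%:E)%E -> `|J u| <= e.
Proof.
move=> m_u uM ue; apply: (le_trans (le_normr_Rintegral mB (Ji m_u uM))).
rewrite -lee_fin Rintegral_EFin//; last exact: (integrable_norm (Ji m_u uM)).
apply: le_trans ue; apply: ge0_le_integral => //.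
- exact: (measurable_int _ (integrable_norm (Ji m_u uM))).
- exact: mGu.
- by move=> x _; rewrite lee_fin normrM ler_wpM2l// lerDl ltW.
Qed.

Let I_le u (e M : R) : measurable_fun setT u -> (forall x, `|u x| <= M) ->
  (wdist B G u <= e%:E)%E -> `|I u| * (O / V) <= e.
Proof.
move=> m_u uM ue; have uiB := ui m_u uM.
apply: (le_trans (ler_wpM2r (ltW OV0) (le_normr_Rintegral mB uiB))).
rewrite mulrC -RintegralZl//; last exact: (integrable_norm uiB).
rewrite -lee_fin Rintegral_EFin//; last first.
  by have := integrableZl mB (O / V) (integrable_norm uiB); exact: eq_integrable.
apply: le_trans ue; apply: ge0_le_integral => //.
- by move=> x _; rewrite lee_fin mulr_ge0// ltW.
- apply/measurable_EFinP; apply: measurable_funM => //; apply: measurable_funTS.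
  exact: measurableT_comp.
- exact: mGu.
- by move=> x _; rewrite lee_fin mulrC ler_wpM2l// lerDr.
Qed.

Let JD u v (M N : R) : measurable_fun setT u -> measurable_fun setT v ->
  (forall x, `|u x| <= M) -> (forall x, `|v x| <= N) ->
  J (fun x => u x + v x) = J u + J v.
Proof.
move=> m_u m_v uM vN; rewrite /J -RintegralD//; [|exact: Ji uM|exact: Ji vN].
by apply: eq_Rintegral => x _; rewrite mulrDl.
Qed.

Let JZ u (k M : R) : measurable_fun setT u -> (forall x, `|u x| <= M) ->
  J (fun x => k * u x) = k * J u.
Proof.
move=> m_u uM; rewrite /J -RintegralZl//; last exact: Ji uM.
by apply: eq_Rintegral => x _; rewrite mulrA.
Qed.

Definition cutoff k x : R := Num.min 1 (k%:R * Num.max 0 (r - enorm (x - c))).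

Lemma cutoff_continuous k : continuous (cutoff k).
Proof.
move=> x; apply: (@continuous_comp _ _ _ (fun x : 'rV[R]_n => enorm (x - c))
  (fun s : R => Num.min 1 (k%:R * Num.max 0 (r - s)))); first exact: enormB_continuous.
apply: (@continuous_min _ R (cst 1)); first exact: cvg_cst.
apply: continuousM; first exact: cvg_cst.
apply: (@continuous_max _ R (cst 0)); first exact: cvg_cst.
by refine (cvgB (cvg_cst _) cvg_id).
Qed.

Lemma cutoff_range k x : 0 <= cutoff k x <= 1.
Proof.
rewrite /cutoff ge_min lexx/= andbT le_min ler01/=.
by rewrite mulr_ge0// le_max lexx.
Qed.

Lemma cutoff_supp k x : ~ eball c r x -> cutoff k x = 0.
Proof.
move=> /negP; rewrite -leNgt => rx.
by rewrite /cutoff (max_idPl _) ?subr_le0// mulr0 (min_idPr _).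
Qed.

(* With h a continuous approximation of the sign of f and psi a cutoff close to
   the indicator of B, take psi h - tau psi, tau making the mean vanish: the
   correction costs little because f has mean zero on B. *)
Lemma test_function : exists a : 'rV[R]_n -> R, [/\ continuous a,
  forall x, `|a x| <= 2, forall x, ~ B x -> a x = 0, \int[mu]_x a x = 0 &
  O / 2 <= \int[mu]_(x in B) (a x * f x)].
Proof.
(* Four losses of O/8 are incurred: two from approximating the sign, as s - h is twice the error on
   the indicator, one from the cutoff and one from the mean correction. They leave O/2. *)
have O80 : 0 < O / 8 by rewrite divr_gt0.
have cm (u : 'rV[R]_n -> R) : continuous u -> measurable_fun setT u.
  exact: rV_continuous_measurable.
have m1c k : measurable_fun setT (fun x => 1 - cutoff k x).
  by apply: measurable_funB => //; apply: cm; exact: cutoff_continuous.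
have c1 k x : `|1 - cutoff k x| <= 1.
  by have /andP[h1 h2] := cutoff_range k x; rewrite ger0_norm; lra.
have [|k hk] := @wdist_small _ _ B G mB G0 Gi (fun k x => 1 - cutoff k x) _ O80 m1c c1.
  move=> x Bx; apply: cvg_near_cst.
  have rx : 0 < r - enorm (x - c) by rewrite subr_gt0.
  exists (Num.truncn (r - enorm (x - c))^-1).+1 => // k /= hk.
  rewrite /cutoff (max_idPr _) ?(ltW rx)// (min_idPl _) ?subrr//.
  rewrite -ler_pdivrMr// div1r.
  by rewrite (le_trans (ltW (truncnS_gt _)))// ler_nat.
set psi := cutoff k in hk.
have mpsi : measurable_fun setT psi by apply: cm; exact: cutoff_continuous.
have psi01 x : 0 <= psi x <= 1 := cutoff_range k x.
have psi1 x : `|psi x| <= 1.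
  by have /andP[h1 h2] := psi01 x; rewrite ger0_norm.
pose P := [set x : 'rV[R]_n | 0 < f x].
have mP : measurable P.
  have -> : P = f @^-1` `]0, +oo[%classic by apply/seteqP; split => x /=; rewrite in_itv/= andbT.
  by rewrite -[X in measurable X]setTI; apply: mf.
have [h0 [ch0 h01 hd]] := measurable_approximable mB G0 Gi mP O80.
have m_d : measurable_fun setT (fun x => \1_P x - h0 x).
  by apply: measurable_funB; [exact: measurable_indic|exact: cm].
have d1 x : `|\1_P x - h0 x| <= 1.
  have /andP[a0 a1] := h01 x; rewrite indicE; case: (_ \in _) => /=.
    by rewrite ger0_norm; lra.
  by rewrite sub0r normrN ger0_norm.
pose h x := 2 * h0 x - 1.
have ch : continuous h.
  by move=> x; refine (cvgB (cvgM (cvg_cst _) (ch0 x)) (cvg_cst _)).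
have h1 x : `|h x| <= 1.
  by have /andP[a0 a1] := h01 x; rewrite ler_norml /h; apply/andP; split; lra.
have mh := cm _ ch.
pose s x : R := 2 * \1_P x - 1.
have ms : measurable_fun setT s.
  apply: measurable_funB => //; apply: measurable_funM => //; exact: measurable_indic.
have s1 x : `|s x| <= 1.
  rewrite /s indicE; case: (_ \in _) => /=; rewrite ?mulr0 ?mulr1 ?sub0r ?normrN ?normr1//.
  by rewrite (_ : 2 - 1 = 1 :> R) ?normr1//; ring.
have Js : J s = O.
  apply: eq_Rintegral => x _; rewrite /s indicE; have [xP|xP] := boolP (x \in P).
    rewrite gtr0_norm; first by rewrite /=; ring.
    by rewrite inE in xP.
  rewrite ler0_norm; first by rewrite /=; ring.
  by move: xP; rewrite notin_setE /P/= => /negP; rewrite -leNgt.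
have Jd := J_le m_d d1 hd.
have mrest : measurable_fun setT (fun x => (1 - psi x) * h x) by apply: measurable_funM => //; exact: m1c.
have rest1 x : `|(1 - psi x) * h x| <= 1.
  by rewrite normrM mulr_ile1// c1.
have Jrest : `|J (fun x => (1 - psi x) * h x)| <= O / 8.
  apply: (J_le mrest rest1); apply: le_trans hk; apply: le_wdist => //.
  - exact: m1c.
  - by move=> x _; rewrite normrM ler_piMr.
have J1psi := J_le (m1c k) (c1 k) hk; rewrite -/psi in J1psi.
have I1psi := I_le (m1c k) (c1 k) hk; rewrite -/psi in I1psi.
(* As f has mean zero on B, [J psi] sees only the small function 1 - psi; this makes the mean
   correction cheap. *)
have Jpsi : J psi = - J (fun x => 1 - psi x).
  have -> : J psi = J (fun x => 1 + (-1) * (1 - psi x)).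
    by apply: eq_Rintegral => x _; congr (_ * _); ring.
  rewrite (@JD (cst 1) (fun x => -1 * (1 - psi x)) 1 1)//.
  - rewrite (JZ _ (m1c k) (c1 k)) mulN1r {1}/J.
    by under eq_Rintegral do rewrite mul1r; rewrite f_mean0 sub0r.
  - by apply: measurable_funM => //; exact: m1c.
  - by move=> x; rewrite normr1.
  - by move=> x; rewrite mulN1r normrN c1.
have mph : measurable_fun setT (fun x => psi x * h x) by apply: measurable_funM.
have ph1 x : `|psi x * h x| <= 1 by rewrite normrM mulr_ile1.
have Jph : J (fun x => psi x * h x) =
    O - 2 * J (fun x => \1_P x - h0 x) - J (fun x => (1 - psi x) * h x).
  have -> : J (fun x => psi x * h x) =
      J (fun x => (s x + (-2) * (\1_P x - h0 x)) + (-1) * ((1 - psi x) * h x)).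
    by apply: eq_Rintegral => x _; congr (_ * _); rewrite /s /h; ring.
  have b1 x : `|-2 * (\1_P x - h0 x)| <= 2.
    by have := d1 x; rewrite normrM normrN (@ger0_norm _ 2)//; lra.
  have mb1 : measurable_fun setT (fun x => -2 * (\1_P x - h0 x)) by apply: measurable_funM.
  rewrite (@JD (fun x => s x + -2 * (\1_P x - h0 x)) _ 3 1)//.
  - by rewrite (JD ms mb1 s1 b1) Js (JZ _ m_d d1) (JZ _ mrest rest1); ring.
  - exact: measurable_funD.
  - exact: measurable_funM.
  - by move=> x; apply: (le_trans (ler_normD _ _)); have := s1 x; have := b1 x; lra.
  - by move=> x; rewrite mulN1r normrN.
have psii := ui mpsi psi1.
have Ipsi : I psi = V - I (fun x => 1 - psi x).
  have i1 := ui (m1c k) (c1 k).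
  rewrite /I -/psi in i1 *.
  have -> : V = \int[mu]_(x in B) cst 1 x by rewrite Rintegral_cst// mul1r.
  rewrite -RintegralB//; last exact: integrable_cst_eball.
  by apply: eq_Rintegral => x _; rewrite /= subKr.
have Ipos : 0 < I psi.
  have h2 : `|I (fun x => 1 - psi x)| <= V / 8.
    move: I1psi; rewrite mulrA ler_pdivrMr// mulrC -mulrA ler_pM2l// mulrC.
    by rewrite mulrC.
  rewrite Ipsi subr_gt0 (le_lt_trans (ler_norm _))// (le_lt_trans h2)//.
  by rewrite ltr_pdivrMr// ltr_pMr// ltr1n.
have Iph : `|I (fun x => psi x * h x)| <= I psi.
  apply: (le_trans (le_normr_Rintegral mB (ui mph ph1))).
  apply: le_Rintegral => //; first exact: (integrable_norm (ui mph ph1)).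
  move=> x _; have /andP[p0 _] := psi01 x.
  by rewrite normrM (ger0_norm p0) ler_piMr.
(* Well defined since the integral of psi is at least V - V/8, and at most 1 in absolute value since
   |h| <= 1. *)
pose tau := I (fun x => psi x * h x) / I psi.
have tau1 : `|tau| <= 1.
  by rewrite /tau normrM normfV (gtr0_norm Ipos) ler_pdivrMr// mul1r.
have mtp : measurable_fun setT (fun x => - tau * psi x) by apply: measurable_funM.
have tp1 x : `|- tau * psi x| <= 1 by rewrite normrM normrN mulr_ile1.
exists (fun x => psi x * h x + - tau * psi x); split.
- move=> x; have cpsi := @cutoff_continuous k x.
  by refine (cvgD (cvgM cpsi (ch x)) (cvgM (cvg_cst _) cpsi)).
- by move=> x; apply: (le_trans (ler_normD _ _)); have := ph1 x; have := tp1 x; lra.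
- by move=> x /(cutoff_supp k) h'; rewrite /psi h' mul0r mulr0 addr0.
- rewrite (@Rintegral_supp _ _ _ B); last first.
    by move=> x /(cutoff_supp k) h'; rewrite /psi h' mul0r mulr0 addr0.
  rewrite RintegralD//; [|exact: ui ph1|exact: ui tp1].
  by rewrite RintegralZl// -/(I psi) -/(I (fun x => psi x * h x)) /tau mulNr divfK ?subrr// gt_eqF.
- rewrite -/(J (fun x => psi x * h x + - tau * psi x)) (JD mph mtp ph1 tp1).
  rewrite (JZ _ mpsi psi1) Jph Jpsi.
  have h2 : `|tau * J (fun x => 1 - psi x)| <= O / 8.
    by rewrite normrM (le_trans _ J1psi)// ler_piMl.
  move: Jd Jrest h2; rewrite !ler_norml => /andP[_ q1] /andP[_ q2] /andP[q3 _].
  rewrite mulNr mulrN opprK; lra.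
Qed.

End test_function.

(** * Summation over annuli *)

Section atoms.
Context {R : realType} {n : nat}.
Variables (n0 : (0 < n)%N) (phi w : 'rV[R]_n -> R) (C t : R).
Hypotheses (sphi : schwartz phi) (dw : density w).
Hypotheses (wpos : forall c r, 0 < r -> 0 < wm w (eball c r)).
Hypotheses (C0 : 0 < C) (t01 : 0 < t < 1) (Hg : growth C t w).
Local Notation mu := (leb n).

Lemma cancelling_atom a c r : 0 < r -> continuous a ->
  cancelling a c r (wm w (eball c r))^-1 -> atom w a.
Proof.
move=> r0 ca [ma aA a0 ai]; split=> //; exists c, r; split => //.
rewrite unlock -/(wm w _); case: ifPn => _; last by rewrite lee_fin invr_ge0 ltW ?wpos.
by apply/ess_supP; apply: aeW => x; rewrite /= lee_fin.
Qed.

Lemma atom_fin_atomic a : atom w a -> fin_atomic w a.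
Proof.
move=> aa; exists 1%N, (fun=> 1), (fun=> a); split => //.
by apply/funext => x; rewrite big_ord1 mul1r.
Qed.

(** The value of the extension at the atom serves as [g]: it is measurable by membership in L^1_w,
    and agrees with [T a] only almost everywhere. The constant depends on neither the atom nor the
    ball. *)
Lemma bounded_on_atoms T : bounded_H1w_L1w phi w T -> exists2 M : R, 0 <= M &
  forall a c r, 0 < r -> continuous a -> cancelling a c r (wm w (eball c r))^-1 ->
  exists g : 'rV[R]_n -> R, [/\ measurable_fun setT g,
    (\int[mu]_x (`|g x| * w x)%:E <= M%:E)%E & {ae mu, forall x, g x = T a x}].
Proof.
move=> [L [L1 _ [K HK] Lae]].
have [KH KH0 HKH] := H1w_cancelling n0 sphi dw C0 t01 Hg.
exists (`|K| * KH); first by rewrite mulr_ge0// ltW.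
move=> a c r r0 ca ha; have W0 := wpos c r0.
have A0 : 0 <= (wm w (eball c r))^-1 by rewrite invr_ge0 ltW.
have [H1 Hn] := HKH a c r _ r0 A0 ha.
rewrite -mulrA mulVf ?gt_eqF// mulr1 in Hn.
have [mL _] := L1 _ H1.
exists (L (distr_of a)); split => //.
  apply: (le_trans (HK _ H1)).
  have Hge0 : (0 <= H1w_norm phi w (distr_of a))%E.
    apply: integral_ge0 => x _; apply: mule_ge0; first exact: max_fun_ge0.
    by case: dw => _ w0 _; rewrite lee_fin.
  apply: (@le_trans _ _ (`|K|%:E * H1w_norm phi w (distr_of a))%E).
    by apply: lee_wpmul2r => //; rewrite lee_fin ler_norm.
  by rewrite EFinM; apply: lee_wpmul2l.
have := Lae _ (atom_fin_atomic (cancelling_atom r0 ca ha)); by apply: filterS => x; apply.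
Qed.

End atoms.

Section annuli.
Context {R : realType} {n : nat}.
Implicit Types (c x : 'rV[R]_n) (r : R).
Local Notation mu := (leb n).

Definition annulus c r k : set 'rV[R]_n := eball c (4 ^+ k.+1 * r) `\` eball c (4 ^+ k * r).

Lemma measurable_annulus c r k : measurable (annulus c r k).
Proof. by apply: measurableD; exact: measurable_eball. Qed.

Lemma trivIset_annulus c r : 0 < r -> trivIset setT (annulus c r).
Proof.
move=> r0; apply/trivIsetP => i j _ _.
wlog ij : i j / (i < j)%N.
  move=> H; rewrite neq_ltn => /orP[ij|ji]; first by apply: H; rewrite ?lt_eqF.
  by rewrite setIC; apply: H; rewrite ?lt_eqF.
move=> _; rewrite -subset0 => x [[xi _] [_ xj]]; apply: xj; move: x xi.
by apply: eball_le; rewrite ler_pM2r// ler_weXn2l// ler1n.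
Qed.

Lemma bigcup_annulus c r : 0 < r -> ~` eball c r = \bigcup_k annulus c r k.
Proof.
move=> r0; apply/seteqP; split => x.
  move=> /= xc; have [k [xk _]] := dyadic_cover c x r0.
  have ex : exists k, enorm (x - c) < 4 ^+ k * r by exists k.
  case: (ex_minnP ex) => -[|m] xm mmin.
    by exfalso; apply: xc; move: xm; rewrite expr0 mul1r.
  by exists m => //; split => //= /mmin; rewrite ltnn.
move=> [k _ [_ xk]] xc; apply: xk; move: x xc; apply: eball_le.
by rewrite ler_peMl ?(ltW r0)// exprn_ege1// ler1n.
Qed.

Lemma integral_compl_ball (f : 'rV[R]_n -> \bar R) c r : 0 < r ->
  measurable_fun setT f -> (forall x, 0 <= f x)%E ->
  (\int[mu]_(x in ~` eball c r) f x = \sum_(0 <= k <oo) \int[mu]_(x in annulus c r k) f x)%E.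
Proof.
move=> r0 mf f0; rewrite bigcup_annulus// ge0_integral_bigcup//.
- exact: measurable_annulus.
- exact: measurable_funTS.
- exact: trivIset_annulus.
Qed.

Lemma sum_integral_le (f : 'rV[R]_n -> \bar R) (E : nat -> set 'rV[R]_n) N :
  measurable_fun setT f -> (forall x, 0 <= f x)%E ->
  (forall k, measurable (E k)) -> trivIset setT E ->
  (\sum_(0 <= k < N) \int[mu]_(x in E k) f x <= \int[mu]_x f x)%E.
Proof.
move=> mf f0 mE tE.
rewrite -ge0_integral_bigsetU//.
- apply: ge0_subset_integral => //; first by apply: bigsetU_measurable.
- exact: iota_uniq.
- exact: sub_trivIset tE.
- by apply: measurable_funTS.
Qed.

End annuli.

Section lower_bound.
Context {R : realType}.
Implicit Types (k q A O r d m X S : R).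

(** Once 8 q r <= d, the error carrying O is at most half of the main term, so the constant 1/4
    drops to 1/8. *)
Lemma absorb_first_error n k q A O r d m X S : 0 < k -> 0 <= A -> 0 <= O ->
  0 < d -> 8 * q * r <= d -> A * O / 4 <= m ->
  k * (m / d ^+ n) <= S + k * q * A * (O * r / d ^+ n.+1 + X * 2 ^+ n * r ^+ n.+1 / d ^+ n.+1) ->
  k * A * O / 8 / d ^+ n <= S + k * q * A * X * 2 ^+ n * (r / d) ^+ n.+1.
Proof.
move=> k0 A0 O0 d0 qrd mAO.
have dn := exprn_gt0 n d0; rewrite expr_div_n.
have -> : O * r / d ^+ n.+1 = O * (r / d) / d ^+ n.
  by rewrite exprS; field; rewrite !gt_eqF.
have qe : q * (r / d) <= 8^-1.
  by rewrite mulrA ler_pdivrMr//; lra.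
have h1 : k * (A * O / 4 / d ^+ n) <= k * (m / d ^+ n).
  by rewrite ler_pM2l// ler_pM2r// invr_gt0.
have h2 : k * A * O / d ^+ n * (q * (r / d)) <= k * A * O / d ^+ n * 8^-1.
  by rewrite ler_wpM2l// divr_ge0 ?(ltW dn)// !mulr_ge0// ltW.
move: h1 h2; move: (r / d) ((d ^+ n)^-1) (r ^+ n.+1) ((d ^+ n.+1)^-1) (2 ^+ n).
move=> {qe qrd mAO dn d0} y e u v s h1 h2 H; lra.
Qed.

Lemma error_identity (k q A T K z u v C s : R) : A != 0 -> u != 0 ->
  k * q * A * (T * K) * z * u^-1 * (C * (v * u * s) * A^-1) = k * q * T * z * C * v * (K * s).
Proof. by move=> A0 u0; field; rewrite A0 u0. Qed.

Lemma main_identity (k l A O W u v : R) : k != 0 -> l != 0 -> u != 0 -> v != 0 ->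
  W / u * (A * O) / (8 * v / (k * l)) = k * A * O / 8 / (v * u) * (l * W).
Proof. by move=> k0 l0 u0 v0; field; rewrite k0 l0 u0 v0. Qed.

End lower_bound.

(** * The estimate on a single ball *)

Section chunks.
Context {R : realType} {n : nat}.
Variables (n0 : (0 < n)%N) (w b : 'rV[R]_n -> R) (C t T kap beta : R).
Hypotheses (dw : density w) (C0 : 0 < C) (t01 : 0 < t < 1) (Hg : growth C t w).
Hypotheses (wpos : forall c r, 0 < r -> 0 < wm w (eball c r)).
Hypotheses (bmob : bmo b) (T0 : 0 < T) (kap0 : 0 < kap) (beta0 : 0 < beta).
Hypothesis good_large : forall c r k, 0 < r ->
  kap * wm w (eball c (4 ^+ k.+1 * r)) <= wm w (good_annulus b T c r k).
Hypothesis osc_le : forall c r, 0 < r ->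
  \int[leb n]_(x in eball c r) `|b x - avg (eball c r) b| <= beta * vol (eball c r).
Local Notation mu := (leb n).
Variables (kappa : R) (kp : 0 < kappa).
Hypothesis kappaE : kappa = @riesz_const R n.
Variables (q : R) (q0 : 0 <= q).
Hypothesis qE : q = n%:R * (2 ^+ n.+1 + n.+1%:R * 4 ^+ n.+1).
Let t0 : 0 < t. Proof. by case/andP: t01. Qed.
Let t1 : t < 1. Proof. by case/andP: t01. Qed.

Section one_ball.
Variables (c : 'rV[R]_n) (r : R) (a : 'rV[R]_n -> R) (g : 'I_n -> 'rV[R]_n -> R) (M : R).
Hypotheses (r0 : 0 < r).
Local Notation B := (eball c r).
Local Notation bB := (avg B b).
Let A : R := (wm w B)^-1.
Let O : R := \int[mu]_(x in B) `|b x - bB|.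
Hypotheses (ha : cancelling a c r A) (O0 : 0 < O).
Hypothesis a_large : A * O / 4 <= \int[mu]_(x in B) (a x * (b x - bB)).
Hypotheses (mg : forall j, measurable_fun setT (g j)).
Hypothesis gM : (\int[mu]_x (\sum_j `|g j x| * w x)%:E <= M%:E)%E.
Hypothesis gae : forall j, {ae mu, forall x, g j x = commutator b j a x}.

Let h x := \sum_j `|g j x| * w x.
Let H k := fine (\int[mu]_(x in good_annulus b T c r k) (h x)%:E)%E.
Let wk k := wm w (eball c (4 ^+ k * r)).
Let A0 : 0 < A. Proof. by rewrite invr_gt0 wpos. Qed.
Let w0 x : 0 <= w x. Proof. by case: dw. Qed.
Let mw : measurable_fun setT w. Proof. by case: dw. Qed.

Let h0 x : 0 <= h x. Proof. by apply: sumr_ge0 => j _; rewrite mulr_ge0. Qed.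

Let mh : measurable_fun setT h.
Proof.
apply: measurable_sum => j; apply: measurable_funM => //.
exact: measurableT_comp.
Qed.

Let mE k : measurable (good_annulus b T c r k) := measurable_good_annulus bmob T c r k.

Let tE : trivIset setT (good_annulus b T c r).
Proof.
apply/trivIsetP => i j _ _ ij; have tA := @trivIset_annulus _ _ c r r0.
move/trivIsetP : tA => /(_ i j Logic.I Logic.I ij).
rewrite -!subset0 => S x [[xi _] [xj _]]; exact: (S x).
Qed.

Let finH k : (\int[mu]_(x in good_annulus b T c r k) (h x)%:E)%E \is a fin_num.
Proof.
rewrite ge0_fin_numE; last by apply: integral_ge0 => x _; rewrite lee_fin.
apply: (@le_lt_trans _ _ M%:E); last by rewrite ltry.
apply: le_trans gM; apply: ge0_subset_integral => //.
- exact/measurable_EFinP.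
- by move=> x _; rewrite lee_fin.
Qed.

Let sumH N : \sum_(0 <= k < N) H k <= M.
Proof.
rewrite -lee_fin -sumEFin; apply: le_trans gM.
rewrite (eq_bigr (fun k => \int[mu]_(x in good_annulus b T c r k) (h x)%:E)%E); last first.
  by move=> k _; rewrite fineK// finH.
by apply: sum_integral_le => //; exact/measurable_EFinP.
Qed.

Let H_ge0 k : 0 <= H k.
Proof. by apply: fine_ge0; apply: integral_ge0 => x _; rewrite lee_fin. Qed.

(** The remaining error of the pointwise bound on the k-th good annulus, where |b - b_B| <= T (k +
    2) and r / |x - c| <= 4^-k. *)
Let err k : R := kappa * q * A * (T * k.+2%:R) * 2 ^+ n * (4 ^- k) ^+ n.+1.

Let err_ge0 k : 0 <= err k.
Proof. by rewrite !mulr_ge0 ?(ltW A0) ?exprn_ge0 ?invr_ge0 ?exprn_ge0 ?(ltW kp) ?(ltW T0). Qed.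

(** The condition 2 <= 4^k puts x outside the double ball, where the kernel is smooth enough; 8 q <=
    4^k is what the absorption of the first error requires. *)
Lemma pointwise_lower k x : 2 <= 4 ^+ k :> R -> 8 * q <= 4 ^+ k ->
  good_annulus b T c r k x -> (forall j, g j x = commutator b j a x) ->
  kappa * A * O / 8 / (4 ^+ k.+1 * r) ^+ n * w x <= h x + err k * w x.
Proof.
move=> k2 kq [[xk1 xk] xT] gx.
rewrite /h -mulr_suml -mulrDl ler_wpM2r//.
set d := enorm (x - c).
have rk0 : 0 < 4 ^+ k * r by rewrite mulr_gt0// exprn_gt0.
have dk : 4 ^+ k * r <= d by rewrite leNgt; apply/negP.
have dk1 : d < 4 ^+ k.+1 * r by exact: xk1.
have d0 : 0 < d := lt_le_trans rk0 dk.
have xc : 2 * r <= d by rewrite (le_trans _ dk)// ler_pM2r.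
have qd : 8 * q * r <= d by rewrite (le_trans _ dk)// ler_pM2r.
have := commutator_far_ge bmob r0 (ltW A0) ha xc; rewrite -kappaE => /(_ kp).
rewrite -(mulrA kappa) -qE -/O -/d => Hc.
have {Hc} := absorb_first_error kp (ltW A0) (ltW O0) d0 qd a_large Hc.
under eq_bigr do rewrite -gx.
move=> Hc; apply: (le_trans (le_trans _ Hc)).
  rewrite ler_wpM2l ?divr_ge0 ?mulr_ge0 ?(ltW kp) ?(ltW A0) ?(ltW O0)//.
  rewrite lef_pV2 ?posrE ?exprn_gt0//; last by rewrite mulr_gt0// exprn_gt0.
  by rewrite lerXn2r ?nnegrE ?(ltW d0) ?(ltW dk1)// ltW// (lt_trans d0).
rewrite lerD2l /err; apply: ler_pM.
- by rewrite !mulr_ge0 ?exprn_ge0 ?(ltW kp) ?(ltW A0).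
- by rewrite exprn_ge0// divr_ge0// ltW.
- rewrite ler_wpM2r ?exprn_ge0// ler_wpM2l ?mulr_ge0 ?(ltW kp) ?(ltW A0)//.
rewrite lerXn2r ?nnegrE ?divr_ge0 ?invr_ge0 ?exprn_ge0 ?(ltW d0) ?(ltW r0)//.
by rewrite ler_pdivrMr// ler_pdivlMl ?exprn_gt0.
Qed.

Let integrate_lower k (m e : R) : let E := good_annulus b T c r k in
  0 <= m -> 0 <= e -> {ae mu, forall x, E x -> m * w x <= h x + e * w x} ->
  m * wm w E <= H k + e * wm w E.
Proof.
move=> E m0 e0 ae_le.
have mEk : measurable E := mE k.
have mwE : measurable_fun E (fun x => (w x)%:E) by exact: measurable_EFin_fun.
have wE : wmeas w E = (wm w E)%:E.
  by apply: (@wmE _ _ _ _ c (4 ^+ k.+1 * r)) => // x [[]].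
have HE : (H k)%:E = (\int[mu]_(x in E) (h x)%:E)%E by rewrite /H fineK// finH.
have mhE : measurable_fun E (fun x => (h x)%:E).
  by apply: measurable_funTS; exact/measurable_EFinP.
have w0E x : E x -> (0 <= (w x)%:E)%E by rewrite lee_fin.
rewrite -lee_fin EFinD !EFinM -wE HE /wmeas -!ge0_integralZl_EFin//.
rewrite -ge0_integralD//.
- apply: ae_ge0_le_integral => //.
  + by move=> x _; rewrite mule_ge0 ?lee_fin.
  + exact: measurable_funeM.
  + by move=> x _; rewrite adde_ge0 ?mule_ge0 ?lee_fin.
  + by apply: emeasurable_funD => //; exact: measurable_funeM.
- by move=> x _; rewrite lee_fin.
- by move=> x _; rewrite mule_ge0 ?lee_fin.
- exact: measurable_funeM.
Qed.

Lemma integrated_lower k : 2 <= 4 ^+ k :> R -> 8 * q <= 4 ^+ k ->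
  kappa * A * O / 8 / (4 ^+ k.+1 * r) ^+ n * wm w (good_annulus b T c r k) <=
  H k + err k * wm w (good_annulus b T c r k).
Proof.
move=> k2 kq; apply: integrate_lower => //.
  rewrite !divr_ge0 ?mulr_ge0 ?(ltW kp) ?(ltW A0) ?(ltW O0)//.
  by rewrite exprn_ge0// mulr_ge0 ?exprn_ge0// ltW.
have gall : {ae mu, forall x, forall j, g j x = commutator b j a x}.
  by apply: filter_forall => j; exact: gae.
by apply: filterS gall => x gx Ex; exact: pointwise_lower.
Qed.

(** [D2] is the inverse of the coefficient left in the main term after passing to the good annulus;
    [D1] collects the constants of [err] and of the growth of w. *)
Let D2 : R := 8 * 4 ^+ n / (kappa * kap).
Let D1 : R := kappa * q * T * 2 ^+ n * C * 4 ^+ n.+1.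

Let D2_gt0 : 0 < D2. Proof. by rewrite divr_gt0 ?mulr_gt0 ?exprn_gt0. Qed.

(** An upper bound for the integral of w / |x - c|^n over the k-th annulus. *)
Let chunk k : R := wk k.+1 / (4 ^+ k * r) ^+ n.

(** The good annulus has at least the share kap of the mass of the whole ball, so the main term
    recovers the full chunk. In the error, A = 1/w(B) cancels the w(B) of the growth bound and
    4^(-k(n+1)) its exponential part, which leaves (k + 2) t^(k+1). *)
Lemma far_chunk k : 2 <= 4 ^+ k :> R -> 8 * q <= 4 ^+ k ->
  chunk k * (A * O) <= D2 * (H k + D1 * (k.+2%:R * t ^+ k.+1)).
Proof.
move=> k2 kq; have := integrated_lower k2 kq.
set E := good_annulus b T c r k; set wE := wm w E.
have rk0 : 0 < 4 ^+ k * r by rewrite mulr_gt0// exprn_gt0.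
have wEge : kap * wk k.+1 <= wE by exact: good_large.
have wEle : wE <= wk k.+1.
  by apply: (@le_wm _ _ _ _ _ c (4 ^+ k.+1 * r)) => //; [exact: mE|exact: measurable_eball|move=> x [[]]].
have growk : wk k.+1 <= C * (4 ^+ n.+1 * t) ^+ k.+1 * A^-1 by rewrite /A invrK; exact: Hg.
have errle : err k * wE <= D1 * (k.+2%:R * t ^+ k.+1).
  apply: (le_trans (ler_wpM2l (err_ge0 k) (le_trans wEle growk))).
  rewrite le_eqVlt; apply/orP; left; apply/eqP; rewrite /err /D1.
  rewrite exprMn exprVn (exprAC 4 k) [(4 ^+ n.+1) ^+ k.+1]exprS.
  by apply: error_identity; [rewrite gt_eqF|rewrite !expf_neq0].
have main : (chunk k * (A * O)) / D2 <= kappa * A * O / 8 / (4 ^+ k.+1 * r) ^+ n * wE.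
  have m0 : 0 <= kappa * A * O / 8 / (4 ^+ k.+1 * r) ^+ n.
    rewrite !divr_ge0 ?mulr_ge0 ?(ltW kp) ?(ltW A0) ?(ltW O0)//.
    by rewrite exprn_ge0// mulr_ge0 ?exprn_ge0// ltW.
  apply: le_trans (ler_wpM2l m0 wEge).
  rewrite le_eqVlt; apply/orP; left; apply/eqP; rewrite /chunk /D2 (exprS 4) -(mulrA 4) [(4 * _) ^+ n]exprMn.
  by apply: main_identity; rewrite ?expf_neq0 ?mulf_neq0 ?expf_neq0// gt_eqF.
move=> HH; rewrite -ler_pdivrMl// [leLHS]mulrC.
by rewrite (le_trans main)// (le_trans HH)// lerD2l.
Qed.

Let Q k : R := C * (4 ^+ n.+1) ^+ k.+1 * (beta * 2 ^+ n).

(** No cancellation: w(B(c, 4^(k+1) r)) / w(B) is bounded by growth, and O by beta (2r)^n, whose r^n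
    is absorbed by the denominator. The bound explodes with k, hence is spent only below k0. *)
Lemma near_chunk k : chunk k * (A * O) <= Q k.
Proof.
have rk0 : 0 < 4 ^+ k * r by rewrite mulr_gt0// exprn_gt0.
have rn0 : 0 < r ^+ n by rewrite exprn_gt0.
have growk : wk k.+1 * A <= C * (4 ^+ n.+1) ^+ k.+1.
  have := Hg c k.+1 r0; rewrite -ler_pdivrMr ?wpos// -/A => /le_trans; apply.
  rewrite ler_wpM2l ?(ltW C0)// exprMn ler_piMr ?exprn_ge0//.
  by rewrite exprn_ile1 ?(ltW t0) ?(ltW t1).
have Ole : O <= beta * 2 ^+ n * r ^+ n.
  apply: (le_trans (osc_le c r0)); rewrite -mulrA ler_wpM2l ?(ltW beta0)// -exprMn.
  by rewrite vol_eball_le// ltW.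
have rkr : r ^+ n <= (4 ^+ k * r) ^+ n.
  by rewrite lerXn2r ?nnegrE ?(ltW r0) ?(ltW rk0)// ler_peMl ?(ltW r0)// exprn_ege1// ler1n.
rewrite /chunk mulrAC mulrA ler_pdivrMr ?exprn_gt0//.
have O' : O <= beta * 2 ^+ n * (4 ^+ k * r) ^+ n.
  by rewrite (le_trans Ole)// ler_wpM2l// mulr_ge0 ?exprn_ge0// ltW.
have := ler_pM _ (ltW O0) growk O'.
rewrite mulr_ge0 ?wm_ge0 ?(ltW A0)// => /(_ isT)/le_trans; apply.
by rewrite /Q -[leRHS]mulrA.
Qed.

Lemma chunk_sum k0 N : 2 <= 4 ^+ k0 :> R -> 8 * q <= 4 ^+ k0 ->
  (\sum_(0 <= k < N) chunk k) * (A * O) <=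
    \sum_(0 <= k < k0) Q k + D2 * (M + D1 * (1 - t) ^- 2).
Proof.
move=> k2 kq.
have Q0 k : 0 <= Q k.
  by rewrite !mulr_ge0 ?exprn_ge0 ?(ltW C0) ?(ltW beta0).
have D10 : 0 <= D1.
  by rewrite !mulr_ge0 ?exprn_ge0 ?(ltW C0) ?(ltW kp) ?(ltW T0).
have tk0 k : 0 <= k.+2%:R * t ^+ k.+1 by rewrite mulr_ge0 ?exprn_ge0 ?(ltW t0).
have rest0 k : 0 <= D2 * (H k + D1 * (k.+2%:R * t ^+ k.+1)).
  by rewrite mulr_ge0 ?(ltW D2_gt0)// addr_ge0// mulr_ge0.
have one k : chunk k * (A * O) <= (if (k < k0)%N then Q k else 0) +
    D2 * (H k + D1 * (k.+2%:R * t ^+ k.+1)).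
  case: ifPn => kk0; first by rewrite (le_trans (near_chunk k))// lerDl.
  rewrite add0r -leqNgt in kk0 *.
  have k4 : 4 ^+ k0 <= 4 ^+ k :> R by rewrite ler_weXn2l// ler1n.
  by rewrite far_chunk// (le_trans _ k4).
rewrite mulr_suml; apply: (le_trans (ler_sum _ (fun k _ => one k))).
rewrite big_split/=; apply: lerD.
  rewrite -big_mkcond/=.
  have [k0N|Nk0] := leqP k0 N.
    rewrite (big_cat_nat (leq0n k0) k0N)//= [X in _ + X]big_nat_cond [X in _ + X]big1 ?addr0.
      rewrite big_nat_cond [leRHS]big_nat_cond le_eqVlt; apply/orP; left; apply/eqP.
      by apply: eq_bigl => k; case: (k < k0)%N; rewrite ?andbF ?andbT.
    by move=> k /andP[/andP[kk _]]; rewrite ltnNge kk.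
  rewrite [leRHS](big_cat_nat (leq0n N) (ltnW Nk0))//= -[leLHS]addr0; apply: lerD; last by apply: sumr_ge0.
  rewrite big_nat_cond [leRHS]big_nat_cond le_eqVlt; apply/orP; left; apply/eqP.
  by apply: eq_bigl => k; case: (ltnP k N) => kN; rewrite ?(ltn_trans kN Nk0).
rewrite -mulr_sumr ler_wpM2l ?(ltW D2_gt0)// big_split/=; apply: lerD; first exact: sumH.
rewrite -mulr_sumr ler_wpM2l//.
(* The terms (k + 2) t^(k+1) are those of the arithmetic-geometric series shifted by one, so one
   more term is taken and the first dropped. *)
apply: le_trans (arith_geometric_sum_le N.+1 t01).
by rewrite big_nat_recl//= lerDr mulr_ge0.
Qed.

(** The complement of B is split into annuli, on the k-th of which |x - c| >= 4^k r. The right side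
    involves neither the centre nor the radius, so it bounds the supremum over balls. *)
Lemma weighted_osc_le k0 : 2 <= 4 ^+ k0 :> R -> 8 * q <= 4 ^+ k0 ->
  (\int[mu]_(x in ~` B) (w x / enorm (x - c) ^+ n)%:E * (A%:E * O%:E) <=
    (\sum_(0 <= k < k0) Q k + D2 * (M + D1 * (1 - t) ^- 2))%:E)%E.
Proof.
move=> k2 kq; set S := _ + _.
have AO0 : 0 < A * O by exact: mulr_gt0.
rewrite -EFinM -lee_pdivlMr//.
have mker : measurable_fun setT (fun x => w x / enorm (x - c) ^+ n).
  apply: measurable_funM => //.
  have -> : (fun x => (enorm (x - c) ^+ n)^-1) = (fun x => (enorm (x - c) `^ (- 1)) ^+ n).
    by apply/funext => x; rewrite powRN powRr1 ?enorm_ge0// exprVn.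
  apply: (measurableT_comp (exprn_measurable _)).
  by apply: (measurableT_comp (measurable_powR _) (enormB_measurable c)).
rewrite integral_compl_ball//; last 2 first.
- exact/measurable_EFinP.
- by move=> x; rewrite lee_fin divr_ge0// exprn_ge0// enorm_ge0.
apply: nneseries_le => [k|N].
  by apply: integral_ge0 => x _; rewrite lee_fin divr_ge0// exprn_ge0// enorm_ge0.
apply: (@le_trans _ _ (\sum_(0 <= k < N) (chunk k)%:E)%E); last first.
  by rewrite sumEFin -EFinM lee_fin ler_pdivlMr// chunk_sum.
apply: lee_sum => k _.
have rk0 : 0 < 4 ^+ k * r by rewrite mulr_gt0// exprn_gt0.
have mA := measurable_annulus c r k.
apply: (@le_trans _ _ (\int[mu]_(x in annulus c r k) (((4 ^+ k * r) ^+ n)^-1%:E * (w x)%:E))%E).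
  apply: ge0_le_integral => //.
  - by move=> x _; rewrite lee_fin divr_ge0// exprn_ge0// enorm_ge0.
  - by apply: measurable_funTS; exact/measurable_EFinP.
  - by apply: measurable_funeM; exact: measurable_EFin_fun.
  move=> x [_ xk]; rewrite -EFinM lee_fin mulrC ler_wpM2r//.
  have dk : 4 ^+ k * r <= enorm (x - c) by rewrite leNgt; apply/negP.
  have d0 := lt_le_trans rk0 dk.
  by rewrite lef_pV2 ?posrE ?exprn_gt0// lerXn2r ?nnegrE ?(ltW d0) ?(ltW rk0).
rewrite ge0_integralZl_EFin//; last 3 first.
- by move=> x _; rewrite lee_fin.
- exact: measurable_EFin_fun.
- by rewrite invr_ge0 exprn_ge0// ltW.
have -> : (chunk k)%:E = (((4 ^+ k * r) ^+ n)^-1%:E * (wk k.+1)%:E)%E.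
  by rewrite -EFinM mulrC.
apply: lee_wpmul2l; first by rewrite lee_fin invr_ge0 exprn_ge0// ltW.
rewrite -/(wmeas w _) (@wmE _ _ _ _ c (4 ^+ k.+1 * r))//; last by move=> x [].
rewrite lee_fin; apply: (@le_wm _ _ _ _ _ c (4 ^+ k.+1 * r)) => //.
  exact: measurable_eball.
by move=> x [].
Qed.

End one_ball.
End chunks.

(** * Assembly: the constants are fixed before the ball is chosen *)

Theorem mainTheorem2 (R : realType) (n : nat) (delta : R)
    (phi w b : 'rV[R]_n -> R) :
  (0 < n)%N ->
  0 < delta -> delta <= 1 ->
  schwartz phi -> (forall x, eball 0 1 x -> phi x = 1) ->
  muckenhoupt (1 + delta / n%:R) w ->
  (\int[leb n]_x (w x / (1 + enorm x ^+ n))%:E < +oo)%E ->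
  bmo b ->
  (forall j : 'I_n, bounded_H1w_L1w phi w (commutator b j)) ->
  bmow w b.
Proof.
move=> n0 d0 d1 sphi _ Apw _ bmob Hbdd; have lb : loc_integrable b by case: bmob.
split=> //.
have nR0 : 0 < (n%:R : R) by rewrite ltr0n.
have p1 : 1 < 1 + delta / n%:R by rewrite ltrDl divr_gt0.
have pn : 1 + delta / n%:R <= 1 + n%:R^-1.
  by rewrite lerD2l ler_pdivrMr// mulVf// gt_eqF.
have dw := muckenhoupt_density Apw.
have wpos := @muckenhoupt_gt0 _ _ n0 _ _ Apw.
have [C [t [C0 t01 Hg]]] := muckenhoupt_growth n0 p1 Apw pn.
have [T [eta [T0 eta0 HT]]] := vol_good_annulus n0 bmob.
have [kap kap0 Hkap] := muckenhoupt_ainfty n0 p1 Apw eta0.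
have [beta beta0 Hbeta] := bmo_bound n0 bmob.
have large c r k : 0 < r ->
    kap * wm w (eball c (4 ^+ k.+1 * r)) <= wm w (good_annulus b T c r k).
  move=> r0; apply: Hkap.
  - by rewrite mulr_gt0// exprn_gt0.
  - exact: measurable_good_annulus.
  - by move=> x [[]].
  - exact: HT.
have /choice[M HM] : forall j : 'I_n, exists Mj : R, forall a c r, 0 < r ->
    continuous a -> cancelling a c r (wm w (eball c r))^-1 ->
    exists g : 'rV[R]_n -> R, [/\ measurable_fun setT g,
      (\int[leb n]_x (`|g x| * w x)%:E <= Mj%:E)%E &
      {ae leb n, forall x, g x = commutator b j a x}].
  move=> j; have [Mj _ HMj] := bounded_on_atoms n0 sphi dw wpos C0 t01 Hg (Hbdd j).
  by exists Mj.
pose q : R := n%:R * (2 ^+ n.+1 + n.+1%:R * 4 ^+ n.+1).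
have q0 : 0 <= q by rewrite mulr_ge0// addr_ge0 ?mulr_ge0 ?exprn_ge0.
have [k0 k2 kq] : exists2 k0, 2 <= 4 ^+ k0 :> R & 8 * q <= 4 ^+ k0.
  exists (Num.truncn (8 * q)).+1.
    have : 1 <= 4 ^+ Num.truncn (8 * q) :> R by rewrite exprn_ege1// ler1n.
    by rewrite exprS; lra.
  apply: (le_trans (ltW (truncnS_gt _))).
  by rewrite -natrX ler_nat ltnW// ltn_expl.
set S := (\sum_(0 <= k < k0) (C * (4 ^+ n.+1) ^+ k.+1 * (beta * 2 ^+ n)) +
  8 * 4 ^+ n / (@riesz_const R n * kap) * (\sum_j M j +
    @riesz_const R n * q * T * 2 ^+ n * C * 4 ^+ n.+1 * (1 - t) ^- 2)).
(* The 0 serves the balls on which b does not oscillate, [S] all the others. *)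
apply: (@le_lt_trans _ _ (Num.max 0 S)%:E); last by rewrite ltry.
apply: ub_ereal_sup => _ [[c r] /= r0 <-].
have mB := @measurable_eball R n c r.
rewrite -(Rintegral_EFin mB (integrable_normB bmob c r (avg (eball c r) b))).
set osc := \int[leb n]_(x in eball c r) _.
have osc_ge0 : 0 <= osc by apply: Rintegral_ge0.
(* The test function exists only for positive oscillation; for zero oscillation the product
   vanishes. *)
have [osc0|osc0] := eqVneq osc 0.
  by rewrite osc0 mule0 mule0 lee_fin le_max lexx.
have {osc_ge0}osc0 : 0 < osc by rewrite lt_neqAle eq_sym osc0.
have W0 := wpos c r r0.
pose f x := b x - avg (eball c r) b.
have mf : measurable_fun setT f by apply: measurable_funB => //; case: lb.
have fi : (leb n).-integrable (eball c r) (EFin \o f) by exact: (integrable_sub_cst bmob).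
have V0 := vol_eball_gt0 c n0 r0.
have f_mean0 : \int[leb n]_(x in eball c r) f x = 0.
  rewrite RintegralB//; [|exact: loc_integrable_eball|exact: integrable_cst_eball].
  rewrite Rintegral_cst// /avg -/(vol _) mulrAC mulVf ?gt_eqF// mul1r subrr//.
have [u [cu u2 uB u0 uO]] := test_function n0 r0 mf fi f_mean0 osc0.
pose A := (wm w (eball c r))^-1.
have A0 : 0 < A by rewrite invr_gt0.
(* As |u| <= 2, the factor A/2 gives |a| <= A = 1/w(B); the pairing of u with f, at least osc/2,
   becomes A osc/4. *)
pose a x := A / 2 * u x.
have ui : (leb n).-integrable setT (EFin \o u).
  exact: (ball_bounded_integrable _ (rV_continuous_measurable cu) u2 uB).1.
have ca : continuous a by move=> x; refine (cvgM (cvg_cst _) (cu x)).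
have ha : cancelling a c r A.
  split.
  - exact: rV_continuous_measurable.
  - move=> x; rewrite /a normrM gtr0_norm ?divr_gt0// mulrAC -mulrA ger_pMr//.
    by rewrite ler_pdivrMr// mul1r.
  - by move=> x /uB; rewrite /a => ->; rewrite mulr0.
  - by rewrite RintegralZl// u0 mulr0.
have a_large : A * osc / 4 <= \int[leb n]_(x in eball c r) (a x * f x).
  have -> : \int[leb n]_(x in eball c r) (a x * f x) =
      A / 2 * \int[leb n]_(x in eball c r) (u x * f x).
    rewrite -RintegralZl//.
      by apply: eq_Rintegral => x _; rewrite /a mulrA.
    apply: (@integrable_mul_bounded _ _ _ _ _ _ 2) => //.
    exact: rV_continuous_measurable.
  have A20 : 0 <= A / 2 by rewrite ltW// divr_gt0.
  apply: le_trans (ler_wpM2l A20 uO); rewrite le_eqVlt; apply/orP; left; apply/eqP.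
  by rewrite -/osc; move: A osc {a ca ha A0 A20 osc0 uO} => A osc; field.
have /choice[g Hgj] : forall j, exists g : 'rV[R]_n -> R, [/\ measurable_fun setT g,
      (\int[leb n]_x (`|g x| * w x)%:E <= (M j)%:E)%E &
      {ae leb n, forall x, g x = commutator b j a x}].
  by move=> j; exact: HM ca ha.
have w0 x : 0 <= w x by case: dw.
have mw : measurable_fun setT w by case: dw.
have mg j : measurable_fun setT (g j) by have [] := Hgj j.
have gM : (\int[leb n]_x (\sum_j `|g j x| * w x)%:E <= (\sum_j M j)%:E)%E.
  under eq_integral do rewrite -sumEFin.
  rewrite ge0_integral_sum//.
  - by rewrite -sumEFin; apply: lee_sum => j _; have [] := Hgj j.
  - move=> j; apply/measurable_EFinP; apply: measurable_funM => //; exact: measurableT_comp.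
  - by move=> j x _; rewrite lee_fin mulr_ge0.
have gae j : {ae leb n, forall x, g j x = commutator b j a x} by have [] := Hgj j.
have := weighted_osc_le dw C0 t01 Hg wpos bmob T0 kap0 beta0 large Hbeta
  (riesz_const_gt0 n0) erefl q0 erefl r0 ha osc0 a_large mg gM gae k2 kq.
move=> /le_trans; apply; rewrite lee_fin le_max; apply/orP; right.
exact: lexx.
Qed.
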